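(* Fix $\varphi\in[-\pi,\pi]$ and put $a_{\varphi,+}:=\cos\frac{|\varphi|}{2}$, $a_{\varphi,-}:=\sin\frac{|\varphi|}{2}$. For even $N$ define the probability measure $$\mu_{N,\varphi}:=\frac1N\sum_{z\in\operatorname{spec}A_N(\varphi,0)}\delta_z,$$ where eigenvalues are counted with algebraic multiplicity. Define $$g_{\varphi,\pm}(t):=\begin{cases}\dfrac1{\pi^2}\,\mathsf K\Bigl(\sqrt{a_{\varphi,\pm}^2-\tfrac{t^2}{4}}\Bigr),&|t|<2a_{\varphi,\pm},\\ 0,&|t|\ge2a_{\varphi,\pm}.\end{cases}$$ Then, as $N\to\infty$ through even integers, weakly as probability measures on $\mathbb C$, $$\mu_{N,\varphi}\Longrightarrow \mu_\varphi:=(R_{\varphi/2})_{\#}\bigl(g_{\varphi,+}(t)\,dt\bigr)+(R_{\varphi/2+\pi/2})_{\#}\bigl(g_{\varphi,-}(t)\,dt\bigr).$$ The two measures on the two lines have masses $$\int_{\mathbb R}g_{\varphi,+}(t)\,dt=1-\frac{|\varphi|}{\pi},\qquad \int_{\mathbb R}g_{\varphi,-}(t)\,dt=\frac{|\varphi|}{\pi}.$$ If $a_{\varphi,\pm}>0$, the support of the corresponding measure $g_{\varphi,\pm}(t)\,dt$ is $[-2a_{\varphi,\pm},2a_{\varphi,\pm}]$; if $a_{\varphi,\pm}=0$, that measure vanishes and its support is empty. For every polynomial $P(z,\bar z)$, as $N\to\infty$ through even integers, $$\frac1N\sum_{z\in\operatorname{spec}A_N(\varphi,0)}P(z,\bar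 z)=\int_{\mathbb C}P(z,\bar z)\,d\mu_\varphi(z)+\mathcal O_{P,\varphi}(N^{-1})$$ (eigenvalues counted with algebraic multiplicity). In particular, for $\varphi=\pi/2$, $a_{\pi/2,+}=a_{\pi/2,-}=\frac1{\sqrt2}$ and $g_{\pi/2,+}=g_{\pi/2,-}$.
   Context: Indices of $\mathbb C^N$ are in $\mathbb Z/N\mathbb Z$; $Se_j=e_{j+1}$ is the periodic shift and $$A_N(\varphi,\vartheta)=e^{i\varphi}\frac{S+S^{-1}}2+\operatorname{diag}\bigl(\cos(\tfrac{2\pi j}{N}+\vartheta)\bigr)_{j\in\mathbb Z/N\mathbb Z}.$$ $\mathsf K$ is the complete elliptic integral of the first kind in the modulus convention: $\mathsf K(k)=\int_0^{\pi/2}\frac{d\alpha}{\sqrt{1-k^2\sin^2\alpha}}$ for $0\le k<1$, and $\mathsf K(1)=+\infty$. For $\alpha\in\mathbb R$, $R_\alpha:\mathbb R\to\mathbb C$, $R_\alpha(t)=e^{i\alpha}t$. For a measure $\nu$ and a map $T$, $T_{\#}\nu$ is the push-forward, $(T_{\#}\nu)(E)=\nu(T^{-1}(E))$. $\delta_z$ is the point mass at $z$. Implied constants in $\mathcal O_{P,\varphi}$ may depend on $P$ and $\varphi$. *)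

(* Defs.v *)
From HB Require Import structures.
From mathcomp Require Import all_boot all_order all_algebra.
From mathcomp Require Import all_classical all_reals all_analysis.
From mathcomp Require Import measurable_realfun.
From mathcomp.real_closed Require Import complex.

Set Implicit Arguments.
Unset Strict Implicit.
Unset Printing Implicit Defensive.

Import Order.TTheory GRing.Theory Num.Theory.
Import numFieldNormedType.Exports.

Local Open Scope classical_set_scope.
Local Open Scope ring_scope.

Section Matrices.
Variable R : realType.

Definition expi (t : R) : R[i] := (cos t +i* sin t)%C.

(* ordS is the successor in Z/N, with representatives 0 to N - 1. *)
Definition shift (N : nat) : 'M[R[i]]_N := \matrix_(i, j) (i == ordS j)%:R.

Lemma shiftE N (j : 'I_N) :
  shift N *m delta_mx j (0 : 'I_1) = delta_mx (ordS j) (0 : 'I_1).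
Proof.
by rewrite -colE; apply/colP => i; rewrite !mxE eqxx andbT.
Qed.

Definition Amx (N : nat) (phi theta : R) : 'M[R[i]]_N :=
  (expi phi / 2) *: (shift N + invmx (shift N))
  + diag_mx (\row_j (cos (2 * pi * j%:R / N%:R + theta))%:C%C).

(* The roots of the characteristic polynomial, repeated according to their
   multiplicities (in an unspecified order). *)
Definition spec (N : nat) (A : 'M[R[i]]_N) : seq R[i] :=
  sval (closed_field_poly_normal (char_poly A)).

Lemma specP (N : nat) (A : 'M[R[i]]_N) :
  char_poly A = \prod_(z <- spec A) ('X - z%:P).
Proof.
rewrite /spec; case: closed_field_poly_normal => r /= rE.
by rewrite [LHS]rE (monicP (char_poly_monic A)) scale1r.
Qed.

Lemma size_spec (N : nat) (A : 'M[R[i]]_N) : size (spec A) = N.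
Proof.
by apply: succn_inj; rewrite -(size_char_poly A) specP size_prod_XsubC.
Qed.

End Matrices.

(* The complex plane with its Borel sigma-algebra; the topology is the one
   MathComp-Analysis attaches to the absolute value of a numClosedFieldType. *)
Definition borelC (R : realType) :=
  g_sigma_algebraType (@open (R[i] : numClosedFieldType)).

HB.instance Definition _ (R : realType) := Measurable.on (borelC R).

Section Measures.
Variable R : realType.
Local Notation mu := (@lebesgue_measure R).

(* Extended-real valued: ellK 1 = +oo. Only moduli 0 <= k <= 1 matter. *)
Definition ellK (k : R) : \bar R :=
  if k < 1 then
    (\int[mu]_(x in `[0%R, (pi / 2)%R])
       ((Num.sqrt (1 - k ^+ 2 * sin x ^+ 2))^-1)%:E)%E
  else +oo%E.

Definition gdens (a t : R) : \bar R :=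
  if `|t| < 2 * a then
    ((pi ^+ 2)^-1%:E * ellK (Num.sqrt (a ^+ 2 - t ^+ 2 / 4)))%E
  else 0%E.

Lemma ellK_ge0 k : (0 <= ellK k)%E.
Proof.
rewrite /ellK; case: ifP => // _; apply: integral_ge0 => x _.
by rewrite lee_fin invr_ge0 sqrtr_ge0.
Qed.

Lemma gdens_ge0 a t : (0 <= gdens a t)%E.
Proof.
rewrite /gdens; case: ifP => // _; apply: mule_ge0; last exact: ellK_ge0.
by rewrite lee_fin invr_ge0 exprn_ge0// pi_ge0.
Qed.

Lemma measurable_inv : measurable_fun [set: R] (@GRing.inv R).
Proof.
rewrite (_ : @GRing.inv R = fun x => if x == 0 then 0 else x^-1); last first.
  by apply/funext => x; case: eqP => // ->; rewrite invr0.
have m0 : measurable_fun [set: R] (fun x : R => x == 0).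
  apply: (measurable_fun_bool true) => //; rewrite setTI.
  rewrite (_ : _ @^-1` _ = [set 0 : R]).
    exact: measurable_set1.
  by apply/seteqP; split => [x /eqP | x ->] /=; rewrite ?eqxx.
apply: measurable_fun_if => //.
rewrite setTI (_ : _ @^-1` _ = [set x : R | x != 0]); last first.
  by apply/seteqP; split => x /= => [->|/negbTE ->].
apply: open_continuous_measurable_fun; first exact: open_neq.
by move=> x; rewrite inE /= => /inv_continuous.
Qed.

Lemma measurable_ellK : measurable_fun [set: R] ellK.
Proof.
apply: measurable_fun_ifT => //; first exact: measurable_fun_ltr.
pose f (u : measurableTypeR R * measurableTypeR R) : \bar R :=
  (((Num.sqrt (1 - u.1 ^+ 2 * sin u.2 ^+ 2))^-1)%:E
   * (\1_(`[0, pi / 2]%classic : set R) u.2)%:E)%E.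
rewrite (_ : (fun _ => _) = fubini_F mu f); last first.
  apply/funext => k; rewrite integral_mkcond epatch_indic.
  by apply: eq_integral.
apply: measurable_fun_fubini_tonelli_F; last first.
  by move=> u; rewrite mule_ge0// lee_fin ?invr_ge0 ?sqrtr_ge0.
apply: emeasurable_funM; apply/measurable_EFinP; last first.
  by apply: measurableT_comp => //; exact: measurable_indic.
apply: (measurableT_comp measurable_inv).
apply: (measurableT_comp (continuous_measurable_fun (@sqrt_continuous R))).
apply: measurable_funB => //; apply: measurable_funM.
  exact: measurable_funX.
apply: measurable_funX.
exact: (measurableT_comp (continuous_measurable_fun (@continuous_sin R))).
Qed.

Lemma measurable_gdens a : measurable_fun [set: R] (gdens a).
Proof.
apply: measurable_fun_ifT => //.
  by apply: measurable_fun_ltr => //; exact: measurableT_comp.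
apply: emeasurable_funM => //.
apply: (measurableT_comp measurable_ellK).
apply: (measurableT_comp (continuous_measurable_fun (@sqrt_continuous R))).
apply: measurable_funB => //; apply: measurable_funM => //.
Qed.

(* The measure gdens a t dt on the real line. *)
Definition gmeasure (a : R) (A : set (measurableTypeR R)) : \bar R :=
  (\int[mu]_(t in A) gdens a t)%E.

Let gmeasure0 a : gmeasure a set0 = 0%E.
Proof. by rewrite /gmeasure integral_set0. Qed.

Let gmeasure_ge0 a A : (0 <= gmeasure a A)%E.
Proof. by apply: integral_ge0 => t _; exact: gdens_ge0. Qed.

Let gmeasure_sigma_additive a : semi_sigma_additive (gmeasure a).
Proof.
apply: semi_sigma_additive_nng_induced; last exact: gdens_ge0.
exact: measurable_gdens.
Qed.

HB.instance Definition _ a := isMeasure.Build _ _ _ (gmeasure a)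
  (gmeasure0 a) (gmeasure_ge0 a) (@gmeasure_sigma_additive a).

Definition Rot (alpha : R) (t : measurableTypeR R) : borelC R :=
  expi alpha * (t : R)%:C%C.

Lemma continuous_Rot alpha :
  continuous (Rot alpha : R -> (R[i] : numClosedFieldType)).
Proof.
move=> t; apply/cvgrPdist_lt => e e0.
have eE : e = (complex.Re e)%:C%C.
  by move: e0; case: e => x y; rewrite ltcE /= => /andP[/eqP -> _].
have {}e0 : 0 < complex.Re e by rewrite -ltcR -eE.
near=> s.
rewrite /Rot -mulrBr normrM.
have -> : `|expi alpha| = 1 by rewrite normc_def /= cos2Dsin2 sqrtr1.
rewrite mul1r -rmorphB /= normc_def /= expr0n /= addr0 sqrtr_sqr eE ltcR.
by near: s; exact: (@cvgr_dist_lt _ _ _ _ _ id).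
Unshelve. all: by end_near. Qed.

Lemma measurable_Rot alpha : measurable_fun [set: measurableTypeR R] (Rot alpha).
Proof.
apply: (@measurability _ _ (measurableTypeR R) (borelC R) setT (Rot alpha)
  (@open (R[i] : numClosedFieldType))) => //.
move=> _ [U oU <-]; rewrite setTI; apply: open_measurable.
by move/continuousP : (@continuous_Rot alpha); exact.
Qed.

HB.instance Definition _ alpha :=
  isMeasurableFun.Build _ _ _ _ (Rot alpha) (measurable_Rot alpha).

Section pushforward_Rot.
Variables (alpha : R) (nu : {measure set (measurableTypeR R) -> \bar R}).

Definition Rot_push : set (borelC R) -> \bar R := pushforward nu (Rot alpha).

Let Rot_push0 : Rot_push set0 = 0%E.
Proof. exact: measure0. Qed.

Let Rot_push_ge0 A : (0 <= Rot_push A)%E.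
Proof. exact: measure_ge0. Qed.

Let Rot_push_sigma_additive : semi_sigma_additive Rot_push.
Proof. exact: measure_semi_sigma_additive. Qed.

HB.instance Definition _ := isMeasure.Build _ _ _ Rot_push
  Rot_push0 Rot_push_ge0 Rot_push_sigma_additive.

End pushforward_Rot.

Definition aplus (phi : R) : R := cos (`|phi| / 2).
Definition aminus (phi : R) : R := sin (`|phi| / 2).

Definition mu_lim (phi : R) : {measure set (borelC R) -> \bar R} :=
  measure_add
    (Rot_push (phi / 2) (gmeasure (aplus phi)))
    (Rot_push (phi / 2 + pi / 2) (gmeasure (aminus phi))).

Definition mu_spec (N : nat) (phi : R) : {measure set (borelC R) -> \bar R} :=
  let s := spec (Amx N phi 0) in
  mscale (N%:R^-1)%:nng (msum (fun k => \d_(s`_k : borelC R)) (size s)).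

Definition weak_cvg (m : nat -> {measure set (borelC R) -> \bar R})
    (F : set_system nat) (m0 : {measure set (borelC R) -> \bar R}) :=
  forall f : (R[i] : numClosedFieldType) -> R, continuous f -> bounded_fun f ->
    (\int[m n]_z f z @[n --> F] --> \int[m0]_z f z).

Definition supp (nu : set (measurableTypeR R) -> \bar R) : set R :=
  [set x | forall U : set R, open U -> U x -> (0 < nu U)%E].

(* P(z, w) is encoded in C[z][w]: the outer indeterminate stands for the
   conjugate of z, the coefficients are polynomials in z. *)
Definition peval (P : {poly {poly R[i]}}) (z : R[i]) : R[i] :=
  P.[(z^*)%C%:P].[z].

Definition cintegral (m : {measure set (borelC R) -> \bar R})
    (f : R[i] -> R[i]) : R[i] :=
  ((\int[m]_z complex.Re (f z)) +i* (\int[m]_z complex.Im (f z)))%C.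

End Measures.

Definition even_oo : set_system nat := within [set N | ~~ odd N] \oo.

(* Main.v *)
(* Write N = 2M. On a basis of quadratic-phase vectors A_N(phi, 0) becomes a
   nearest-neighbour hopping operator on a cycle of length 2M with zero diagonal,
   so its spectrum is symmetric and its square is, on each sublattice, e^(i phi)
   times a real cyclic tridiagonal matrix. Up to a gauge transformation, that
   matrix is symmetric, with diagonal entries u_i + v_(i-1) and off-diagonal
   entries h_i, h_i^2 = u_i v_i, where u_i and v_i are consecutive samples of
   w(x) = (cos phi + cos x) / 2 and the starting sample is chosen at the sign
   change of w, so that u_i v_i >= 0. Hence the eigenvalues are the
   +-e^(i phi/2) sqrt(lambda_j) with lambda_j real: positive lambda_j lie on one
   line, negative ones on the other.

   As w varies slowly, the matrix is locally w times a signed cyclic Laplacian,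
   the diagonal entries of whose k-th power are binomial(2k, k). It is the
   difference of two such positive semidefinite matrices, built from the positive
   and the negative parts of w, so Jensen bounds both power sums of eigenvalues
   from above; restricting the trace of the k-th power to the sites with w > 0 (k
   odd), or subtracting the other bound from the full trace (k even), bounds them
   from below. Thus sum_j max(lambda_j, 0)^k is binomial(2k, k) times
   sum_i max(w_i, 0)^k up to O(1), a Riemann sum, and similarly for the negative
   part.

   Expanding the elliptic integral and (1 - x)^(-1/2) into series with central
   binomial coefficients shows that the limits are the even moments of
   g_(phi, +-); the odd moments vanish by symmetry. This proves the estimate for
   polynomials, and Bernstein polynomials on the two segments give weak
   convergence. *)

Require Import Defs.
From HB Require Import structures.
From mathcomp Require Import all_boot all_order all_algebra.
From mathcomp Require Import all_classical all_reals all_analysis.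
From mathcomp Require Import measurable_realfun.
From mathcomp.real_closed Require Import complex.
From mathcomp Require Import ring lra zify.

Set Implicit Arguments.
Unset Strict Implicit.
Unset Printing Implicit Defensive.

Import Order.TTheory GRing.Theory Num.Theory.
Import numFieldNormedType.Exports.

Local Open Scope classical_set_scope.
Local Open Scope ring_scope.

(** * Cyclic tridiagonal matrices *)

(** Two obstacles shape the proof. The real cyclic matrix is gauge equivalent to a symmetric one
    only if no amplitude vanishes and the products of the amplitudes around the cycle match. The
    match holds in absolute value by a reflection of the samples, and the signs [eps] are free to
    fix the rest; when a sample of w is exactly zero, similarity may fail and only characteristic
    polynomials are compared. The same reflection gives the positive samples an arc of even length,
    so that pairs of consecutive samples can avoid straddling a sign change.

    The power sums say nothing about the exponent 0, so the number of eigenvalues on each line is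
    never estimated. Polynomials vanishing at 0, the common point of the lines, are treated line by
    line; constants are recovered from the total count N and the total mass 1. For this reason the
    polynomial approximants in the weak limit take the exact value at 0.

    The error O(1) in the power sums is the total of M rows, each perturbed by O(1/M), the increment
    of w between neighbouring samples. *)

Section Cyclic.
Variables (R : comNzRingType) (M : nat).
Implicit Types u v p r : 'I_M -> R.

(** A sum over the bonds from i to [ordS i], not a table of entries: for M = 1 or 2, where bonds
    share entries, the contributions simply add up and no case distinction arises. *)
Definition cyc u v p r : 'M[R]_M := \sum_(i < M)
  (u i *: delta_mx i i + v i *: delta_mx (ordS i) (ordS i)
   + p i *: delta_mx i (ordS i) + r i *: delta_mx (ordS i) i).

Lemma cycD u v p r u' v' p' r' :
  cyc u v p r + cyc u' v' p' r' =
  cyc (u \+ u') (v \+ v') (p \+ p') (r \+ r').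
Proof.
rewrite /cyc -big_split /=; apply: eq_bigr => i _.
by apply/matrixP => x y; rewrite !mxE; ring.
Qed.

Lemma cycZ a u v p r :
  a *: cyc u v p r = cyc (a \*o u) (a \*o v) (a \*o p) (a \*o r).
Proof.
rewrite /cyc scaler_sumr; apply: eq_bigr => i _.
by rewrite !scalerDr !scalerA.
Qed.

Lemma eq_cyc u v p r u' v' p' r' : u =1 u' -> v =1 v' -> p =1 p' -> r =1 r' ->
  cyc u v p r = cyc u' v' p' r'.
Proof. by move=> eu ev ep er; apply: eq_bigr => i _; rewrite eu ev ep er. Qed.

Lemma diag_mul_cyc (D : 'rV[R]_M) u v p r : diag_mx D *m cyc u v p r =
  cyc (fun i => D 0 i * u i) (fun i => D 0 (ordS i) * v i)
      (fun i => D 0 i * p i) (fun i => D 0 (ordS i) * r i).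
Proof.
rewrite mulmx_sumr; apply: eq_bigr => i _.
rewrite !mulmxDr -!scalemxAr.
have H (a b : 'I_M) : diag_mx D *m delta_mx a b = D 0 a *: delta_mx a b.
  apply/matrixP => x y; rewrite mul_diag_mx !mxE.
  by case: eqP => [->|]; rewrite //= mulr0n !mulr0.
by rewrite !H !scalerA ![_ * D _ _]mulrC.
Qed.

Lemma cyc_mul_diag (D : 'rV[R]_M) u v p r : cyc u v p r *m diag_mx D =
  cyc (fun i => u i * D 0 i) (fun i => v i * D 0 (ordS i))
      (fun i => p i * D 0 (ordS i)) (fun i => r i * D 0 i).
Proof.
rewrite mulmx_suml; apply: eq_bigr => i _.
rewrite !mulmxDl -!scalemxAl.
have H (a b : 'I_M) : delta_mx a b *m diag_mx D = D 0 b *: delta_mx a b.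
  apply/matrixP => x y; rewrite mul_mx_diag !mxE.
  by case: eqP => [_|]; case: eqP => [->|]; rewrite //= ?mulr1 ?mul1r // !(mulr0,mul0r).
by rewrite !H !scalerA.
Qed.

Lemma tr_cyc u v p r : (cyc u v p r)^T = cyc u v r p.
Proof.
rewrite /cyc raddf_sum; apply: eq_bigr => i _ /=.
by rewrite !raddfD /= !linearZ /= !trmx_delta -!addrA; congr (_ + (_ + _)); rewrite addrC.
Qed.

End Cyclic.

Section CharPoly.
Variable F : fieldType.

Lemma horner_char_poly n (A : 'M[F]_n) x : (char_poly A).[x] = \det (x%:M - A).
Proof.
rewrite -[_.[x]]/(horner_eval x _) -det_map_mx; congr (\det _).
apply/matrixP => i j; rewrite !mxE /= /horner_eval hornerD hornerN hornerC.
by rewrite hornerMn hornerX.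
Qed.

Lemma similar_char_poly n (A B P : 'M[F]_n) :
  P \in unitmx -> A *m P = P *m B -> char_poly A = char_poly B.
Proof.
move=> uP AP.
have dP : \det (map_mx polyC P) != 0 :> {poly F}.
  by rewrite det_map_mx polyC_eq0 -unitfE.
apply/(mulIf dP); rewrite [RHS]mulrC /char_poly -!det_mulmx /char_poly_mx.
rewrite mulmxBl mulmxBr -!map_mxM AP /= scalar_mxC. by [].
Qed.

End CharPoly.

Section CyclicChar.
Variables (F : numFieldType) (M : nat).
Implicit Types u v p r h : 'I_M -> F.

Lemma eq_poly_num (p q : {poly F}) (S : F -> Prop) :
  (exists e : nat -> F, injective e /\ forall n, S (e n)) ->
  (forall x, S x -> p.[x] = q.[x]) -> p = q.
Proof.
move=> [e [ie Se]] pq; apply/eqP; rewrite -subr_eq0; apply/negPn/negP => nz.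
have := max_poly_roots nz (rs := [seq e n | n <- iota 0 (size (p - q))]).
rewrite size_map size_iota ltnn => H; apply: notF; apply: H.
  by apply/allP => _ /mapP[n _ ->]; rewrite rootE hornerD hornerN pq ?subrr.
by rewrite map_inj_uniq ?iota_uniq.
Qed.

(* If A is similar to B + tE for all t <> 0, letting t -> 0 shows that A and B
   have the same characteristic polynomial, although they need not be similar. *)
Lemma char_poly_degenerate n (A B E : 'M[F]_n) :
  (forall t, t != 0 -> exists2 P, P \in unitmx & A *m P = P *m (B + t *: E)) ->
  char_poly A = char_poly B.
Proof.
move=> AB; apply: (@eq_poly_num _ _ (fun=> True)).
  by exists (fun n => n%:R); split=> // m k /eqP; rewrite eqr_nat => /eqP.
move=> x _; rewrite !horner_char_poly.
(* For fixed x the determinant is a polynomial in t; being constant off 0, it is constant at 0 as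
   well. *)
pose Q : {poly F} := \det (map_mx polyC (x%:M - B) - 'X *: map_mx polyC E).
have QE t : Q.[t] = \det (x%:M - (B + t *: E)).
  rewrite -[_.[t]]/(horner_eval t _) -det_map_mx; congr (\det _).
  apply/matrixP => i j; rewrite !mxE /= /horner_eval !(hornerD,hornerN,hornerM,hornerC,hornerX).
  by rewrite opprD addrA.
have -> : x%:M - B = x%:M - (B + 0 *: E) by rewrite scale0r addr0.
rewrite -QE.
suff -> : Q = (\det (x%:M - A))%:P by rewrite hornerC.
apply: (@eq_poly_num _ _ (fun t => t != 0)).
  exists (fun n => n.+1%:R); split=> [m k /eqP|k]; last by rewrite pnatr_eq0.
  by rewrite eqr_nat eqSS => /eqP.
move=> t t0; rewrite QE hornerC -!horner_char_poly.
by have [P uP AP] := AB t t0; rewrite (similar_char_poly uP AP).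
Qed.

(** Partial products of [d] solve the recurrence along the cycle; the closing bond, from the last
    index back to 0, imposes the product condition. *)
Lemma cyc_gauge (d : 'I_M -> F) : (forall i, d i != 0) -> \prod_i d i = 1 ->
  exists2 D : 'rV[F]_M, diag_mx D \in unitmx &
    forall i, D 0 (ordS i) = d i * D 0 i.
Proof.
case: M d => [|m] d d0 d1.
  exists 0; first by rewrite unitmxE det_mx00 unitr1.
  by case.
pose e (k : nat) := d (inord k).
have e0 k : e k != 0 by exact: d0.
exists (\row_i \prod_(0 <= k < i) e k).
  rewrite unitmxE det_diag unitfE; apply/prodf_neq0 => i _.
  by rewrite mxE prodf_seq_neq0; apply/allP => k _; exact: e0.
move=> i; rewrite !mxE /=.
have [im|] := ltnP i.+1 m.+1.
  by rewrite modn_small // big_nat_recr //= mulrC /e inord_val.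
rewrite leq_eqVlt ltnS ltnNge -ltnS ltn_ord orbF => /eqP mi.
rewrite -mi modnn big_geq // -[RHS]/(_) mulrC.
have -> : d i = e i by rewrite /e inord_val.
rewrite -big_nat_recr //= -mi big_mkord -[LHS]d1.
by apply: eq_bigr => j _; rewrite /e inord_val.
Qed.

(** Conjugation by the gauge with ratios h / p multiplies each p by h / p and each r by p / h, and
    both become h because h^2 = p r. *)
Lemma char_poly_cyc u v p r h :
  (forall i, h i ^+ 2 = p i * r i) -> (forall i, h i != 0) ->
  \prod_i h i = \prod_i p i ->
  char_poly (cyc u v p r) = char_poly (cyc u v h h).
Proof.
move=> hpr h0 hp.
have p0 i : p i != 0.
  by apply: contraNneq (h0 i) => p0; rewrite -sqrf_eq0 hpr p0 mul0r.
have [||D uD DE] := @cyc_gauge (fun i => h i / p i).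
- by move=> i; rewrite mulf_neq0 ?invr_eq0.
- by rewrite prodf_div hp divff //; apply/prodf_neq0.
apply: (similar_char_poly uD); rewrite cyc_mul_diag diag_mul_cyc.
apply: eq_cyc => i; rewrite ?DE; do ?by rewrite mulrC.
  by rewrite mulrA [h i / _]mulrC mulrA divff ?mul1r // mulrC.
have -> : r i = h i ^+ 2 / p i by rewrite hpr mulrAC divff ?mul1r.
by field.
Qed.

(** With one forward and one backward amplitude equal to zero, the gauge ratios at [i0] and [i1] are
    constrained only through their product. Taking them proportional to 1 / t and t scales the
    amplitudes left over there by t, and they disappear as t -> 0. If [i0 = i1], nothing is left
    over. *)
Lemma char_poly_cyc_degenerate u v p r h i0 i1 :
  (forall i, h i ^+ 2 = p i * r i) ->
  p i0 = 0 -> r i1 = 0 -> (forall i, i != i0 -> i != i1 -> h i != 0) ->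
  char_poly (cyc u v p r) = char_poly (cyc u v h h).
Proof.
move=> hpr p0 r0 h0.
have hi0 : h i0 = 0 by apply/eqP; rewrite -sqrf_eq0 hpr p0 mul0r.
have hi1 : h i1 = 0 by apply/eqP; rewrite -sqrf_eq0 hpr r0 mulr0.
pose P i := (i != i0) && (i != i1).
have hP i : P i -> h i != 0 by case/andP => a b; exact: h0.
have pP i : P i -> p i != 0.
  by move=> /hP; apply: contraNneq => pi0; rewrite -sqrf_eq0 hpr pi0 mul0r.
pose K := \prod_(i | P i) (h i / p i).
have K0 : K != 0.
  by apply/prodf_neq0 => i Pi; rewrite mulf_neq0 ?invr_eq0 ?hP ?pP.
apply: (@char_poly_degenerate _ _ _ (cyc (fun=> 0) (fun=> 0)
   (fun i => if P i then 0 else if i == i1 then if i0 == i1 then 0 else p i / K else 0)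
   (fun i => if P i then 0 else if i == i0 then if i0 == i1 then 0 else r i else 0))).
move=> t t0.
(* [K] is the product of the ratios already fixed; the one or two remaining ratios bring the whole
   product to 1. *)
pose d i := if P i then h i / p i else
  if i0 == i1 then K^-1 else if i == i0 then t^-1 else t / K.
have [||D uD DE] := @cyc_gauge d.
- move=> i; rewrite /d; case: ifP => [Pi|_].
    by rewrite mulf_neq0 ?invr_eq0 ?hP ?pP.
  by do 2?case: ifP => _; rewrite ?mulf_neq0 ?invr_eq0 ?K0 ?t0.
- rewrite (bigID P) /=.
  have -> : \prod_(i | P i) d i = K by apply: eq_bigr => i; rewrite /d => ->.
  have [e01|n01] := eqVneq i0 i1.
    rewrite (big_pred1 i0) => [|i]; last by rewrite /P -e01 andbb negbK.
    by rewrite /d /P !e01 !eqxx /= divff.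
  rewrite (bigD1 i0) /=; last by rewrite /P eqxx.
  rewrite (big_pred1 i1) => [|i]; last first.
    rewrite /P negb_and !negbK /=; case: eqVneq => [->|] //=; last by rewrite andbT.
    by rewrite (negbTE n01).
  rewrite /d /P (negbTE n01) !eqxx /= andbF (eq_sym i1) (negbTE n01).
  by field; rewrite K0.
exists (diag_mx D) => //.
rewrite cycZ cycD cyc_mul_diag diag_mul_cyc.
apply: eq_cyc => i /=; rewrite ?mulr0 ?addr0 ?DE; do ?by rewrite mulrC.
  rewrite /d; case: ifPn => [Pi|nP].
    rewrite mulr0 addr0.
    by rewrite mulrA [h i / _]mulrC mulrA divff ?mul1r ?pP // mulrC.
  have -> : h i = 0 by move: nP; rewrite /P negb_and !negbK => /orP[]/eqP ->.
  have [e01|n01] := eqVneq i0 i1.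
    have -> : p i = 0.
      by move: nP; rewrite /P negb_and !negbK -e01 orbb => /eqP ->.
    by rewrite mul0r; case: ifP; rewrite !(mulr0,addr0).
  move: nP; rewrite /P negb_and !negbK => /orP[/eqP->|/eqP->].
    by rewrite (negbTE n01) p0 !(mulr0,mul0r,addr0).
  by rewrite eqxx eq_sym (negbTE n01) add0r; ring.
rewrite /d; case: ifPn => [Pi|nP].
  rewrite mulr0 addr0.
  have -> : r i = h i ^+ 2 / p i by rewrite hpr mulrAC divff ?mul1r ?pP.
  by field; rewrite pP.
have -> : h i = 0 by move: nP; rewrite /P negb_and !negbK => /orP[]/eqP ->.
have [e01|n01] := eqVneq i0 i1.
  have -> : r i = 0.
    by move: nP; rewrite /P negb_and !negbK e01 orbb => /eqP ->.
  by rewrite mul0r; case: ifP; rewrite !(mulr0,addr0).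
move: nP; rewrite /P negb_and !negbK => /orP[/eqP->|/eqP->].
  by rewrite eqxx add0r; field.
by rewrite (eq_sym i1) (negbTE n01) r0 !(mulr0,mul0r,addr0).
Qed.

End CyclicChar.

(** * The quadratic-phase basis *)

Section Expi.
Variable R : realType.

Lemma expiD (x y : R) : expi (x + y) = expi x * expi y.
Proof.
rewrite /expi cosD sinD; apply/eqP; rewrite eq_complex /=; apply/andP; split.
  by [].
by apply/eqP; ring.
Qed.

Lemma expi0 : expi 0 = 1 :> R[i].
Proof. by rewrite /expi cos0 sin0. Qed.

Lemma expi_neq0 (x : R) : expi x != 0.
Proof.
apply/eqP => e0; have : expi (x + - x) = 0 by rewrite expiD e0 mul0r.
by rewrite subrr expi0 => /eqP; rewrite oner_eq0.
Qed.

Lemma expi_pi : expi pi = -1 :> R[i].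
Proof. by rewrite /expi cospi sinpi; apply/eqP; rewrite eq_complex /= oppr0 !eqxx. Qed.

Lemma expi_npi n : expi (n%:R * pi) = (-1) ^+ n :> R[i].
Proof.
elim: n => [|n IH]; first by rewrite mul0r expi0 expr0.
by rewrite -natr1 mulrDl mul1r expiD IH expi_pi exprSr.
Qed.

Lemma cos_expi (x : R) : (cos x)%:C%C = (expi x + expi (- x)) / 2.
Proof.
have n2 : (2 : R[i]) != 0 by rewrite pnatr_eq0.
apply: (mulIf n2); rewrite divfK // mulr_natr mulr2n /expi cosN sinN.
by apply/eqP; rewrite eq_complex /= subrr addr0 !eqxx.
Qed.

Lemma expi_eq1 (x : R) : - (pi *+ 2) < x < pi *+ 2 -> expi x = 1 -> x = 0.
Proof.
move=> /andP[xl xu] [cx _].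
have c2 : cos x = 1 - sin (x / 2) ^+ 2 *+ 2.
  have {1}-> : x = (x / 2) *+ 2 by rewrite -mulr_natr; field.
  by rewrite cos_mulr2n cos2sin2 mulrnBl; ring.
have s0 : sin (x / 2) = 0.
  apply/eqP; rewrite -sqrf_eq0; apply/eqP.
  by move: c2; rewrite cx -mulr_natr => H; lra.
have pi0 := pi_gt0 R.
rewrite -[pi *+ 2]mulr_natr in xl xu.
case: (ltgtP x 0) => // x0.
  have : 0 < sin (- x / 2) by apply: sin_gt0_pi; apply/andP; split; lra.
  by rewrite mulNr sinN s0 oppr0 ltxx.
have : 0 < sin (x / 2) by apply: sin_gt0_pi; apply/andP; split; lra.
by rewrite s0 ltxx.
Qed.

End Expi.

Section Conj.
Variables (R : realType) (M : nat).
Hypothesis M0 : (0 < M)%N.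
Local Notation N := (M + M)%N.
Local Notation m := (M%:R : R).

Local Notation shift := Defs.shift.

Let m0 : m != 0. Proof. by rewrite pnatr_eq0 -lt0n. Qed.

Lemma invmx_shift n : invmx (shift R n) = (shift R n)^T.
Proof.
have H : shift R n *m (shift R n)^T = 1%:M.
  apply/matrixP => i j; rewrite !mxE (bigD1 (ord_pred i)) //= !mxE ord_predK eqxx mul1r.
  rewrite big1 => [|k ki]; last first.
    rewrite !mxE; case: eqP => [e|]; last by rewrite mul0r.
    by move: ki; rewrite e ordSK eqxx.
  by rewrite addr0 eq_sym.
have [uS _] := mulmx1_unit H.
by rewrite -[RHS]mul1mx -(mulVmx uS) -mulmxA H mulmx1.
Qed.

(* With this phase, both the shifts and the multiplication by cos (2 pi j / N)
   map [bas n.+1] to a combination of [bas n] and [bas n.+2]. *)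
Definition gphase (x y : R) : R := - (pi / (4 * m)) * (x ^+ 2 + 4 * x * y + 2 * y ^+ 2).

(** The position is written k - 1 so as to include -1, the left neighbour of 0. Adding N = 2 m to it
    changes the phase by an integral multiple of 2 pi. *)
Lemma gphase_perr (n k : nat) :
  expi (gphase n%:R (k%:R - 1 + 2 * m)) = expi (gphase n%:R (k%:R - 1)).
Proof.
have -> : gphase n%:R (k%:R - 1) = gphase n%:R (k%:R - 1 + 2 * m)
   + (((n + k + M) * 2)%N%:R * pi) + - (2%:R * pi).
  by rewrite natrM !natrD /gphase; field.
have e2 : expi (2%:R * pi) = 1 :> R[i] by rewrite expi_npi sqrrN expr1n.
have eN : expi (- (2%:R * pi)) = 1 :> R[i].
  by rewrite -[LHS]mul1r -e2 -expiD subrr expi0.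
by rewrite !expiD eN mulr1 expi_npi mulnC exprM sqrrN !expr1n mulr1.
Qed.

Definition bas (x : R) : 'cV[R[i]]_N := \col_j expi (gphase x j%:R).

(** Replacing n by n + N changes the phase at position j by -(n + M + 2 j) pi, which modulo 2 pi
    does not depend on j. *)
Lemma bas_per n : bas (n + N)%N%:R = (-1) ^+ (n + M) *: bas n%:R.
Proof.
apply/colP => j; rewrite !mxE -expi_npi -(_ : expi (- ((n + M)%N%:R * pi)) = expi ((n + M)%N%:R * pi)).
  rewrite -expiD; have -> : gphase (n + N)%N%:R j%:R = - ((n + M)%N%:R * pi) +
     gphase n%:R j%:R + - ((j * 2)%N%:R * pi).
    by rewrite natrM !natrD /gphase; field.
  have e1 : expi (- ((j * 2)%N%:R * pi)) = 1 :> R[i].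
    apply: (mulfI (expi_neq0 ((j * 2)%N%:R * pi))).
    by rewrite -expiD subrr expi0 mulr1 expi_npi mulnC exprM sqrrN !expr1n.
  by rewrite [LHS]expiD e1 mulr1.
apply: (mulfI (expi_neq0 ((n + M)%N%:R * pi))).
by rewrite -!expiD subrr expi0 -mulrDl -natrD addnn -mul2n expi_npi exprM sqrrN !expr1n.
Qed.

Lemma bas_ordS n (k : 'I_N) : bas n%:R (ordS k) 0 = expi (gphase n%:R (k%:R + 1)).
Proof.
rewrite mxE /=; have [kN|] := ltnP k.+1 N.
  by rewrite modn_small // -natr1.
rewrite leq_eqVlt ltnNge ltn_ord orbF => /eqP kN.
have -> : (k.+1 %% N)%N = 0%N by rewrite -kN modnn.
have := gphase_perr n 1; rewrite mulr1n subrr add0r => <-.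
by congr (expi (gphase _ _)); rewrite natr1 -kN natrD; ring.
Qed.

Lemma bas_ord_pred n (k : 'I_N) :
  bas n%:R (ord_pred k) 0 = expi (gphase n%:R (k%:R - 1)).
Proof.
rewrite -{2}(ord_predK k); move: (ord_pred k) => {}k.
rewrite mxE /=; have [kN|] := ltnP k.+1 N.
  by rewrite modn_small // -natr1 addrK.
rewrite leq_eqVlt ltnNge ltn_ord orbF => /eqP kN.
have -> : (k.+1 %% N)%N = 0%N by rewrite -kN modnn.
rewrite -gphase_perr.
congr (expi (gphase _ _)); rewrite mulr0n.
have -> : k%:R = k.+1%:R - 1 :> R by rewrite -natr1 addrK.
by rewrite -kN natrD; ring.
Qed.

(** Half of the angle 2 pi (x + 1/2) / N attached to the bond between the indices x and x + 1. *)
Definition thb (x : R) : R := pi * (2 * x + 1) / (4 * m).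

Lemma thbE x : thb x = pi * (2 * x + 1) / (4 * m). Proof. by []. Qed.

(** The shift and the factor e^(2 pi i j / N) both lower the index to n, with phases [thb n] and its
    opposite; the inverse shift and the conjugate factor raise it to n.+2. Taking e^(i phi / 2) out
    of each pair leaves a real cosine. *)
Lemma Amx_bas phi n : Amx N phi 0 *m bas n.+1%:R =
  expi (phi / 2) *: ((cos (phi / 2 + thb n%:R))%:C%C *: bas n%:R +
                     (cos (phi / 2 - thb n.+1%:R))%:C%C *: bas n.+2%:R).
Proof.
rewrite /Amx invmx_shift mulmxDl -scalemxAl mulmxDl.
apply/colP => j; rewrite mul_diag_mx.
have S1 : (shift R N *m bas n.+1%:R) j 0 = bas n.+1%:R (ord_pred j) 0.
  rewrite mxE (bigD1 (ord_pred j)) //= !mxE ord_predK eqxx mul1r big1 ?addr0 //.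
  move=> k kj; rewrite !mxE; case: eqP => [e|]; last by rewrite mul0r.
  by move: kj; rewrite e ordSK eqxx.
have S2 : ((shift R N)^T *m bas n.+1%:R) j 0 = bas n.+1%:R (ordS j) 0.
  rewrite mxE (bigD1 (ordS j)) //= !mxE eqxx mul1r big1 ?addr0 //.
  by move=> k kj; rewrite !mxE (negbTE kj) mul0r.
rewrite mxE [in LHS]mxE [X in expi phi / 2 * X]mxE S1 S2 bas_ordS bas_ord_pred.
rewrite !mxE !cos_expi.
have -> : expi phi = expi (phi / 2) * expi (phi / 2) :> R[i].
  by rewrite -expiD; congr expi; field.
rewrite addr0 !opprD !opprK !expiD.
have E (x y z : R) : x = y + z -> expi x = expi y * expi z by move=> ->; exact: expiD.
set p := expi (phi / 2).
have pp : p * expi (- (phi / 2)) = 1 by rewrite -expiD subrr expi0.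
set y : R := j%:R; set x : R := n%:R.
have x1 : n.+1%:R = x + 1 by rewrite -natr1.
have x2 : n.+2%:R = x + 1 + 1 by rewrite -natr1 x1.
rewrite x1 x2.
rewrite (E (gphase (x + 1) (y - 1)) (thb x) (gphase x y)); last first.
  by rewrite /gphase /thb; field.
rewrite (E (gphase (x + 1) (y + 1)) (- thb (x + 1)) (gphase (x + 1 + 1) y)); last first.
  by rewrite /gphase /thb; field.
have mm0 : m + m != 0 by rewrite -mulr2n mulrn_eq0.
have E3 : expi (2 * pi * y / N%:R) * expi (gphase (x + 1) y) =
          expi (- thb x) * expi (gphase x y).
  by rewrite -!expiD; congr expi; rewrite /gphase /thb natrD; field; rewrite m0 mm0.
have E4 : expi (- (2 * pi * y / N%:R)) * expi (gphase (x + 1) y) =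
          expi (thb (x + 1)) * expi (gphase (x + 1 + 1) y).
  by rewrite -!expiD; congr expi; rewrite /gphase /thb natrD; field; rewrite m0 mm0.
have D3 (a b c : R[i]) : (a + b) / 2 * c = (a * c + b * c) / 2 by ring.
rewrite D3 E3 E4.
have p0 : p != 0 by exact: expi_neq0.
have -> : expi (- (phi / 2)) = p^-1 by apply: (mulfI p0); rewrite pp divff.
clear pp.
move: p p0 (expi (thb x)) (expi (- thb x)) (expi (thb _)) (expi (- thb _))
  (expi (gphase x y)) (expi (gphase _ y)) => p p0 a b c d f g.
by field.
Qed.

End Conj.

Section Columns.
Variable K : comNzRingType.

Lemma sum_col_delta n m (B : 'M[K]_(n, m)) :
  B = \sum_i col i B *m delta_mx (0 : 'I_1) i.
Proof.
apply/matrixP => x y; rewrite summxE (bigD1 y) //= big1 => [|i iy].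
  by rewrite !mxE big_ord1 !mxE !eqxx mulr1 addr0.
by rewrite !mxE big_ord1 !mxE (eq_sym y) (negbTE iy) andbF mulr0.
Qed.

Lemma mulmx_delta n m l (B : 'M[K]_(n, m)) a (b : 'I_l) :
  B *m delta_mx a b = col a B *m delta_mx (0 : 'I_1) b.
Proof. by rewrite colE -mulmxA mul_delta_mx. Qed.

End Columns.

(** Multiplication by a block triangular matrix of determinant x^n yields a block triangular matrix
    with diagonal blocks x^2 - B C and x; cancelling x^n requires x <> 0. *)
Lemma det_block_offdiag (F : fieldType) n (B C : 'M[F]_n) (x : F) : x != 0 ->
  \det (x%:M - block_mx 0 B C 0) = \det ((x ^+ 2)%:M - B *m C).
Proof.
move=> x0; have xn0 : x ^+ n != 0 by rewrite expf_neq0.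
apply: (mulIf xn0).
have E : (x%:M - block_mx 0 B C 0) *m block_mx x%:M 0 C 1%:M =
   block_mx ((x ^+ 2)%:M - B *m C) (- B) 0 x%:M.
  rewrite scalar_mx_block opp_block_mx add_block_mx mulmx_block.
  rewrite !subr0 !sub0r !mulmx0 !mulmx1 !add0r -scalar_mxM -expr2 !mulNmx.
  by rewrite mul_mx_scalar mul_scalar_mx addNr.
have := congr1 determinant E.
by rewrite det_mulmx det_ublock det_lblock !det_scalar expr1n mulr1.
Qed.

Section Reduction.
Variables (R : realType) (M : nat).
Hypothesis M0 : (0 < M)%N.
Variables (q : nat) (phi : R).
Local Notation N := (M + M)%N.
Local Notation bas := (@bas R M).
Local Notation thb := (@thb R M).
Local Notation toC := (real_complex R).

(* The basis vectors of index n and n + N agree up to a sign, which sits on the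
   bond that closes the cycle. *)
Definition wsign (i : 'I_M) : R := if i.+1 == M then (-1) ^+ (q.+1 + M) else 1.
(** Let X_i and Y_i be the basis vectors of index q.+1 + 2 i and q.+2 + 2 i. The letter u is for the
    bond between X_i and Y_i, v for the bond between Y_i and the next X; the digit 1 marks the
    amplitude leaving Y, 2 the one leaving X. The offset q stays free until the cut at the sign
    change. *)
Definition hopu1 (i : 'I_M) := cos (phi / 2 + thb (q.+1 + i.*2)%:R).
Definition hopu2 (i : 'I_M) := cos (phi / 2 - thb (q.+1 + i.*2)%:R).
Definition hopv1 (i : 'I_M) := cos (phi / 2 - thb (q.+2 + i.*2)%:R).
Definition hopv2 (i : 'I_M) := cos (phi / 2 + thb (q.+2 + i.*2)%:R).

Definition hopF : 'M[R]_M := \sum_i (hopu1 i *: delta_mx i i +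
  (wsign i * hopv1 i) *: delta_mx (ordS i) i).
Definition hopG : 'M[R]_M := \sum_i (hopu2 i *: delta_mx i i +
  (wsign i * hopv2 i) *: delta_mx i (ordS i)).

Let X (i : 'I_M) := bas (q.+1 + i.*2)%:R.
Let Y (i : 'I_M) := bas (q.+2 + i.*2)%:R.

Lemma wsign2 i : wsign i ^+ 2 = 1.
Proof. by rewrite /wsign; case: ifP => _; rewrite ?expr1n // exprAC sqrrN !expr1n. Qed.

Lemma mul_hopF_hopG : hopF *m hopG = cyc (fun i => hopu1 i * hopu2 i)
  (fun i => hopv1 i * hopv2 i) (fun i => wsign i * (hopu1 i * hopv2 i))
  (fun i => wsign i * (hopv1 i * hopu2 i)).
Proof.
rewrite /hopF /hopG /cyc mulmx_suml; apply: eq_bigr => i _.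
rewrite mulmx_sumr (bigD1 i) //= big1 => [|k ki]; last first.
  rewrite !mulmxDr !mulmxDl -!scalemxAl -!scalemxAr !mul_delta_mx_0 1?eq_sym //.
  by rewrite !scaler0 !addr0.
rewrite addr0 !mulmxDr !mulmxDl -!scalemxAl -!scalemxAr !mul_delta_mx !scalerA.
have := wsign2 i; rewrite expr2 => w2.
have -> : wsign i * hopv1 i * (wsign i * hopv2 i) = hopv1 i * hopv2 i.
  by rewrite mulrACA w2 mul1r.
by apply/matrixP => x y; rewrite !mxE; ring.
Qed.

Lemma Amx_Y i : Amx N phi 0 *m Y i = expi (phi / 2) *:
  (toC (hopu1 i) *: X i + toC (wsign i * hopv1 i) *: X (ordS i)).
Proof.
rewrite /Y addSn (Amx_bas M0).
congr (_ *: (_ + _)); rewrite /X /= /wsign.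
case: eqP => [iM|niM].
  rewrite rmorphM /= rmorphXn rmorphN1 [in RHS]mulrC -scalerA.
  rewrite (_ : i.+1 %% M = 0)%N ?addn0 -?(bas_per R M0); last by rewrite iM modnn.
  by congr (_ *: bas _%:R); lia.
rewrite modn_small ?mul1r; last by have := ltn_ord i; lia.
by congr (_ *: bas _%:R); lia.
Qed.

Lemma Amx_X i : Amx N phi 0 *m X (ordS i) = expi (phi / 2) *:
  (toC (wsign i * hopv2 i) *: Y i + toC (hopu2 (ordS i)) *: Y (ordS i)).
Proof.
have m0 : M%:R != 0 :> R by rewrite pnatr_eq0 -lt0n.
have E : toC (wsign i * hopv2 i) *: Y i =
  toC (cos (phi / 2 + thb (q + (ordS i).*2)%:R)) *: bas (q + (ordS i).*2)%:R.
  rewrite /= /wsign /Y; case: eqP => [iM|niM]; last first.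
    rewrite modn_small ?mul1r; last by have := ltn_ord i; lia.
    by rewrite /hopv2 (_ : q + i.+1.*2 = q.+2 + i.*2)%N //; lia.
  rewrite (_ : i.+1 %% M = 0)%N ?addn0; last by rewrite iM modnn.
  (* On the closing bond three signs cancel: [wsign], the sign relating [bas] at q + N and at q, and
     that of the cosine, whose argument grows by pi over a period. *)
  rewrite (_ : q.+2 + i.*2 = q + N)%N; last by lia.
  rewrite (bas_per R M0) /hopv2 (_ : q.+2 + i.*2 = q + N)%N; last by lia.
  have -> : phi / 2 + thb (q + N)%:R = phi / 2 + thb q%:R + pi.
    by rewrite !thbE !natrD; field.
  rewrite cosDpi scalerA; congr (_ *: _).
  rewrite addSn exprS mulN1r mulrNN rmorphM rmorphXn rmorphN1 /=.
  have s2 : (-1) ^+ (q + M) * (-1) ^+ (q + M) = 1 :> R[i].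
    by rewrite -exprD addnn -mul2n exprM sqrrN !expr1n.
  by rewrite mulrAC s2 mul1r.
by rewrite E /X addSn (Amx_bas M0).
Qed.

Definition basX : 'M[R[i]]_(N, M) := \matrix_(j, i) X i j 0.
Definition basY : 'M[R[i]]_(N, M) := \matrix_(j, i) Y i j 0.

Let col_basX i : col i basX = X i.
Proof. by apply/colP => j; rewrite !mxE. Qed.
Let col_basY i : col i basY = Y i.
Proof. by apply/colP => j; rewrite !mxE. Qed.

Lemma Amx_basY : Amx N phi 0 *m basY = basX *m (expi (phi / 2) *: map_mx toC hopF).
Proof.
rewrite [basY]sum_col_delta mulmx_sumr -scalemxAr /hopF raddf_sum /= mulmx_sumr scaler_sumr.
apply: eq_bigr => i _; rewrite mulmxA col_basY Amx_Y.
rewrite map_mxD !map_mxZ !map_delta_mx mulmxDr -!scalemxAr.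
by rewrite !(mulmx_delta basX) !col_basX -scalemxAl mulmxDl -!scalemxAl.
Qed.

Lemma Amx_basX : Amx N phi 0 *m basX = basY *m (expi (phi / 2) *: map_mx toC hopG).
Proof.
rewrite [basX]sum_col_delta mulmx_sumr -scalemxAr /hopG raddf_sum /= mulmx_sumr scaler_sumr.
rewrite (reindex_inj (@ordS_inj M)) /=.
rewrite (eq_bigr (fun i => expi (phi / 2) *: (toC (wsign i * hopv2 i) *: (Y i *m delta_mx (0 : 'I_1) (ordS i)))
   + expi (phi / 2) *: (toC (hopu2 (ordS i)) *: (Y (ordS i) *m delta_mx (0 : 'I_1) (ordS i))))); last first.
  by move=> i _; rewrite mulmxA col_basX Amx_X -scalemxAl mulmxDl -!scalemxAl scalerDr.
rewrite big_split /= addrC.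
have -> : \sum_i expi (phi / 2) *: (toC (hopu2 (ordS i)) *: (Y (ordS i) *m delta_mx (0 : 'I_1) (ordS i))) =
    \sum_i expi (phi / 2) *: (toC (hopu2 i) *: (Y i *m delta_mx (0 : 'I_1) i)).
  by rewrite [RHS](reindex_inj (@ordS_inj M)).
rewrite -big_split /=; apply: eq_bigr => i _.
rewrite map_mxD !map_mxZ !map_delta_mx mulmxDr -!scalemxAr.
by rewrite !(mulmx_delta basY) !col_basY scalerDr.
Qed.

(** The phase is a function of n, plus a function of j, plus a term linear in j, so the basis is a
    Vandermonde matrix between two diagonal ones. Its nodes are 2M-th roots of unity, distinct for N
    consecutive values of n. *)
Lemma bas_vandermonde (n : nat) (j : 'I_N) : bas n%:R j 0 =
  expi (- (pi / (4 * M%:R)) * n%:R ^+ 2) * expi (- (pi / (4 * M%:R)) * (2 * j%:R ^+ 2))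
   * expi (- (pi / M%:R) * n%:R) ^+ j.
Proof.
have m0 : M%:R != 0 :> R by rewrite pnatr_eq0 -lt0n.
have -> k (x : R) : expi x ^+ k = expi (k%:R * x).
  elim: k => [|k IH]; first by rewrite mul0r expi0 expr0.
  by rewrite exprS IH -expiD -natr1; congr expi; ring.
by rewrite mxE /gphase -!expiD; congr expi; field.
Qed.

Lemma expi_inj_nat (a b : nat) : (a < b < a + N)%N ->
  expi (- (pi / M%:R) * a%:R) != expi (- (pi / M%:R) * b%:R) :> R[i].
Proof.
have m0 : 0 < M%:R :> R by rewrite ltr0n.
move=> /andP[ab ba]; apply/eqP => e.
have : expi ((pi / M%:R) * (b - a)%:R : R) = 1.
  rewrite natrB ?(ltnW ab) // (_ : _ * _ = - (- (pi / M%:R) * b%:R) + (- (pi / M%:R) * a%:R)); last by ring.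
  by rewrite expiD e -expiD addNr expi0.
have pi0 := pi_gt0 R.
move=> e1; have : pi / M%:R * (b - a)%:R = 0 :> R.
  apply: expi_eq1 e1; rewrite (@lt_le_trans _ _ 0) /=; last first.
  - by rewrite mulr_ge0 ?divr_ge0 // ltW.
  - by rewrite oppr_lt0 pmulrn_lgt0.
  rewrite mulrAC ltr_pdivrMr // -[pi *+ 2]mulr_natr -mulrA ltr_pM2l //.
  by rewrite -natrM ltr_nat; lia.
move/eqP; rewrite !mulf_eq0 invr_eq0 (gt_eqF pi0) (gt_eqF m0) /= pnatr_eq0; lia.
Qed.

Lemma unit_row_bas : row_mx basX basY \in unitmx.
Proof.
pose n_ (c : 'I_N) := match fintype.split c with inl i => (q.+1 + i.*2)%N
   | inr i => (q.+2 + i.*2)%N end.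
have E : row_mx basX basY =
   diag_mx (\row_j expi (- (pi / (4 * M%:R)) * (2 * j%:R ^+ 2)))
   *m Vandermonde N (\row_c expi (- (pi / M%:R) * (n_ c)%:R))
   *m diag_mx (\row_c expi (- (pi / (4 * M%:R)) * (n_ c)%:R ^+ 2)).
  apply/matrixP => j c; rewrite mul_mx_diag mul_diag_mx !mxE /n_.
  by case: fintype.splitP => i _; rewrite mxE bas_vandermonde; ring.
rewrite E !unitmx_mul !unitmxE !unitfE !det_diag det_Vandermonde.
apply/andP; split; last by apply/prodf_neq0 => i _; rewrite mxE expi_neq0.
apply/andP; split; first by apply/prodf_neq0 => i _; rewrite mxE expi_neq0.
apply/prodf_neq0 => i _; apply/prodf_neq0 => j ij; rewrite !mxE subr_eq0.
have : n_ i != n_ j.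
  rewrite /n_; case: fintype.splitP => a ea; case: fintype.splitP => b eb; try lia.
have H c : (q.+1 <= n_ c < q.+1 + N)%N.
  by rewrite /n_; case: fintype.splitP => a _; have := ltn_ord a; lia.
have := H i; have := H j => Hj Hi.
case: ltngtP => // [l|l] _; last by apply: expi_inj_nat; lia.
by rewrite eq_sym; apply: expi_inj_nat; lia.
Qed.

Lemma char_poly_Amx_hop (x : R[i]) : x != 0 ->
  (char_poly (Amx N phi 0)).[x] =
  \det ((x ^+ 2)%:M - expi phi *: map_mx toC (hopF *m hopG)).
Proof.
move=> x0.
rewrite (@similar_char_poly _ _ _ (block_mx 0 (expi (phi / 2) *: map_mx toC hopF)
   (expi (phi / 2) *: map_mx toC hopG) 0) (row_mx basX basY) unit_row_bas); last first.
  by rewrite mul_mx_row mul_row_block !mulmx0 addr0 add0r Amx_basX Amx_basY.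
rewrite horner_char_poly det_block_offdiag // map_mxM -scalemxAl -scalemxAr scalerA.
by rewrite -expiD; congr (\det (_ - expi _ *: _)); field.
Qed.

End Reduction.

(** * Power sums of positive eigenvalues *)

Section PowerMean.
Variable R : realFieldType.

(** Convexity: the tangent at c lies below the graph. Multiplying the case k by x leaves the
    remainder (k + 1) c^k (x - c)^2. *)
Lemma power_tangent (k : nat) (x c : R) : 0 <= x -> 0 <= c ->
  c ^+ k.+1 + k.+1%:R * c ^+ k * (x - c) <= x ^+ k.+1.
Proof.
move=> x0 c0; elim: k => [|k IH]; first by rewrite !expr1 expr0; lra.
have := ler_wpM2l x0 IH; rewrite -exprS => /(le_trans _); apply.
rewrite -subr_ge0 (_ : _ - _ = k.+1%:R * c ^+ k * (x - c) ^+ 2).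
  by rewrite mulr_ge0 ?sqr_ge0 // mulr_ge0 ?exprn_ge0.
by rewrite -[k.+2%:R]natr1 !exprS; ring.
Qed.

Lemma power_mean (I : finType) (a mu : I -> R) (k : nat) :
  (forall i, 0 <= a i) -> \sum_i a i = 1 -> (forall i, 0 <= mu i) ->
  (\sum_i a i * mu i) ^+ k.+1 <= \sum_i a i * mu i ^+ k.+1.
Proof.
move=> a0 a1 mu0; set c := \sum_i _.
have c0 : 0 <= c by apply: sumr_ge0 => i _; rewrite mulr_ge0.
apply: (@le_trans _ _ (\sum_i a i * (c ^+ k.+1 + k.+1%:R * c ^+ k * (mu i - c)))).
  rewrite (eq_bigr (fun i => c ^+ k.+1 * a i + k.+1%:R * c ^+ k * (a i * mu i - c * a i))); last first.
    by move=> i _; ring.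
  by rewrite big_split /= -!mulr_sumr sumrB -mulr_sumr a1 !mulr1 subrr mulr0 addr0.
by apply: ler_sum => i _; rewrite ler_wpM2l // power_tangent.
Qed.

End PowerMean.

Lemma Re_sum (R : realType) (I : Type) (r : seq I) (P : pred I) (F : I -> R[i]) :
  complex.Re (\sum_(i <- r | P i) F i) = \sum_(i <- r | P i) complex.Re (F i).
Proof. by apply: big_morph => // -[a b] [c d]. Qed.

Lemma Im_sum (R : realType) (I : Type) (r : seq I) (P : pred I) (F : I -> R[i]) :
  complex.Im (\sum_(i <- r | P i) F i) = \sum_(i <- r | P i) complex.Im (F i).
Proof. by apply: big_morph => // -[a b] [c d]. Qed.

(** * Diagonalization of real symmetric matrices and comparison of power sums *)

Section Spectral.
Local Open Scope sesquilinear_scope.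
Variables (R : realType) (n : nat).
Local Notation toC := (real_complex R).
Implicit Types (H A K : 'M[R]_n) (P V : 'M[R[i]]_n) (lam mu : 'I_n -> R).

(** A relation, so that one [P] serves [H], its opposite and its powers. [P] is complex because the
    spectral theorem is applied to a Hermitian matrix. *)
Definition diagonalizes P lam H := P \is unitarymx /\
  map_mx toC H = P^t* *m diag_mx (\row_j toC (lam j)) *m P.

Lemma symmetric_diagonalizes H : H^T = H -> exists P lam, diagonalizes P lam H.
Proof.
move=> sH; set Hc := map_mx toC H.
have hH : Hc \is hermsymmx.
  apply: realsym_hermsym.
    apply/is_hermitianmxP; by rewrite expr0 scale1r map_mx_id // /Hc map_trmx sH.
  by apply/mxOverP => i j; rewrite mxE; apply/complex_realP; exists (H i j).
have /orthomx_spectralP E := hermitian_normalmx hH.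
have uP := spectral_unitarymx Hc.
have /mxOverP rd := hermitian_spectral_diag_real hH.
exists (spectralmx Hc), (fun j => complex.Re (spectral_diag Hc 0 j)).
split; first by []. rewrite -invmx_unitary // -/Hc [LHS]E; congr (_ *m diag_mx _ *m _).
by apply/rowP => j; rewrite mxE; apply/esym/RRe_real.
Qed.

(** The squared moduli of the entries; for unitary [P] they are doubly stochastic. Rows serve as
    weights in Jensen's inequality, columns in the comparison of traces. *)
Definition wgt P j x : R := complex.Re (P j x) ^+ 2 + complex.Im (P j x) ^+ 2.

Lemma wgt_ge0 P j x : 0 <= wgt P j x.
Proof. by rewrite addr_ge0 ?sqr_ge0. Qed.

Lemma wgtE P j x : toC (wgt P j x) = P j x * (P j x)^*.
Proof. by rewrite /wgt add_Re2_Im2 normCK. Qed.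

Lemma wgt_row P j : P \is unitarymx -> \sum_x wgt P j x = 1.
Proof.
move=> /unitarymxP /matrixP/(_ j j); rewrite !mxE eqxx => E.
apply: (@complexI R); rewrite raddf_sum /= -[RHS]E; apply: eq_bigr => x _.
by rewrite wgtE !mxE.
Qed.

Lemma wgt_col P x : P \is unitarymx -> \sum_j wgt P j x = 1.
Proof.
move=> /unitarymxP /mulmx1C /matrixP/(_ x x); rewrite !mxE eqxx => E.
apply: (@complexI R); rewrite raddf_sum /= -[RHS]E; apply: eq_bigr => j _.
by rewrite wgtE !mxE mulrC.
Qed.

Lemma diagonalizesN P lam H : diagonalizes P lam H ->
  diagonalizes P (fun j => - lam j) (- H).
Proof.
move=> [uP E]; split; first by [].
have -> : \row_j toC (- lam j) = - \row_j toC (lam j).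
  by apply/rowP => j; rewrite !mxE rmorphN.
by rewrite map_mxN E linearN /= mulmxN mulNmx.
Qed.

Lemma diagonalizesX P lam H k : diagonalizes P lam H ->
  diagonalizes P (fun j => lam j ^+ k) (H ^+ k).
Proof.
move=> [uP E]; split; first by []. elim: k => [|k IH].
  rewrite !expr0 map_mx1 (_ : \row_j _ = const_mx 1); last by apply/rowP => j; rewrite !mxE.
  by rewrite diag_const_mx mulmx1; move/unitarymxP: uP => /mulmx1C.
have -> : \row_j toC (lam j ^+ k.+1) = \row_j (toC (lam j) * toC (lam j ^+ k)).
  by apply/rowP => j; rewrite !mxE exprS rmorphM.
have -> : H ^+ k.+1 = H *m H ^+ k by exact: exprS.
rewrite map_mxM {1}E IH !mulmxA (mulmxtVK _ uP).
rewrite -(mulmxA (P^t*) (diag_mx _) (diag_mx _)) mulmx_diag.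
by have -> : (\row_j ((\row_j0 toC (lam j0)) 0 j * (\row_j0 toC (lam j0 ^+ k)) 0 j)) =
  \row_j (toC (lam j) * toC (lam j ^+ k)) by apply/rowP => j; rewrite !mxE.
Qed.

Lemma diagonalizes_entry P lam H x : diagonalizes P lam H ->
  H x x = \sum_j lam j * wgt P j x.
Proof.
move=> [uP /matrixP/(_ x x)]; rewrite !mxE => E.
apply: (@complexI R); rewrite E raddf_sum /=; apply: eq_bigr => j _.
by rewrite mul_mx_diag !mxE rmorphM /= wgtE; ring.
Qed.

Lemma diagonalizes_tr P lam H : diagonalizes P lam H -> \tr H = \sum_j lam j.
Proof.
move=> dH; rewrite /mxtrace (eq_bigr _ (fun x _ => diagonalizes_entry x dH)).
rewrite exchange_big /=; apply: eq_bigr => j _.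
by rewrite -mulr_sumr wgt_row ?mulr1 //; case: dH.
Qed.

Lemma diagonalizes_det P lam H (z c : R[i]) : diagonalizes P lam H ->
  \det (z%:M - c *: map_mx toC H) = \prod_j (z - c * toC (lam j)).
Proof.
move=> [uP E].
have PP : P^t* *m P = 1%:M by move/unitarymxP: uP => /mulmx1C.
have -> : z%:M - c *: map_mx toC H =
    P^t* *m diag_mx (\row_j (z - c * toC (lam j))) *m P.
  have -> : diag_mx (\row_j (z - c * toC (lam j))) = z%:M - c *: diag_mx (\row_j toC (lam j)).
    apply/matrixP => i j; rewrite !mxE.
    by case: eqP => _; rewrite ?mulr1n // !mulr0n mulr0 subr0.
  by rewrite mulmxBr mulmxBl mul_mx_scalar -scalemxAl PP -scalemxAr -scalemxAl -E scalemx1.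
rewrite !det_mulmx mulrAC -det_mulmx PP det1 mul1r det_diag.
by apply: eq_bigr => j _; rewrite mxE.
Qed.

Definition qform K (v : 'I_n -> R) := \sum_x \sum_y K x y * (v x * v y).
Definition psd K := forall v, 0 <= qform K v.

(** The real part of the j-th diagonal entry of [P *m K *m P^t*]. Splitting the row into real and
    imaginary parts reduces it to real quadratic forms, which is why [psd] asks for real vectors
    only. *)
Definition hform K P j := qform K (fun x => complex.Re (P j x)) + qform K (fun x => complex.Im (P j x)).

Lemma hformE K P j : complex.Re ((P *m map_mx toC K *m P^t*) j j) = hform K P j.
Proof.
rewrite mxE Re_sum.
under eq_bigr do rewrite !mxE mulr_suml Re_sum.
rewrite exchange_big /hform /qform -big_split; apply: eq_bigr => x _ /=.
rewrite -big_split; apply: eq_bigr => y _ /=.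
by rewrite !mxE; case: (P j x) => a b; case: (P j y) => c d /=; ring.
Qed.

Lemma hform_diagonalizes P V mu K j : P \is unitarymx -> diagonalizes V mu K ->
  hform K P j = \sum_l wgt (P *m V^t*) j l * mu l.
Proof.
move=> uP [uV E]; rewrite -hformE E.
set W := P *m V^t*.
have -> : P *m (V^t* *m diag_mx (\row_j0 toC (mu j0)) *m V) *m P^t* =
   W *m diag_mx (\row_j0 toC (mu j0)) *m W^t*.
  by rewrite /W trmx_mul map_mxM trmxCK !mulmxA.
rewrite mxE Re_sum /=; apply: eq_bigr => l _.
rewrite mul_mx_diag !mxE /wgt mxE; case: (\sum_ _ _) => a b /=; ring.
Qed.

Lemma hform_self P lam H j : diagonalizes P lam H -> hform H P j = lam j.
Proof.
move=> dH; rewrite (hform_diagonalizes j (proj1 dH) dH).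
move: (dH) => [/unitarymxP -> _]; rewrite (bigD1 j) //= big1 => [|l lj].
  by rewrite /wgt mxE eqxx /= expr1n expr0n /= !addr0 mul1r.
by rewrite /wgt mxE eq_sym (negbTE lj) /= expr0n /= addr0 mul0r.
Qed.

Lemma hform_mono K K' P j : psd (K' - K) -> hform K P j <= hform K' P j.
Proof.
move=> pK; rewrite -subr_ge0.
have qB v : qform (K' - K) v = qform K' v - qform K v.
  rewrite /qform -sumrB; apply: eq_bigr => x _; rewrite -sumrB.
  by apply: eq_bigr => y _; rewrite !mxE mulrBl.
by rewrite /hform opprD addrACA -!qB addr_ge0.
Qed.

(* Jensen: an eigenvalue of H is at most the same diagonal entry of A in an
   eigenbasis of H, which is a weighted mean of the eigenvalues of A. *)
Lemma sum_pos_eigen_le P lam H A k : diagonalizes P lam H -> A^T = A ->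
  psd A -> psd (A - H) -> \sum_j Num.max (lam j) 0 ^+ k.+1 <= \tr (A ^+ k.+1).
Proof.
move=> dH sA pA pAH; have [V [mu dA]] := symmetric_diagonalizes sA.
have [uP _] := dH; have [uV _] := dA.
have uV' : V^t* \is unitarymx by rewrite trmxC_unitary.
have uW : P *m V^t* \is unitarymx by exact: (mul_unitarymx uP uV').
have mu0 l : 0 <= mu l.
  by rewrite -(hform_self l dA) addr_ge0.
rewrite (diagonalizes_tr (diagonalizesX k.+1 dA)).
apply: (@le_trans _ _ (\sum_j \sum_l wgt (P *m V^t*) j l * mu l ^+ k.+1)); last first.
  rewrite exchange_big /=; apply: ler_sum => l _.
  by rewrite -mulr_suml wgt_col // mul1r.
apply: ler_sum => j _.
have H1 : 0 <= \sum_l wgt (P *m V^t*) j l * mu l.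
  by apply: sumr_ge0 => l _; rewrite mulr_ge0 ?wgt_ge0.
apply: (@le_trans _ _ ((\sum_l wgt (P *m V^t*) j l * mu l) ^+ k.+1)); last first.
  by apply: power_mean => //; [move=> l; exact: wgt_ge0 | exact: wgt_row].
apply: lerXn2r; rewrite ?nnegrE ?le_max ?lexx ?orbT // ge_max H1 andbT.
by rewrite -(hform_diagonalizes _ uP dA) -(hform_self j dH) hform_mono.
Qed.

(** In an eigenbasis the left side is a sum of the lam_j^k with weights in [0, 1]; for odd k the
    negative eigenvalues contribute at most 0, and the others gain from weight 1. *)
Lemma sum_pos_eigen_ge P lam H (I : pred 'I_n) k : diagonalizes P lam H -> odd k ->
  \sum_(x | I x) (H ^+ k) x x <= \sum_j Num.max (lam j) 0 ^+ k.
Proof.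
move=> dH ok; have [uP _] := dH.
under eq_bigr do rewrite (diagonalizes_entry _ (diagonalizesX k dH)).
rewrite exchange_big /=; apply: ler_sum => j _; rewrite -mulr_sumr.
have s0 : 0 <= \sum_(x | I x) wgt P j x by apply: sumr_ge0 => x _; exact: wgt_ge0.
have s1 : \sum_(x | I x) wgt P j x <= 1.
  rewrite -(wgt_row j uP) [leRHS](bigID I) /= lerDl.
  by apply: sumr_ge0 => x _; exact: wgt_ge0.
have [l0|l0] := leP 0 (lam j); first by rewrite ler_piMr // exprn_ge0.
rewrite expr0n; case: k ok {dH} => // k ok /=.
by rewrite mulr_le0_ge0 // exprn_odd_le0 // ltW.
Qed.

Lemma diagonalizes_le P lam H c j : diagonalizes P lam H -> psd (c%:M - H) ->
  lam j <= c.
Proof.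
move=> dH pc; have [uP _] := dH.
rewrite -(hform_self j dH); apply: (le_trans (hform_mono _ _ pc)).
have -> // : hform c%:M P j = c.
have E v : qform c%:M v = c * \sum_x v x ^+ 2.
  rewrite /qform mulr_sumr; apply: eq_bigr => x _.
  rewrite (bigD1 x) //= big1 => [|y yx]; first by rewrite mxE eqxx mulr1n addr0 expr2.
  by rewrite mxE eq_sym (negbTE yx) mulr0n mul0r.
by rewrite /hform !E -mulrDr -big_split /= wgt_row ?mulr1.
Qed.

End Spectral.

(** * Powers of slowly modulated cyclic matrices *)

Section RowSum.
Variables (R : realFieldType) (n : nat).
Implicit Types A B : 'M[R]_n.

Definition rowsum_le A c := forall i, \sum_j `|A i j| <= c.

Lemma rowsum_leD A B a b : rowsum_le A a -> rowsum_le B b -> rowsum_le (A + B) (a + b).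
Proof.
move=> hA hB i; apply: le_trans (lerD (hA i) (hB i)).
by rewrite -big_split; apply: ler_sum => j _; rewrite mxE ler_normD.
Qed.

Lemma rowsum_leM A B a b : 0 <= b ->
  rowsum_le A a -> rowsum_le B b -> rowsum_le (A *m B) (a * b).
Proof.
move=> b0 hA hB i; apply: (@le_trans _ _ (\sum_k `|A i k| * b)); last first.
  by rewrite -mulr_suml ler_wpM2r.
apply: (@le_trans _ _ (\sum_j \sum_k `|A i k| * `|B k j|)).
  apply: ler_sum => j _; rewrite mxE; apply: (le_trans (ler_norm_sum _ _ _)).
  by apply: ler_sum => k _; rewrite normrM.
rewrite exchange_big; apply: ler_sum => k _ /=.
by rewrite -mulr_sumr ler_wpM2l.
Qed.

Lemma rowsum_le_entry A a i j : rowsum_le A a -> `|A i j| <= a.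
Proof.
move=> /(_ i); apply: le_trans; rewrite (bigD1 j) //= lerDl.
by apply: sumr_ge0.
Qed.

Lemma rowsum_leX A a k : 0 <= a -> rowsum_le A a -> rowsum_le (A ^+ k) (a ^+ k).
Proof.
move=> a0 hA; elim: k => [|k IH].
  move=> i; rewrite !expr0 (bigD1 i) //= big1 => [|j ji]; first by rewrite mxE eqxx normr1 addr0.
  by rewrite mxE eq_sym (negbTE ji) normr0.
have -> : A ^+ k.+1 = A *m A ^+ k by exact: exprS.
by rewrite exprS; apply: rowsum_leM; rewrite ?exprn_ge0.
Qed.

Lemma rowsum_le_diag (d : 'rV[R]_n) a : (forall i, `|d 0 i| <= a) -> rowsum_le (diag_mx d) a.
Proof.
move=> hd i; rewrite (bigD1 i) //= big1 => [|j ji]; first by rewrite mxE eqxx mulr1n addr0.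
by rewrite mxE eq_sym (negbTE ji) mulr0n normr0.
Qed.

(** Each of the four summands of [cyc] is a weighted permutation matrix, with one entry per row. *)
Lemma rowsum_le_cyc (u v p r : 'I_n -> R) a : (forall i, `|u i| <= a) ->
  (forall i, `|v i| <= a) -> (forall i, `|p i| <= a) -> (forall i, `|r i| <= a) ->
  rowsum_le (cyc u v p r) (4 * a).
Proof.
move=> hu hv hp hr.
have H (f : 'I_n -> R) (s t : 'I_n -> 'I_n) : injective s -> (forall i, `|f i| <= a) ->
    rowsum_le (\sum_i f i *: delta_mx (s i) (t i)) a.
  move=> si hf i; have [g sK gK] := injF_bij si.
  have E j : (\sum_k f k *: delta_mx (s k) (t k)) i j = f (g i) * (j == t (g i))%:R.
    rewrite summxE (bigD1 (g i)) //= big1 => [|k ki]; first by rewrite !mxE gK eqxx addr0.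
    rewrite !mxE; case: eqP => [e|]; last by rewrite mulr0.
    by move: ki; rewrite e sK eqxx.
  under eq_bigr do rewrite E.
  rewrite (bigD1 (t (g i))) //= big1 => [|j ji].
    by rewrite eqxx mulr1 addr0.
  by rewrite (negbTE ji) mulr0 normr0.
have -> : 4 * a = a + a + a + a by ring.
rewrite /cyc !big_split /=.
do !apply: rowsum_leD; apply: H => //; exact: ordS_inj.
Qed.

End RowSum.

Lemma sign_norm_le1 (R : realFieldType) (x : R) : x ^+ 2 = 1 -> `|x| <= 1.
Proof. by move/eqP; rewrite sqrf_eq1 => /orP[]/eqP->; rewrite ?normrN normr1. Qed.

Section SignedLaplacian.
Variables (R : realFieldType) (M : nat) (eps : 'I_M -> R).
Hypothesis eps2 : forall i, eps i ^+ 2 = 1.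

Let one : 'I_M -> R := fun=> 1.
Definition lapl : 'M[R]_M := cyc one one eps eps.
Definition sshift : 'M[R]_M := \sum_i eps i *: delta_mx (ordS i) i.

Let Z : 'M[R]_M := sshift.

Lemma tr_sshift : Z^T = \sum_i eps i *: delta_mx i (ordS i).
Proof. by rewrite raddf_sum; apply: eq_bigr => i _ /=; rewrite linearZ /= trmx_delta. Qed.

Let sum_delta : \sum_i delta_mx i i = 1%:M :> 'M[R]_M.
Proof.
apply/matrixP => x y; rewrite summxE (bigD1 x) //= big1 => [|i ix].
  by rewrite !mxE eqxx addr0 eq_sym.
by rewrite !mxE eq_sym (negbTE ix).
Qed.

Lemma trZZ : Z^T *m Z = 1%:M.
Proof.
rewrite tr_sshift /Z /sshift -sum_delta mulmx_suml; apply: eq_bigr => i _.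
rewrite mulmx_sumr (bigD1 i) //= big1 => [|k ki].
  by rewrite -scalemxAl -scalemxAr mul_delta_mx scalerA -expr2 eps2 scale1r addr0.
rewrite -scalemxAl -scalemxAr mul_delta_mx_0 ?scaler0 //.
by rewrite (inj_eq (@ordS_inj M)) eq_sym.
Qed.

Lemma ZtrZ : Z *m Z^T = 1%:M.
Proof. exact: (mulmx1C trZZ). Qed.

(** [Z] is a signed cyclic permutation, so its transpose is its inverse, and 2 + Z + Z^(-1) = Z^(-1)
    (1 + Z)^2. *)
Lemma laplE : lapl = Z^T *m (1%:M + Z) *m (1%:M + Z).
Proof.
rewrite !mulmxDr !mulmxDl !mulmx1 trZZ !mul1mx.
rewrite /lapl /cyc !big_split /= -/(sshift) -/Z -tr_sshift.
have -> : \sum_i one i *: delta_mx i i = 1%:M :> 'M[R]_M.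
  by rewrite -sum_delta; apply: eq_bigr => i _; rewrite scale1r.
have -> : \sum_i one i *: delta_mx (ordS i) (ordS i) = 1%:M :> 'M[R]_M.
  rewrite -sum_delta [RHS](reindex_inj (@ordS_inj M)).
  by apply: eq_bigr => i _; rewrite scale1r.
by move: (Z^T) (1%:M : 'M[R]_M) => A B; apply/matrixP => x y; rewrite !mxE; ring.
Qed.

Lemma val_iter_ordS m (x : 'I_M) : (iter m (@ordS M) x = (x + m) %% M :> nat)%N.
Proof.
elim: m => [|m IH]; first by rewrite addn0 modn_small.
by rewrite iterS /= IH -addn1 modnDml addn1 addnS.
Qed.

Lemma sshiftX m x y : y != iter m (@ordS M) x -> (Z ^+ m) y x = 0.
Proof.
elim: m y => [|m IH] y /= yx.
  by rewrite expr0 mxE (negbTE yx).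
have -> : Z ^+ m.+1 = Z *m Z ^+ m by exact: exprS.
rewrite mxE big1 // => z _.
have [zE|zn] := eqVneq z (iter m (@ordS M) x); last by rewrite IH ?mulr0.
rewrite /Z /sshift summxE big1 ?mul0r // => i _; rewrite !mxE.
case: eqP => [e|]; last by rewrite mulr0.
by case: eqP => [e'|]; rewrite ?mulr0 //; move: yx; rewrite e -e' zE eqxx.
Qed.

Lemma trX (A : 'M[R]_M) k : (A ^+ k)^T = A^T ^+ k.
Proof.
elim: k => [|k IH]; first by rewrite !expr0 trmx1.
have -> : A ^+ k.+1 = A *m A ^+ k by exact: exprS.
by rewrite trmx_mul IH exprSr.
Qed.

Lemma sshiftX_diag m x : (0 < m < M)%N -> (Z ^+ m) x x = 0.
Proof.
move=> /andP[m0 mM]; apply: sshiftX; apply/eqP => /(congr1 val) /=.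
rewrite val_iter_ordS => /eqP.
have xM := ltn_ord x.
have [h|h] := ltnP (x + m) M; first by rewrite modn_small //; lia.
rewrite -(subnK h) modnDr modn_small; lia.
Qed.

(** Since [Z] commutes with its inverse, the power is Z^(-k) (1 + Z)^(2k). A term Z^(j - k) with j
    <> k moves every site by 0 < |j - k| <= k < M steps, so only j = k reaches the diagonal, and the
    signs never enter. *)
Lemma laplX_diag k x : (k < M)%N -> (lapl ^+ k) x x = 'C(k.*2, k)%:R.
Proof.
move=> kM; rewrite laplE.
have cZ : GRing.comm Z^T Z by rewrite /GRing.comm -[LHS]/(_ *m _) -[RHS]/(_ *m _) trZZ ZtrZ.
set I1 : 'M[R]_M := 1%:M.
have c1 : GRing.comm (Z^T) (1 + Z) by apply: commrD => //; exact: commr1.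
have -> : Z^T *m (I1 + Z) *m (I1 + Z) = Z^T * (1 + Z) ^+ 2 by rewrite expr2 mulrA.
rewrite exprMn_comm; last exact: commrX.
rewrite -exprM mul2n addrC exprD1n mulr_sumr summxE.
have kk : (k < k.*2.+1)%N by lia.
rewrite (bigD1 (Ordinal kk)) //= big1 => [|j jk].
  rewrite mulrnAr -exprMn_comm // -[X in X ^+ k]/(Z^T *m Z) trZZ expr1n addr0.
  by rewrite mulmxnE mxE eqxx.
rewrite mulrnAr mulmxnE.
suff -> : ((Z^T) ^+ k * Z ^+ j) x x = 0 by rewrite mul0rn.
have jk' : j != k :> nat by apply: contra jk => /eqP e; apply/eqP/val_inj.
have j2 := ltn_ord j.
move: (nat_of_ord j) jk' j2 => {jk} {}j jk' j2.
have [jlt|jge] := ltnP j k.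
  rewrite -(subnK (ltnW jlt)) exprD -mulrA -exprMn_comm // -[X in X ^+ j]/(Z^T *m Z) trZZ.
  by rewrite expr1n mulr1 -trX mxE sshiftX_diag //; lia.
rewrite -{1}(subnKC jge) exprD mulrA -exprMn_comm // -[X in X ^+ k]/(Z^T *m Z) trZZ.
by rewrite expr1n mul1r sshiftX_diag //; lia.
Qed.

Lemma rowsum_le_lapl : rowsum_le lapl 4.
Proof.
have -> : 4 = 4 * 1 :> R by rewrite mulr1.
have e1 i : `|eps i| <= 1.
  exact: sign_norm_le1.
by apply: rowsum_le_cyc => i; rewrite ?normr1.
Qed.

End SignedLaplacian.

Section DiagPower.
Variable R : realFieldType.

Lemma distX_le (a b d : R) k : `|a| <= 1 -> `|b| <= 1 -> `|a - b| <= d ->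
  `|a ^+ k - b ^+ k| <= k%:R * d.
Proof.
move=> a1 b1 ab; elim: k => [|k IH]; first by rewrite !expr0 subrr normr0 mul0r.
have -> : a ^+ k.+1 - b ^+ k.+1 = a * (a ^+ k - b ^+ k) + (a - b) * b ^+ k.
  by rewrite !exprS; ring.
have -> : k.+1%:R * d = k%:R * d + d by rewrite -natr1; ring.
apply: (le_trans (ler_normD _ _)).
rewrite !normrM lerD //.
  by apply: le_trans IH; rewrite ler_piMl.
by apply: le_trans ab; rewrite ler_piMr // normrX exprn_ile1.
Qed.

(* A slowly modulated Laplacian K ~ diag(w) L: the commutators are of the size
   d of the increments of w, so K ^ k ~ diag(w ^ k) L ^ k, and the diagonal
   entries of L ^ k are central binomial coefficients. *)
Lemma cyc_power_diag (k : nat) : exists2 c : R, 0 <= c &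
  forall (M : nat) (eps w u v h : 'I_M -> R) (d : R), 0 <= d ->
  (forall i, eps i ^+ 2 = 1) ->
  (forall i, `|w i| <= 1) -> (forall i, `|u i| <= 1) ->
  (forall i, `|v i| <= 1) -> (forall i, `|h i| <= 1) ->
  (forall i, `|w (ordS i) - w i| <= d) -> (forall i, `|u i - w i| <= d) ->
  (forall i, `|v i - w (ordS i)| <= d) -> (forall i, `|h i - eps i * w i| <= d) ->
  rowsum_le (cyc u v h h ^+ k - diag_mx (\row_i (w i ^+ k)) *m lapl eps ^+ k) (c * d).
Proof.
elim: k => [|k [c c0 IH]].
  exists 0 => // M eps w u v h d d0 *; rewrite mul0r => i.
  rewrite !expr0 big1 // => j _.
  have -> : \row_i0 w i0 ^+ 0 = const_mx 1 by apply/rowP => l; rewrite !mxE.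
  by rewrite diag_const_mx mul1mx subrr mxE normr0.
exists (4 * c + 8 * 4 ^+ k + 4 * k%:R * 4 ^+ k).
  by rewrite !addr_ge0 // ?mulr_ge0 // ?exprn_ge0.
move=> M eps w u v h d d0 e2 w1 u1 v1 h1 ww uw vw hw.
have e1 i : `|eps i| <= 1 by exact: sign_norm_le1.
set K := cyc u v h h; set L := lapl eps.
pose W j : 'M[R]_M := diag_mx (\row_i (w i ^+ j)).
have hK : rowsum_le K 4.
  by rewrite -[4]mulr1; apply: rowsum_le_cyc.
have hL : rowsum_le L 4 by exact: rowsum_le_lapl.
have hW j : rowsum_le (W j) 1.
  by apply: rowsum_le_diag => i; rewrite mxE normrX exprn_ile1.
have WLE j : W j *m L = cyc (fun i => w i ^+ j) (fun i => w (ordS i) ^+ j)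
    (fun i => w i ^+ j * eps i) (fun i => w (ordS i) ^+ j * eps i).
  by rewrite diag_mul_cyc; apply: eq_cyc => i; rewrite !mxE ?mulr1.
have LWE j : L *m W j = cyc (fun i => w i ^+ j) (fun i => w (ordS i) ^+ j)
    (fun i => eps i * w (ordS i) ^+ j) (fun i => eps i * w i ^+ j).
  by rewrite cyc_mul_diag; apply: eq_cyc => i; rewrite !mxE ?mul1r.
have cycB (u1' v1' p1' r1' u2 v2 p2 r2 : 'I_M -> R) :
   cyc u1' v1' p1' r1' - cyc u2 v2 p2 r2 = cyc (fun i => u1' i - u2 i) (fun i => v1' i - v2 i)
     (fun i => p1' i - p2 i) (fun i => r1' i - r2 i).
  by rewrite -scaleN1r cycZ cycD; apply: eq_cyc => i /=; rewrite mulN1r.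
have hKWL : rowsum_le (K - W 1%N *m L) (4 * (2 * d)).
  rewrite WLE /K cycB; apply: rowsum_le_cyc => i; rewrite !expr1.
  - by apply: (le_trans (uw i)); lra.
  - by apply: (le_trans (vw i)); lra.
  - by rewrite mulrC; apply: (le_trans (hw i)); lra.
  have -> : h i - w (ordS i) * eps i = (h i - eps i * w i) - eps i * (w (ordS i) - w i) by ring.
  apply: (le_trans (ler_normB _ _)); rewrite normrM.
  have := hw i; have := ww i; have : `|eps i| * `|w (ordS i) - w i| <= `|w (ordS i) - w i|.
    by rewrite ler_piMl.
  by lra.
have hC : rowsum_le (L *m W k - W k *m L) (4 * (k%:R * d)).
  have kd i : `|w (ordS i) ^+ k - w i ^+ k| <= k%:R * d by exact: distX_le.
  have kd0 : 0 <= k%:R * d by rewrite mulr_ge0.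
  rewrite WLE LWE cycB; apply: rowsum_le_cyc => i; rewrite ?subrr ?normr0 //.
    rewrite [X in _ - X]mulrC -mulrBr normrM; apply: le_trans (kd i).
    by rewrite ler_piMl.
  rewrite [X in _ - X]mulrC -mulrBr normrM distrC; apply: le_trans (kd i).
  by rewrite ler_piMl.
have WS : W k.+1 = W 1%N *m W k.
  by rewrite mulmx_diag; congr diag_mx; apply/rowP => i; rewrite !mxE expr1 exprS.
have -> : K ^+ k.+1 = K *m K ^+ k by exact: exprS.
have -> : L ^+ k.+1 = L *m L ^+ k by exact: exprS.
(* Replace K^k by its approximation, then K by W_1 L, then move L past W_k: the three errors give
   the three summands of the constant. *)
have -> : K *m K ^+ k - diag_mx (\row_i w i ^+ k.+1) *m (L *m L ^+ k) =
   K *m (K ^+ k - W k *m L ^+ k) + ((K - W 1%N *m L) *m (W k *m L ^+ k) +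
   W 1%N *m ((L *m W k - W k *m L) *m L ^+ k)).
  rewrite -/(W k.+1) WS !mulmxBr !mulmxBl !mulmxBr !mulmxA.
  by rewrite [X in _ = _ + X]addrA subrK addrA subrK.
have -> : (4 * c + 8 * 4 ^+ k + 4 * k%:R * 4 ^+ k) * d =
   4 * (c * d) + ((4 * (2 * d)) * 4 ^+ k + (4 * (k%:R * d)) * 4 ^+ k) by ring.
have hLk : rowsum_le (L ^+ k) (4 ^+ k) by exact: rowsum_leX.
have k40 : 0 <= 4 ^+ k :> R by rewrite exprn_ge0.
apply: rowsum_leD.
  by apply: rowsum_leM; rewrite ?mulr_ge0 //; exact: IH.
apply: rowsum_leD.
  apply: rowsum_leM => //.
  by rewrite -[4 ^+ k]mul1r; apply: rowsum_leM.
rewrite -[X in rowsum_le _ X]mul1r; apply: rowsum_leM => //.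
  by rewrite mulr_ge0 // !mulr_ge0.
by apply: rowsum_leM.
Qed.

End DiagPower.

(** * Eigenvalue sums of the symmetrized hopping matrix *)

Section EigenSums.
Variable R : realType.
Local Notation pos x := (Num.max x 0 : R).
Implicit Types (u v : R).

Lemma quad_ge0 u v (h x y : R) : 0 <= u -> 0 <= v -> h ^+ 2 <= u * v ->
  0 <= u * x ^+ 2 + v * y ^+ 2 + 2 * h * x * y.
Proof.
move=> u0 v0 huv; have [u0'|u1] := eqVneq u 0.
  have /eqP h0 : h == 0 by rewrite -sqrf_eq0 eq_le sqr_ge0 andbT (le_trans huv) ?u0' ?mul0r.
  by rewrite u0' h0 !(mulr0,mul0r) add0r addr0 mulr_ge0 ?sqr_ge0.
have {u0}u0 : 0 < u by rewrite lt_neqAle eq_sym u1.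
rewrite -(pmulr_rge0 _ u0).
have -> : u * (u * x ^+ 2 + v * y ^+ 2 + 2 * h * x * y) =
  (u * x + h * y) ^+ 2 + (u * v - h ^+ 2) * y ^+ 2 by ring.
by rewrite addr_ge0 ?sqr_ge0 // mulr_ge0 ?sqr_ge0 // subr_ge0.
Qed.

Lemma qform_cyc M (u v p r : 'I_M -> R) (x : 'I_M -> R) : qform (cyc u v p r) x =
  \sum_i (u i * x i ^+ 2 + v i * x (ordS i) ^+ 2 + (p i + r i) * x i * x (ordS i)).
Proof.
have D (a b : 'I_M) : qform (delta_mx a b) x = x a * x b.
  rewrite /qform (bigD1 a) //= (bigD1 b) //= !big1 => [|i ia|i ib].
  - by rewrite !mxE !eqxx !addr0 mul1r.
  - by rewrite big1 // => j _; rewrite mxE (negbTE ia) mul0r.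
  - by rewrite mxE (negbTE ib) andbF mul0r.
have A (K L : 'M[R]_M) : qform (K + L) x = qform K x + qform L x.
  rewrite /qform -big_split; apply: eq_bigr => i _ /=; rewrite -big_split.
  by apply: eq_bigr => j _ /=; rewrite mxE mulrDl.
have S c (K : 'M[R]_M) : qform (c *: K) x = c * qform K x.
  rewrite /qform mulr_sumr; apply: eq_bigr => i _ /=; rewrite mulr_sumr.
  by apply: eq_bigr => j _ /=; rewrite mxE -mulrA.
have Z : qform (0 : 'M[R]_M) x = 0.
  by rewrite /qform big1 // => i _; rewrite big1 // => j _; rewrite mxE mul0r.
rewrite /cyc (big_morph (fun K => qform K x) A Z); apply: eq_bigr => i _.
by rewrite !A !S !D; ring.
Qed.

(** The quadratic form is a sum over bonds of binary forms, each nonnegative by its discriminant. *)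
Lemma psd_cyc M (u v h : 'I_M -> R) : (forall i, 0 <= u i) -> (forall i, 0 <= v i) ->
  (forall i, h i ^+ 2 <= u i * v i) -> psd (cyc u v h h).
Proof.
move=> u0 v0 huv x; rewrite qform_cyc; apply: sumr_ge0 => i _.
have -> : h i + h i = 2 * h i by ring.
exact: quad_ge0.
Qed.

Lemma pos_ge0 u : 0 <= pos u.
Proof. by rewrite le_max lexx orbT. Qed.

Lemma posP u : (0 <= u /\ pos u = u /\ pos (- u) = 0) \/
  (u < 0 /\ pos u = 0 /\ pos (- u) = - u).
Proof.
have [u0|u0] := boolP (0 <= u); [left|right].
  by rewrite max_l // max_r // oppr_le0.
by move: u0; rewrite -ltNge => u0; rewrite max_r ?max_l // ?oppr_ge0 ltW.
Qed.

Lemma pos_sub u : pos u - pos (- u) = u.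
Proof.
by case: (posP u) => -[_ [-> ->]]; rewrite ?subr0 // sub0r opprK.
Qed.

Lemma pos_lip u v : `|pos u - pos v| <= `|u - v|.
Proof.
by rewrite /Num.max; case: ltP => a; case: ltP => b; rewrite ?subrr ?normr0 // ler_normr ?ler_norml;
   case: (ger0P (u - v)); lra.
Qed.

Lemma pos_le1 u : `|u| <= 1 -> `|pos u| <= 1.
Proof. by move=> u1; have := pos_lip u 0; rewrite maxxx !subr0 => /le_trans; apply. Qed.

(** With a = sqrt u and b = sqrt v it reads a |b - a| <= (a + b) |b - a|. *)
Lemma sqrt_mul_dist u v : 0 <= u -> 0 <= v -> `|Num.sqrt (u * v) - u| <= `|v - u|.
Proof.
move=> u0 v0.
rewrite sqrtrM //; have := sqr_sqrtr u0; have := sqr_sqrtr v0.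
have := sqrtr_ge0 u; have := sqrtr_ge0 v.
move: (Num.sqrt u) (Num.sqrt v) => a b b0 a0 <- <-.
rewrite (_ : a * b - a ^+ 2 = a * (b - a)); last by ring.
rewrite subr_sqr normrM [leRHS]normrM [leLHS]mulrC ler_wpM2l //.
by rewrite !ger0_norm ?addr_ge0 // lerDr.
Qed.

Section Hopping.
Variables (M : nat) (eps u v : 'I_M -> R).

(** Up to [eps], the geometric mean of u and v taken with their common sign. The two parts are kept
    apart so that the matrix splits into a difference of two positive semidefinite ones. *)
Definition hop i : R := eps i * (Num.sqrt (pos (u i) * pos (v i)) -
                                 Num.sqrt (pos (- u i) * pos (- v i))).

Hypothesis eps2 : forall i, eps i ^+ 2 = 1.
Hypothesis uv0 : forall i, 0 <= u i * v i.

Let hp i : R := eps i * Num.sqrt (pos (u i) * pos (v i)).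
Let hm i : R := eps i * Num.sqrt (pos (- u i) * pos (- v i)).

Lemma hop_sqr i : hop i ^+ 2 = u i * v i.
Proof.
rewrite /hop exprMn eps2 mul1r.
case: (posP (u i)) => -[u0 [-> ->]]; rewrite mul0r sqrtr0 ?subr0 ?sub0r.
  have [->|un0] := eqVneq (u i) 0; first by rewrite !mul0r sqrtr0 expr0n.
  have u1 : 0 < u i by rewrite lt_neqAle eq_sym un0.
  have v0 : 0 <= v i by rewrite -(pmulr_rge0 _ u1).
  by rewrite max_l // sqr_sqrtr.
have v0 : v i <= 0 by rewrite -(nmulr_rge0 _ u0).
rewrite sqrrN max_l ?oppr_ge0 //.
by rewrite mulrNN sqr_sqrtr.
Qed.

Hypothesis u1 : forall i, `|u i| <= 1.
Hypothesis v1 : forall i, `|v i| <= 1.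

Let e1 i : `|eps i| <= 1. Proof. exact: sign_norm_le1. Qed.

Lemma hop_le1 i : `|hop i| <= 1.
Proof.
rewrite -[leRHS]sqrtr1 -sqrtr_sqr hop_sqr ler_wsqrtr //.
by rewrite (le_trans (ler_norm _)) // normrM mulr_ile1.
Qed.

Let scalar_cyc (c : R) : c%:M = cyc (fun=> c / 2) (fun=> c / 2) (fun=> 0) (fun=> 0) :> 'M[R]_M.
Proof.
have H (f : 'I_M -> 'I_M) : injective f -> \sum_i (c / 2) *: delta_mx (f i) (f i) = (c / 2)%:M :> 'M[R]_M.
  move=> fi; have S1 : \sum_i delta_mx (f i) (f i) = 1%:M :> 'M[R]_M.
    have [g fK gK] := injF_bij fi; apply/matrixP => x y; rewrite summxE (bigD1 (g x)) //= big1 => [|i ix].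
      by rewrite !mxE gK eqxx addr0 eq_sym.
    rewrite !mxE; case: eqP => // xE; by move: ix; rewrite xE fK eqxx.
  by rewrite -scaler_sumr S1 scalemx1.
rewrite /cyc !big_split /= !H //; last exact: ordS_inj.
rewrite !big1 => [|i _|i _]; rewrite ?scale0r // !addr0 -raddfD /=.
by congr (_%:M); field.
Qed.

(** 4 - H is cyclic with entries 2 - u, 2 - v and -h, where h^2 <= 1 <= (2 - u) (2 - v). After the
    square root, the spectrum lies on segments |t| <= 2, where the test functions are
    approximated. *)
Lemma eigen_le4 P lam j : diagonalizes P lam (cyc u v hop hop) -> lam j <= 4.
Proof.
move=> /diagonalizes_le; apply.
rewrite scalar_cyc -scaleN1r cycZ cycD.
have b1 (x : R) : `|x| <= 1 -> -1 <= x <= 1 by rewrite ler_norml.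
rewrite (@eq_cyc _ _ _ _ _ _ (fun i => 2 - u i) (fun i => 2 - v i) (fun i => - hop i) (fun i => - hop i)).
- apply: psd_cyc => i.
  + by have /andP[_] := b1 _ (u1 i); lra.
  + by have /andP[_] := b1 _ (v1 i); lra.
  rewrite sqrrN; have /andP[_ a] := b1 _ (u1 i); have /andP[_ b] := b1 _ (v1 i).
  have : hop i ^+ 2 <= 1 by rewrite -real_normK ?num_real // exprn_ile1 // hop_le1.
  by nra.
- by move=> i /=; field.
- by move=> i /=; field.
- by move=> i /=; rewrite add0r mulN1r.
- by move=> i /=; rewrite add0r mulN1r.
Qed.

End Hopping.

Lemma eigen_power_sum_pos (k : nat) : exists2 c : R, 0 <= c &
  forall M (eps u v : 'I_M -> R) (d : R) P lam, (k.+1 < M)%N -> 0 <= d ->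
  (forall i, eps i ^+ 2 = 1) -> (forall i, 0 <= u i * v i) ->
  (forall i, `|u i| <= 1) -> (forall i, `|v i| <= 1) ->
  (forall i, `|v i - u i| <= d) -> (forall i, `|v i - u (ordS i)| <= d) ->
  diagonalizes P lam (cyc u v (hop eps u v) (hop eps u v)) ->
  `|\sum_j pos (lam j) ^+ k.+1 - 'C(k.+1.*2, k.+1)%:R * \sum_i pos (u i) ^+ k.+1| <= c * (M%:R * d).
Proof.
have [c c0 Hc] := cyc_power_diag R k.+1.
(* A step of u skips one sample, hence the increment 2 * d and the error c * (2 * d) at each of the
   M sites; the lower bound for even exponents adds two such errors. *)
exists (4 * c); first by rewrite mulr_ge0.
move=> M eps u v d P lam kM d0 e2 uv0 u1 v1 vu vSu dH.
set h := hop eps u v in dH.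
pose B : R := 'C(k.+1.*2, k.+1)%:R.
have e1 i : `|eps i| <= 1 by exact: sign_norm_le1.
have uS i : `|u (ordS i) - u i| <= 2 * d.
  rewrite (_ : u (ordS i) - u i = (v i - u i) - (v i - u (ordS i))); last by ring.
  by apply: (le_trans (ler_normB _ _)); have := vu i; have := vSu i; lra.
have d1 i : `|v i - u (ordS i)| <= 2 * d by apply: (le_trans (vSu i)); lra.
have hdist (f : R -> R) i : (forall x y, `|f x - f y| <= `|x - y|) ->
   `|Num.sqrt (pos (f (u i)) * pos (f (v i))) - pos (f (u i))| <= d.
  move=> lf; apply: (le_trans (sqrt_mul_dist (pos_ge0 _) (pos_ge0 _))).
  by apply: (le_trans (pos_lip _ _)); apply: (le_trans (lf _ _)).
have lid (x y : R) : `|id x - id y| <= `|x - y| by [].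
have lopp (x y : R) : `|- x - - y| <= `|x - y| by rewrite -opprD normrN.
have d20 : 0 <= 2 * d by rewrite mulr_ge0.
have entry (w : 'I_M -> R) (K : 'M[R]_M) x :
    rowsum_le (K ^+ k.+1 - diag_mx (\row_i (w i ^+ k.+1)) *m lapl eps ^+ k.+1) (c * (2 * d)) ->
    `|(K ^+ k.+1) x x - w x ^+ k.+1 * B| <= c * (2 * d).
  move=> /(rowsum_le_entry x x); rewrite mxE [X in _ + X]mxE.
  by rewrite mul_diag_mx !mxE laplX_diag.
have part (f : R -> R) : (forall x y, `|f x - f y| <= `|x - y|) -> (forall x, `|x| <= 1 -> `|f x| <= 1) ->
   forall x, `|(cyc (fun i => pos (f (u i))) (fun i => pos (f (v i)))
     (fun i => eps i * Num.sqrt (pos (f (u i)) * pos (f (v i))))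
     (fun i => eps i * Num.sqrt (pos (f (u i)) * pos (f (v i)))) ^+ k.+1) x x - pos (f (u x)) ^+ k.+1 * B|
     <= c * (2 * d).
  move=> lf f1 x; apply: (entry (fun i => pos (f (u i)))); apply: Hc => // i.
  - exact/pos_le1/f1.
  - exact/pos_le1/f1.
  - exact/pos_le1/f1.
  - rewrite normrM mulr_ile1 // ger0_norm ?sqrtr_ge0 // -[leRHS]sqrtr1 ler_wsqrtr //.
    rewrite mulr_ile1 ?pos_ge0 //.
      by rewrite (le_trans (ler_norm _)) // pos_le1 // f1.
    by rewrite (le_trans (ler_norm _)) // pos_le1 // f1.
  - by apply: (le_trans (pos_lip _ _)); apply: (le_trans (lf _ _)).
  - by rewrite subrr normr0.
  - by apply: (le_trans (pos_lip _ _)); apply: (le_trans (lf _ _)).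
  - rewrite -mulrBr normrM; apply: (@le_trans _ _ d); last lra.
    apply: le_trans (hdist f i lf); rewrite ler_piMl //.
have full x : `|(cyc u v h h ^+ k.+1) x x - u x ^+ k.+1 * B| <= c * (2 * d).
  apply: entry; apply: Hc => // i.
  - exact: hop_le1.
  - by rewrite subrr normr0.
  rewrite /h /hop -mulrBr normrM.
  set s1 := Num.sqrt _; set s2 := Num.sqrt _.
  have -> : s1 - s2 - u i = (s1 - pos (u i)) - (s2 - pos (- u i)).
    by rewrite -{1}(pos_sub (u i)); ring.
  have E : `|s1 - pos (u i) - (s2 - pos (- u i))| <= 2 * d.
    apply: (le_trans (ler_normB _ _)).
    by have := hdist id i lid; have := hdist -%R i lopp; rewrite -/s1 -/s2 /=; lra.
  by apply: le_trans E; rewrite ler_piMl.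
have sumM (I : pred 'I_M) (f g : 'I_M -> R) : (forall x, `|f x - g x * B| <= c * (2 * d)) ->
   `|\sum_(x | I x) f x - B * \sum_(x | I x) g x| <= c * (2 * d) * M%:R.
  move=> fg; rewrite mulr_sumr -sumrB; apply: (le_trans (ler_norm_sum _ _ _)).
  rewrite (@le_trans _ _ (\sum_(x < M) c * (2 * d))) //; last first.
    by rewrite sumr_const card_ord mulr_natr.
  rewrite [leRHS](bigID I) /= -[leLHS]addr0 lerD //.
    by apply: ler_sum => x _; rewrite [B * _]mulrC.
  by apply: sumr_ge0 => x _; rewrite !mulr_ge0.
pose Kp := cyc (fun i => pos (u i)) (fun i => pos (v i))
     (fun i => eps i * Num.sqrt (pos (u i) * pos (v i)))
     (fun i => eps i * Num.sqrt (pos (u i) * pos (v i))).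
pose Km := cyc (fun i => pos (- u i)) (fun i => pos (- v i))
     (fun i => eps i * Num.sqrt (pos (- u i) * pos (- v i)))
     (fun i => eps i * Num.sqrt (pos (- u i) * pos (- v i))).
have KE : cyc u v h h = Kp - Km.
  rewrite /Kp /Km -scaleN1r cycZ cycD; by apply: eq_cyc => i /=; rewrite mulN1r ?pos_sub // -mulrBr.
have psdK (f : R -> R) : psd (cyc (fun i => pos (f (u i))) (fun i => pos (f (v i)))
     (fun i => eps i * Num.sqrt (pos (f (u i)) * pos (f (v i))))
     (fun i => eps i * Num.sqrt (pos (f (u i)) * pos (f (v i))))).
  apply: psd_cyc => i; rewrite ?pos_ge0 //.
  by rewrite exprMn e2 mul1r sqr_sqrtr // mulr_ge0 ?pos_ge0.
have trb (K : 'M[R]_M) (g : 'I_M -> R) :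
  (forall x, `|(K ^+ k.+1) x x - g x ^+ k.+1 * B| <= c * (2 * d)) ->
  `|\tr (K ^+ k.+1) - B * \sum_x g x ^+ k.+1| <= c * (2 * d) * M%:R.
  exact: (sumM predT).
have up : \sum_j pos (lam j) ^+ k.+1 <= \tr (Kp ^+ k.+1).
  apply: (sum_pos_eigen_le k dH); first by rewrite tr_cyc.
    exact: (psdK id).
  rewrite KE opprB addrCA subrr addr0; exact: (psdK -%R).
have um : \sum_j pos (- lam j) ^+ k.+1 <= \tr (Km ^+ k.+1).
  apply: (sum_pos_eigen_le k (diagonalizesN dH)); first by rewrite tr_cyc.
    exact: (psdK -%R).
  rewrite opprK KE addrC subrK; exact: (psdK id).
have tp := trb Kp (fun x => pos (u x)) (part id lid (fun x p => p)).
have n1 (x : R) : `|x| <= 1 -> `|- x| <= 1 by rewrite normrN.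
have tm := trb Km (fun x => pos (- u x)) (part -%R lopp n1).
rewrite ler_norml; apply/andP; split; last first.
  move: tp; rewrite ler_norml => /andP[_ tp].
  have : 0 <= c * (M%:R * d) by rewrite !mulr_ge0.
  by rewrite -/B; lra.
have [ok|ek] := boolP (odd k.+1).
  have lo := sum_pos_eigen_ge (fun x => 0 < u x) dH ok.
  have := sumM (fun x => 0 < u x) _ _ full.
  have -> : \sum_(x | 0 < u x) u x ^+ k.+1 = \sum_x pos (u x) ^+ k.+1.
    rewrite [RHS](bigID (fun x => 0 < u x)) /= [X in _ + X]big1 ?addr0.
      by apply: eq_bigr => x ux; rewrite max_l // ltW.
    by move=> x; rewrite -leNgt => ux; rewrite max_r // expr0n.
  rewrite ler_norml => /andP[lo2 _].
  have : 0 <= c * (M%:R * d) by rewrite !mulr_ge0.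
  by move: lo; rewrite -/B; lra.
have evp (x : R) : x ^+ k.+1 = pos x ^+ k.+1 + pos (- x) ^+ k.+1.
  case: (posP x) => -[_ [-> ->]]; rewrite expr0n /= ?addr0 // add0r.
  by rewrite exprNn -signr_odd (negbTE ek) mul1r.
have tr := diagonalizes_tr (diagonalizesX k.+1 dH).
have tf := trb _ _ full; rewrite tr in tf.
rewrite (eq_bigr (fun j => pos (lam j) ^+ k.+1 + pos (- lam j) ^+ k.+1)) in tf; last by move=> *.
rewrite big_split [X in B * X](eq_bigr (fun x => pos (u x) ^+ k.+1 + pos (- u x) ^+ k.+1)) in tf; last by move=> *.
rewrite big_split /= in tf.
move: tf tm um; rewrite !ler_norml => /andP[tf _] /andP[_ tm] um.
by rewrite -/B; lra.
Qed.

End EigenSums.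

(** * The spectrum of the operator *)

Section Products.
Variable R : comNzRingType.

Lemma prod_even_odd (G : nat -> R) M :
  \prod_(i < M) (G i.*2 * G i.*2.+1) = \prod_(k < M + M) G k.
Proof.
elim: M => [|M IH]; first by rewrite !big_ord0.
by rewrite big_ord_recr /= IH addSn addnS !big_ord_recr /= addnn mulrA.
Qed.

Lemma prod_periodic (G : nat -> R) n q : (forall m, G (m + n)%N = G m) ->
  \prod_(k < n) G (q + k)%N = \prod_(k < n) G k.
Proof.
move=> per; elim: q => [|q <-]; first by apply: eq_bigr.
case: n per => [|n] per; first by rewrite !big_ord0.
rewrite big_ord_recr big_ord_recl /= addn0 mulrC; congr (_ * _).
  by rewrite addSnnS per.
by apply: eq_bigr => i _; rewrite /= addSnnS.
Qed.

Lemma sum_periodic (V : nmodType) (G : nat -> V) n q : (forall m, G (m + n)%N = G m) ->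
  \sum_(k < n) G (q + k)%N = \sum_(k < n) G k.
Proof.
move=> per; elim: q => [|q <-]; first by apply: eq_bigr.
case: n per => [|n] per; first by rewrite !big_ord0.
rewrite big_ord_recr big_ord_recl /= addn0 addrC; congr (_ + _).
  by rewrite addSnnS per.
by apply: eq_bigr => i _; rewrite /= addSnnS.
Qed.

End Products.

Section Symbol.
Variables (R : realType) (M : nat) (phi : R).
Hypothesis M0 : (0 < M)%N.
Local Notation thb := (@thb R M).
Let m0 : M%:R != 0 :> R. Proof. by rewrite pnatr_eq0 -lt0n. Qed.

Definition symb (alpha : R) : R := (cos phi + cos alpha) / 2.
(** The sample at the angle 2 pi (m + 1/2) / N; half-integers make the samples symmetric under m ->
    N - 1 - m. *)
Definition wb (m : nat) : R := symb (pi * (2 * m%:R + 1) / (2 * M%:R)).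

Lemma wbE m : wb m = cos (phi / 2 + thb m%:R) * cos (phi / 2 - thb m%:R).
Proof.
rewrite /wb /symb.
have -> : pi * (2 * m%:R + 1) / (2 * M%:R) = thb m%:R + thb m%:R by rewrite !thbE; field.
have {1}-> : phi = phi / 2 + phi / 2 by field.
rewrite !cosD cosN sinN !(mulrN, mulNr, opprK).
have := cos2Dsin2 (phi / 2); have := cos2Dsin2 (thb m%:R).
move: (cos (phi / 2)) (sin (phi / 2)) (cos (thb m%:R)) (sin (thb m%:R)) => a b c d.
move=> h1 h2; have -> : d * d = 1 - c ^+ 2 by rewrite -h1; ring.
have -> : b * b = 1 - a ^+ 2 by rewrite -h2; ring.
have : d ^+ 2 = 1 - c ^+ 2 by rewrite -h1; ring.
have : b ^+ 2 = 1 - a ^+ 2 by rewrite -h2; ring.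
move=> eb ed; have -> : (a * c - b * d) * (a * c + b * d) = a ^+ 2 * c ^+ 2 - b ^+ 2 * d ^+ 2 by ring.
by rewrite eb ed; field.
Qed.

Lemma symb_le1 x : `|symb x| <= 1.
Proof.
rewrite /symb ler_norml.
have := cos_le1 phi; have := cos_geN1 phi; have := cos_le1 x; have := cos_geN1 x.
by move=> *; apply/andP; split; lra.
Qed.

Lemma wb_per m : wb (m + (M + M)) = wb m.
Proof.
rewrite /wb /symb; congr ((_ + _) / 2); rewrite -[RHS]cosD2pi; congr cos.
by rewrite !natrD -[pi *+ 2]mulr_natr; field.
Qed.

Lemma wb_rev m : (m < M + M)%N -> wb (M + M - m.+1) = wb m.
Proof.
move=> mM; rewrite /wb /symb; congr ((_ + _) / 2); rewrite -[RHS]cosN -[RHS]cosD2pi.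
congr cos; rewrite natrB // -natr1 natrD -[pi *+ 2]mulr_natr.
by field.
Qed.

Lemma wb_decr m n : (m < n < M)%N -> wb n < wb m.
Proof.
move=> /andP[mn nM]; rewrite /wb /symb ltr_pM2r ?invr_gt0 // ltrD2l.
have pi0 := pi_gt0 R.
have M0' : 0 < M%:R :> R by rewrite ltr0n.
have H k : (k < M)%N -> pi * (2 * k%:R + 1) / (2 * M%:R) \in `[0, pi : R].
  move=> kM; rewrite in_itv /=; apply/andP; split.
    apply: divr_ge0; last by rewrite mulr_ge0.
    apply: mulr_ge0; first exact: (ltW pi0).
    by rewrite addr_ge0 ?mulr_ge0.
  have k1 : (2 * k + 1)%N%:R <= (2 * M)%N%:R :> R by rewrite ler_nat; lia.
  rewrite natrD !natrM in k1.
  by rewrite ler_pdivrMr ?mulr_gt0 // ler_wpM2l ?(ltW pi0).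
rewrite ltr_cos ?H //; last by apply: ltn_trans nM.
rewrite ltr_pM2r ?invr_gt0 ?mulr_gt0 // ltr_pM2l // ltrD2r ltr_pM2l //.
by rewrite ltr_nat.
Qed.

(** [q] counts the positive samples in the first half period. By reflection the positive samples
    occupy the 2 q indices N - q <= m < N + q modulo N, and only the samples q and N - q - 1 can
    vanish. *)
Lemma wb_cut : exists q, [/\ (q <= M)%N,
  (forall m, (m < q)%N -> 0 < wb m),
  (forall m, (q < m < M + M - q.+1)%N -> wb m < 0) &
  (q < M)%N -> wb q <= 0].
Proof.
pose P m := (M <= m)%N || (wb m <= 0).
have exP : exists m, P m by exists M; rewrite /P leqnn.
case: (ex_minnP exP) => q Pq qmin; exists q.
have qM : (q <= M)%N by apply: qmin; rewrite /P leqnn.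
have wq : (q < M)%N -> wb q <= 0.
  by move=> qM'; move: Pq; rewrite /P leqNgt qM'.
split=> // [m mq|m /andP[qm mM]].
  rewrite ltNge; apply/negP => wm; move: mq; rewrite ltnNge => /negP; apply.
  by apply: qmin; rewrite /P wm orbT.
have qM' : (q < M)%N by lia.
have H n : (q < n < M)%N -> wb n < 0.
  move=> qnM; apply: lt_le_trans (wq qM'); exact: wb_decr.
have [mM'|mM'] := ltnP m M; first by apply: H; rewrite qm.
by rewrite -wb_rev; [apply: H; lia | lia].
Qed.

End Symbol.

Section Model.
Variables (R : realType) (M : nat) (phi : R).
Hypothesis M0 : (0 < M)%N.
Local Notation N := (M + M)%N.
Local Notation thb := (@thb R M).
Local Notation toC := (real_complex R).
Local Notation wb := (@wb R M phi).
Let m0 : M%:R != 0 :> R. Proof. by rewrite pnatr_eq0 -lt0n. Qed.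

Lemma cosB2pi (x : R) : cos (x - pi *+ 2) = cos x.
Proof. by rewrite -[LHS]cosD2pi subrK. Qed.

Lemma cosBpi (x : R) : cos (x - pi) = - cos x.
Proof. by rewrite -[x in RHS](subrK pi) cosDpi opprK. Qed.

(** The left product runs over cos(phi/2 + thb), the right one over cos(phi/2 - thb), each over a
    full period. The reflection k -> N - 1 - k turns [thb] into pi - thb and exchanges them up to
    sign. *)
Lemma prod_norm_hop q : \prod_(i < M) `|hopu1 q phi i * hopv2 q phi i| =
  \prod_(i < M) `|hopv1 q phi i * hopu2 q phi i|.
Proof.
pose g m : R := `|cos (phi / 2 + thb m%:R)|.
pose f m : R := `|cos (phi / 2 - thb m%:R)|.
have gper m : g (m + N)%N = g m.
  rewrite /g -(_ : `|cos (phi / 2 + thb m%:R + pi)| = `|cos (phi / 2 + thb m%:R)|); last first.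
    by rewrite cosDpi normrN.
  by congr (`|cos _|); rewrite !thbE !natrD; field.
have fper m : f (m + N)%N = f m.
  rewrite /f -(_ : `|cos (phi / 2 - thb m%:R - pi)| = `|cos (phi / 2 - thb m%:R)|); last first.
    by rewrite cosBpi normrN.
  by congr (`|cos _|); rewrite !thbE !natrD; field.
have fg : \prod_(k < N) f k = \prod_(k < N) g k.
  rewrite [RHS](reindex_inj rev_ord_inj); apply: eq_bigr => k _ /=.
  rewrite /f /g -normrN -cosDpi; congr (`|cos _|).
  by rewrite natrB // -natr1 !thbE !natrD; field.
have L : \prod_(i < M) `|hopu1 q phi i * hopv2 q phi i| = \prod_(k < N) g (q.+1 + k)%N.
  rewrite -(prod_even_odd (fun k => g (q.+1 + k)%N)); apply: eq_bigr => i _.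
  by rewrite normrM /g addnS.
have L' : \prod_(i < M) `|hopv1 q phi i * hopu2 q phi i| = \prod_(k < N) f (q.+1 + k)%N.
  rewrite -(prod_even_odd (fun k => f (q.+1 + k)%N)); apply: eq_bigr => i _.
  by rewrite mulrC normrM /f addnS.
by rewrite L L' !prod_periodic // fg.
Qed.

Lemma char_poly_hop : exists q eps, let u := fun i : 'I_M => wb (q + i.*2) in
  let v := fun i : 'I_M => wb (q + i.*2).+1 in
  [/\ forall i, eps i ^+ 2 = 1, forall i, 0 <= u i * v i &
      forall x : R[i], x != 0 -> (char_poly (Amx N phi 0)).[x] =
      \det ((x ^+ 2)%:M - expi phi *: map_mx toC (cyc u v (hop eps u v) (hop eps u v)))].
Proof.
have [q0 [q0M wpos wneg wq]] := wb_cut phi M0.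
(* The first sublattice then starts at q.+1 = q0 + N, which carries the same sample of w as q0. *)
pose q := (q0 + N.-1)%N.
have qE : q.+1 = (q0 + N)%N by rewrite /q; lia.
pose u (i : 'I_M) := wb (q.+1 + i.*2).
pose v (i : 'I_M) := wb (q.+1 + i.*2).+1.
have uE i : u i = hopu1 q phi i * hopu2 q phi i by rewrite /u wbE.
have vE i : v i = hopv1 q phi i * hopv2 q phi i by rewrite /v wbE // mulrC.
have u0E (i : 'I_M) : u i = wb (q0 + i.*2).
  by rewrite /u qE (_ : q0 + N + i.*2 = q0 + i.*2 + N)%N ?wb_per //; lia.
have v0E (i : 'I_M) : v i = wb (q0 + i.*2).+1.
  by rewrite /v qE (_ : (q0 + N + i.*2).+1 = (q0 + i.*2).+1 + N)%N ?wb_per //; lia.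
have wle m : (q0 <= m < N - q0)%N -> wb m <= 0.
  move=> /andP[qm mN]; have q0M' : (q0 < M)%N by lia.
  have [->|mq] := eqVneq m q0; first exact: wq.
  have [mE|mq'] := eqVneq m (N - q0.+1)%N; last by apply/ltW/wneg; lia.
  by rewrite mE wb_rev //; [exact: wq | lia].
have wgt0 m : (N - q0 <= m < N + q0)%N -> 0 < wb m.
  move=> /andP[mN mq]; have [mN'|mN'] := ltnP m N.
    by rewrite -wb_rev //; apply: wpos; lia.
  by rewrite -(subnK mN') wb_per //; apply: wpos; lia.
(* The nonpositive samples, an arc of even length starting at q0, are paired among themselves, and
   so are the positive ones. *)
have uv0 i : 0 <= u i * v i.
  have iM := ltn_ord i; rewrite u0E v0E.
  have [h|h] := ltnP i (M - q0)%N.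
    by rewrite mulr_le0 ?wle //; lia.
  by rewrite mulr_ge0 // ltW // wgt0 //; lia.
pose p (i : 'I_M) := wsign R q i * (hopu1 q phi i * hopv2 q phi i).
pose r (i : 'I_M) := wsign R q i * (hopv1 q phi i * hopu2 q phi i).
(* [hop] has the sign of eps u; this [eps] gives it the sign of p, so that the gauge condition
   concerns absolute values only. *)
pose eps (i : 'I_M) : R := if (0 < p i) == (0 < u i) then 1 else -1.
have e2 i : eps i ^+ 2 = 1 by rewrite /eps; case: ifP; rewrite ?sqrrN expr1n.
pose h := hop eps u v.
have prE i : h i ^+ 2 = p i * r i.
  by rewrite hop_sqr // uE vE /p /r -[LHS]mul1r -(wsign2 R q i); ring.
exists q.+1, eps; split => // x x0.
rewrite (char_poly_Amx_hop M0 q phi x0) mul_hopF_hopG.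
set T := cyc _ _ _ _; set H := cyc _ _ _ _.
suff TH : char_poly T = char_poly H.
  have e0 := expi_neq0 phi.
  have D (K : 'M[R]_M) : \det ((x ^+ 2)%:M - expi phi *: map_mx toC K) =
      expi phi ^+ M * (map_poly toC (char_poly K)).[x ^+ 2 / expi phi].
    rewrite map_char_poly horner_char_poly -detZ scalerBr scale_scalar_mx.
    by rewrite mulrCA divff // mulr1.
  by rewrite !D TH.
have -> : T = cyc u v p r by apply: eq_cyc => i; rewrite ?uE ?vE.
have -> : H = cyc u v h h by [].
have [hn0|] := boolP [forall i, h i != 0].
  move/forallP: hn0 => hn0; apply: char_poly_cyc => //.
  have hp i : h i = `|h i| / `|p i| * p i.
    have p0 : p i != 0.
      by apply: contraNneq (hn0 i) => p0; rewrite -sqrf_eq0 prE p0 mul0r.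
    have un0 : u i != 0.
      by apply: contraNneq (hn0 i) => un0; rewrite -sqrf_eq0 hop_sqr // un0 mul0r.
    have sh : h i = eps i * (if 0 < u i then 1 else -1) * `|h i|.
      rewrite /h /hop normrM.
      have -> : `|eps i| = 1 by rewrite /eps; case: ifP; rewrite ?normrN normr1.
      rewrite mul1r -mulrA; congr (_ * _).
      case: (posP (u i)) => -[ui [-> ->]]; rewrite mul0r sqrtr0 ?subr0 ?sub0r.
        have -> : 0 < u i by rewrite lt_neqAle eq_sym un0.
        by rewrite mul1r ger0_norm ?sqrtr_ge0.
      have -> : (0 < u i) = false by apply/negbTE; rewrite -leNgt ltW.
      by rewrite mulN1r normrN ger0_norm ?sqrtr_ge0.
    have sp : p i = (if 0 < p i then 1 else -1) * `|p i|.
      case: ltP => [pi0|pi0]; first by rewrite mul1r ger0_norm // ltW.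
      by rewrite ler0_norm // mulrNN mul1r.
    rewrite [X in _ = _ * X]sp {1}sh /eps.
    have np0 : `|p i| != 0 by rewrite normr_eq0.
    by case: (0 < p i); case: (0 < u i) => /=; field.
  rewrite (eq_bigr _ (fun i _ => hp i)) big_split /= -[RHS]mul1r; congr (_ * _).
  rewrite prodf_div; set A := \prod_i `|h i|; set B := \prod_i `|p i|.
  have AB : A ^+ 2 = B ^+ 2.
    have -> : B ^+ 2 = \prod_i (`|p i| * `|r i|).
      rewrite big_split expr2 /=; congr (_ * _); rewrite /B /p /r.
      under eq_bigr do rewrite normrM.
      under [RHS]eq_bigr do rewrite normrM.
      by rewrite !big_split /= prod_norm_hop.
    rewrite /A -prodrXl; apply: eq_bigr => i _.
    by rewrite -normrM -prE normrX.
  have A0 : 0 <= A by apply: prodr_ge0.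
  have B0 : 0 <= B by apply: prodr_ge0.
  have -> : A = B by apply/eqP; rewrite -(eqrXn2 (n := 2)) // AB.
  rewrite divff //; apply/prodf_neq0 => i _; rewrite normr_eq0.
  by apply: contraNneq (hn0 i) => p0; rewrite -sqrf_eq0 prE p0 mul0r.
rewrite negb_forall => /existsP[i1 /negPn/eqP h0].
(* A zero of h comes from a zero sample, q0 or N - q0 - 1; these belong to the pairs i = 0 and i = M
   - q0 - 1. *)
have key i : h i = 0 -> [/\ (q0 < M)%N, wb q0 = 0 & (i = 0 :> nat) \/ (i = M - q0.+1 :> nat)%N].
  move=> hi0; have iM := ltn_ord i.
  have : u i * v i = 0 by rewrite -(hop_sqr e2 uv0) -/h hi0 expr0n.
  move=> /eqP; rewrite u0E v0E mulf_eq0 => uv.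
  have iMq : (i < M - q0)%N.
    rewrite ltnNge; apply/negP => h'; move: uv; rewrite !gt_eqF // wgt0 //; lia.
  have q0M' : (q0 < M)%N by lia.
  have rev0 : wb (N - q0.+1) = wb q0 by rewrite wb_rev //; lia.
  case/orP: uv => /eqP w0.
    have [iz|iz] := eqVneq (i : nat) 0.
      by split=> //; [rewrite -w0 iz addn0 | left].
    have : wb (q0 + i.*2) < 0 by apply: wneg; lia.
    by rewrite w0 ltxx.
  have [iz|iz] := eqVneq (i : nat) (M - q0.+1)%N.
    split=> //; last by right.
    by rewrite -rev0 -w0; congr wb; lia.
  have : wb (q0 + i.*2).+1 < 0 by apply: wneg; lia.
  by rewrite w0 ltxx.
have [q0M' w0 _] := key _ h0.
have jM : (M - q0.+1 < M)%N by lia.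
pose a : 'I_M := Ordinal M0; pose b : 'I_M := Ordinal jM.
have hab i : i != a -> i != b -> h i != 0.
  move=> ia ib; apply/eqP => /key[_ _ [e|e]].
    by move/eqP: ia; apply; apply/val_inj.
  by move/eqP: ib; apply; apply/val_inj.
have Eu1 : hopu1 q phi a = - cos (phi / 2 + thb q0%:R).
  rewrite /hopu1 addn0 qE -cosDpi; congr cos.
  by rewrite !thbE !natrD; field.
have Eu2 : hopu2 q phi a = - cos (phi / 2 - thb q0%:R).
  rewrite /hopu2 addn0 qE -cosBpi; congr cos.
  by rewrite !thbE !natrD; field.
have idx : (q.+2 + b.*2)%:R = 4 * M%:R - 1 - q0%:R :> R.
  have -> : (q.+2 + b.*2 = 4 * M - q0.+1)%N by rewrite /=; lia.
  by rewrite natrB; [rewrite natrM -natr1; ring | lia].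
have Ev1 : hopv1 q phi b = cos (phi / 2 + thb q0%:R).
  rewrite /hopv1 idx -[RHS]cosB2pi; congr cos.
  by rewrite !thbE -[pi *+ 2]mulr_natr; field.
have Ev2 : hopv2 q phi b = cos (phi / 2 - thb q0%:R).
  rewrite /hopv2 idx -[RHS]cosD2pi; congr cos.
  by rewrite !thbE -[pi *+ 2]mulr_natr; field.
(* Whichever cosine factor of the zero sample vanishes, it breaks the forward direction at one of
   [a], [b] and the backward direction at the other. *)
move: w0; rewrite wbE // => /eqP; rewrite mulf_eq0 => /orP[]/eqP c0.
  apply: (@char_poly_cyc_degenerate _ _ _ _ _ _ _ a b) => //.
    by rewrite /p Eu1 c0 oppr0 mul0r mulr0.
  by rewrite /r Ev1 c0 mul0r mulr0.
apply: (@char_poly_cyc_degenerate _ _ _ _ _ _ _ b a) => //.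
- by rewrite /p Ev2 c0 !mulr0.
- by rewrite /r Eu2 c0 oppr0 !mulr0.
by move=> i ib ia; exact: hab.
Qed.

Definition rt (x : R) : R[i] := if 0 <= x then toC (Num.sqrt x) else (0 +i* Num.sqrt (- x))%C.

Lemma rt_sqr x : rt x ^+ 2 = toC x.
Proof.
rewrite /rt; case: ifPn => [x0|]; first by rewrite -rmorphXn /= sqr_sqrtr.
rewrite -ltNge => x0; rewrite expr2; apply/eqP; rewrite eq_complex /=.
by rewrite !(mulr0, mul0r) addr0 sub0r -expr2 sqr_sqrtr ?opprK ?eqxx // oppr_ge0 ltW.
Qed.

(** Stated as an identity of sums for every F because the order of [spec] is unspecified. The
    reduction to the cyclic matrix is available off 0 only, which still determines the
    characteristic polynomial. *)
Lemma spec_Amx : exists q eps P lam, let u := fun i : 'I_M => wb (q + i.*2) in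
  let v := fun i : 'I_M => wb (q + i.*2).+1 in
  [/\ forall i, eps i ^+ 2 = 1, forall i, 0 <= u i * v i,
      diagonalizes P lam (cyc u v (hop eps u v) (hop eps u v)) &
      forall (V : nmodType) (F : R[i] -> V), \sum_(z <- spec (Amx N phi 0)) F z =
        \sum_j (F (expi (phi / 2) * rt (lam j)) + F (- (expi (phi / 2) * rt (lam j))))].
Proof.
have [q [eps [e2 uv0 HD]]] := char_poly_hop.
set u := fun i : 'I_M => wb (q + i.*2); set v := fun i : 'I_M => wb (q + i.*2).+1.
have [P [lam dH]] := symmetric_diagonalizes (tr_cyc u v (hop eps u v) (hop eps u v)).
exists q, eps, P, lam; split=> // V F.
pose z j := expi (phi / 2) * rt (lam j).
pose s := flatten [seq [:: z j; - z j] | j <- index_enum 'I_M].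
have sE (S : Type) (idx : S) (op : Monoid.law idx) (G : R[i] -> S) :
   \big[op/idx]_(w <- s) G w = \big[op/idx]_j op (G (z j)) (G (- z j)).
  rewrite /s big_flatten big_map; apply: eq_bigr => j _.
  by rewrite big_cons big_seq1.
rewrite -(sE _ _ _ F); apply: perm_big; apply: prod_XsubC_eq.
rewrite -specP; apply: (@eq_poly_num _ _ _ (fun x => x != 0)).
  exists (fun n => n.+1%:R); split=> [m n /eqP|k]; last by rewrite pnatr_eq0.
  by rewrite eqr_nat eqSS => /eqP.
move=> x x0; rewrite HD // (diagonalizes_det _ _ dH) sE horner_prod.
apply: eq_bigr => j _; rewrite hornerM !hornerXsubC opprK.
have -> : (x - z j) * (x + z j) = x ^+ 2 - z j ^+ 2 by ring.
congr (_ - _); rewrite /z exprMn rt_sqr; congr (_ * _).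
by rewrite expr2 -expiD; congr expi; field.
Qed.

End Model.

(** * Moments of the limit density *)

Section Primitive.
Variable R : numFieldType.
Implicit Types p q : {poly R}.

Definition prim p : {poly R} := \poly_(i < (size p).+1) (p`_i.-1 / i%:R).

Lemma coef_prim p i : (prim p)`_i = p`_i.-1 / i%:R.
Proof.
rewrite coef_poly; case: ltnP => // pi; case: i pi => // i pi.
by rewrite nth_default ?mul0r.
Qed.

Lemma deriv_prim p : (prim p)^`() = p.
Proof.
by apply/polyP => i; rewrite coef_deriv coef_prim /= -[LHS]mulr_natr mulfVK //.
Qed.

Lemma prim_deriv q : prim q^`() = q - (q`_0)%:P.
Proof.
apply/polyP => -[|i]; rewrite coef_prim coefB coefC /= ?invr0 ?mulr0 ?subrr //.
by rewrite coef_deriv -[_`_i.+1 *+ _]mulr_natr mulfK ?subr0 // pnatr_eq0.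
Qed.

Lemma primD p q : prim (p + q) = prim p + prim q.
Proof. by apply/polyP => i; rewrite coefD !coef_prim coefD mulrDl. Qed.

Lemma primZ c p : prim (c *: p) = c *: prim p.
Proof. by apply/polyP => i; rewrite coefZ !coef_prim coefZ mulrA. Qed.

End Primitive.

Section Coefficients.
Variable R : numFieldType.

(** The Taylor coefficients of (1 - x)^(-1/2). *)
Definition cbin (n : nat) : R := 'C(n.*2, n)%:R / 4 ^+ n.

Lemma cbin_ge0 n : 0 <= cbin n.
Proof. by rewrite divr_ge0 // exprn_ge0. Qed.

Lemma cbin0 : cbin 0 = 1.
Proof. by rewrite /cbin bin0 expr0 divr1. Qed.

Lemma cbinS n : n.+1%:R * cbin n.+1 = (n%:R + 1 / 2) * cbin n.
Proof.
have H : (n.+1 * 'C(n.+1.*2, n.+1) = 2 * n.*2.+1 * 'C(n.*2, n))%N.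
  have h1 := mul_bin_diag (n.*2.+2) n.
  have h2 := mul_bin_diag (n.*2.+1) n.
  have e : 'C(n.*2.+1, n) = 'C(n.*2.+1, n.+1).
    by rewrite -bin_sub; [congr 'C(_, _) | ]; lia.
  rewrite doubleS -h1 /= e.
  have -> : (n.*2.+2 * 'C(n.*2.+1, n.+1) = 2 * (n.+1 * 'C(n.*2.+1, n.+1)))%N by rewrite -doubleS -mul2n mulnA.
  by rewrite -h2 /= mulnA.
have := congr1 (fun k => k%:R : R) H; rewrite !natrM => E.
rewrite /cbin exprS.
have n0 : n.+1%:R != 0 :> R by rewrite pnatr_eq0.
have f0 : 4 ^+ n != 0 :> R by rewrite expf_neq0.
rewrite [LHS]mulrA E -[n.*2.+1%:R]natr1 -muln2 natrM; field.
by rewrite f0.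
Qed.

(** In coefficients, the square of (1 - x)^(-1/2) is 1 / (1 - x). Weighting the terms by m + 1 = i +
    (m + 1 - i), symmetry and [cbinS] turn m + 1 times the new sum into m + 1 times the old one. *)
Lemma cbin_conv m : \sum_(i < m.+1) cbin i * cbin (m - i) = 1.
Proof.
elim: m => [|m IH]; first by rewrite big_ord1 cbin0 mulr1.
set S := \sum_(i < m.+2) _.
have rev (F : nat -> nat -> R) n : \sum_(i < n.+1) F i (n - i)%N = \sum_(i < n.+1) F (n - i)%N i.
  rewrite (reindex_inj rev_ord_inj); apply: eq_bigr => i _ /=.
  by rewrite subSS subKn // -ltnS.
have m0 : m.+1%:R != 0 :> R by rewrite pnatr_eq0.
apply: (mulfI m0); transitivity (m.+1%:R * \sum_(i < m.+1) cbin i * cbin (m - i)); last by rewrite IH.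
have -> : m.+1%:R * S = \sum_(i < m.+2) (i%:R * cbin i * cbin (m.+1 - i)%N +
    (m.+1 - i)%N%:R * cbin i * cbin (m.+1 - i)%N).
  rewrite mulr_sumr; apply: eq_bigr => i _.
  by rewrite -!mulrA -mulrDl -natrD subnKC // -ltnS.
rewrite big_split /= (rev (fun i j => j%:R * cbin i * cbin j)).
have -> : \sum_(i < m.+2) i%:R * cbin (m.+1 - i) * cbin i =
  \sum_(i < m.+2) i%:R * cbin i * cbin (m.+1 - i) by apply: eq_bigr => i _; ring.
rewrite big_ord_recl /= !mul0r add0r.
under eq_bigr do rewrite /bump /= add1n cbinS subSS.
have -> : m.+1%:R * \sum_(i < m.+1) cbin i * cbin (m - i) =
  \sum_(i < m.+1) (i%:R * cbin i * cbin (m - i)%N +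
    (m - i)%N%:R * cbin i * cbin (m - i)%N) + \sum_(i < m.+1) cbin i * cbin (m - i)%N.
  rewrite -big_split mulr_sumr; apply: eq_bigr => i _ /=.
  have -> : m.+1%:R = i%:R + (m - i)%N%:R + 1 :> R.
    by rewrite -natrD subnKC ?natr1 // -ltnS.
  ring.
rewrite big_split /= (rev (fun i j => j%:R * cbin i * cbin j)).
have -> : \sum_(i < m.+1) i%:R * cbin (m - i) * cbin i =
  \sum_(i < m.+1) i%:R * cbin i * cbin (m - i) by apply: eq_bigr => i _; ring.
rewrite -!big_split /=; apply: eq_bigr => i _; by field.
Qed.

Variable a : R.

Definition betap (n k : nat) : {poly R} := ((a ^+ 2)%:P - 'X ^+ 2) ^+ k * 'X ^+ n.*2.
(** The integral of (a^2 - x^2)^k x^(2n) from -a to a, defined with a formal primitive so that its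
    recurrences are polynomial algebra. *)
Definition betai (n k : nat) : R := (prim (betap n k)).[a] - (prim (betap n k)).[- a].

(** Integration by parts: (a^2 - x^2)^(k+1) x^(2n+1) vanishes at both ends, and its derivative
    combines the two integrands. *)
Lemma betai_parts n k : (n.*2.+1)%:R * betai n k.+1 = k.+1.*2%:R * betai n.+1 k.
Proof.
pose q : {poly R} := ((a ^+ 2)%:P - 'X ^+ 2) ^+ k.+1 * 'X ^+ n.*2.+1.
have qa : q.[a] = 0 by rewrite /q !hornerE subrr expr0n mul0r.
have qNa : q.[- a] = 0 by rewrite /q !hornerE sqrrN subrr expr0n mul0r.
have dq : q^`() = (n.*2.+1)%:R *: betap n k.+1 + (- k.+1.*2%:R) *: betap n.+1 k.
  rewrite /q derivM deriv_exp derivB derivC !derivXn /= /betap exprS sub0r.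
  rewrite -!mul_polyC !polyCN !polyC_natr !doubleS -[k.*2]muln2 -[n.*2]muln2.
  move: ((a ^+ 2)%:P - 'X ^+ 2 : {poly R}) => b.
  rewrite !exprS; ring.
have := prim_deriv q; rewrite dq primD !primZ => E.
have := congr1 (fun p => p.[a] - p.[- a]) E.
rewrite !(hornerD, hornerZ, hornerN, hornerC) qa qNa /betai => E2.
apply/eqP; rewrite -subr_eq0; apply/eqP.
by move: E2; rewrite subrr => <-; ring.
Qed.

(* Both sides equal the same symmetric expression in double factorials. *)
Lemma cbin_betai_sym n k : cbin n * betai k n = cbin k * betai n k.
Proof.
pose o n : R := \prod_(j < n) (j.*2.+1)%:R.
have o0 m : o m != 0 by apply/prodf_neq0 => i _; rewrite pnatr_eq0.
have H m l : cbin m * betai l m * o (m + l)%N = o m * o l * betai (m + l) 0.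
  elim: m l => [|m IH] l; first by rewrite cbin0 /o big_ord0 !mul1r mulrC.
  have m1 : m.+1%:R != 0 :> R by rewrite pnatr_eq0.
  have l1 : (l.*2.+1)%:R != 0 :> R by rewrite pnatr_eq0.
  have E1 : cbin m.+1 = (m%:R + 1 / 2) * cbin m / m.+1%:R by rewrite -cbinS; field.
  have E2 : betai l m.+1 = m.+1.*2%:R * betai l.+1 m / (l.*2.+1)%:R by rewrite -betai_parts; field.
  have ol : o l.+1 = o l * (l.*2.+1)%:R by rewrite /o big_ord_recr.
  have om : o m.+1 = o m * (m.*2.+1)%:R by rewrite /o big_ord_recr.
  have := IH l.+1; rewrite addnS -addSn => IHl.
  apply: (mulIf l1).
  have -> : o m.+1 * o l * betai (m.+1 + l) 0 * (l.*2.+1)%:R =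
     (m.*2.+1)%:R * (o m * o l.+1 * betai (m.+1 + l) 0) by rewrite ol om; ring.
  have e1 : m.+1.*2%:R = 2 * m.+1%:R :> R by rewrite -natrM mul2n.
  have e2 : (m.*2.+1)%:R = 2 * m%:R + 1 :> R by rewrite -natrM mul2n natr1.
  rewrite -IHl E1 E2 e1 e2.
  by field; rewrite ![1 + _]addrC !natr1 l1 m1.
apply: (mulIf (o0 (n + k)%N)).
by rewrite H (addnC n k) H [(o k) * _]mulrC.
Qed.

End Coefficients.

Section BinomialSeries.
Variable R : realType.

(* The square of the partial sums lies between two partial sums of the
   geometric series, since sum_(i + j = m) cbin i * cbin j = 1. *)
Lemma cbin_partial_sqr (n : nat) (x : R) : 0 <= x ->
  \sum_(i < n) x ^+ i <= (\sum_(i < n) cbin R i * x ^+ i) ^+ 2 <= \sum_(i < n + n) x ^+ i.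
Proof.
move=> x0; pose p : {poly R} := \poly_(i < n) cbin R i.
have pE : p.[x] = \sum_(i < n) cbin R i * x ^+ i by rewrite horner_poly.
have sp : (size (p ^+ 2)%R <= n + n)%N.
  rewrite expr2; apply: (leq_trans (size_polyMleq _ _)).
  by have := size_poly n (cbin R); rewrite -/p; case: (size p) => [|k]; lia.
rewrite -pE -horner_exp (horner_coef_wide _ sp).
have c0 i : 0 <= p`_i by rewrite coef_poly; case: ifP => // _; exact: cbin_ge0.
have cc m : 0 <= (p ^+ 2)`_m <= 1.
  rewrite expr2 coefM sumr_ge0 => [|i _]; last by rewrite mulr_ge0.
  rewrite -(cbin_conv R m); apply: ler_sum => i _; rewrite ler_pM // coef_poly.
    by case: ifP => // _; exact: cbin_ge0.
  by case: ifP => // _; exact: cbin_ge0.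
have c1 m : (m < n)%N -> (p ^+ 2)`_m = 1.
  move=> mn; rewrite expr2 coefM -(cbin_conv R m); apply: eq_bigr => i _.
  have im := ltn_ord i; have h1 : (i < n)%N by lia.
  have h2 : (m - i < n)%N by lia.
  by rewrite !coef_poly h1 h2.
apply/andP; split.
  rewrite big_split_ord /= -[leLHS]addr0 lerD //.
    by apply: ler_sum => i _; rewrite c1 ?mul1r.
  by apply: sumr_ge0 => i _; rewrite mulr_ge0 ?exprn_ge0 //; have /andP[] := cc (n + i)%N.
apply: ler_sum => i _; rewrite ler_piMl ?exprn_ge0 //.
by have /andP[] := cc i.
Qed.

Lemma cvg_cbin_series (x : R) : 0 <= x < 1 ->
  (fun n => \sum_(i < n) cbin R i * x ^+ i) @ \oo --> (Num.sqrt (1 - x))^-1.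
Proof.
move=> /andP[x0 x1]; set S := fun n => _.
have x1' : 0 < 1 - x by rewrite subr_gt0.
have S0 n : 0 <= S n by apply: sumr_ge0 => i _; rewrite mulr_ge0 ?cbin_ge0 ?exprn_ge0.
have geo : (fun n : nat => \sum_(i < n) x ^+ i) @ \oo --> (1 - x)^-1.
  have := @cvg_geometric_series R 1 x; rewrite ger0_norm // => /(_ x1).
  rewrite div1r; apply: cvg_trans; apply: near_eq_cvg; near=> n.
  by rewrite /series /= /geometric /= big_mkord; apply: eq_bigr => i _; rewrite mul1r.
have geo2 : (fun n : nat => \sum_(i < n + n) x ^+ i) @ \oo --> (1 - x)^-1.
  have H : (fun n : nat => (n + n)%N) @ \oo --> \oo.
    apply/cvgnyPge => A; near=> n; rewrite (@leq_trans n) ?leq_addr //.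
    by near: n; exact: nbhs_infty_ge.
  exact: (@cvg_comp _ _ _ (fun n => (n + n)%N) (fun n : nat => \sum_(i < n) x ^+ i) _ _ _ H geo).
have S2 : (fun n => S n ^+ 2) @ \oo --> (1 - x)^-1.
  apply: (squeeze_cvgr _ geo geo2); near=> n; exact: cbin_partial_sqr.
have -> : (Num.sqrt (1 - x))^-1 = Num.sqrt ((1 - x)^-1) by rewrite sqrtrV // ltW.
have -> : S = (fun n => Num.sqrt (S n ^+ 2)).
  by apply/funext => n; rewrite sqrtr_sqr ger0_norm.
apply: (@cvg_comp _ _ _ (fun n => S n ^+ 2) Num.sqrt _ _ _ S2); exact: sqrt_continuous.
Unshelve. all: by end_near. Qed.

Lemma eseries_cbin (x : R) : 0 <= x < 1 ->
  (\sum_(n <oo) (cbin R n * x ^+ n)%:E = ((Num.sqrt (1 - x))^-1)%:E)%E.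
Proof.
move=> x01; have := cvg_cbin_series x01 => H.
apply/cvg_lim => //=.
have -> : (fun n => \sum_(0 <= i < n) (cbin R i * x ^+ i)%:E)%E =
   EFin \o (fun n => \sum_(i < n) cbin R i * x ^+ i).
  by apply/funext => n /=; rewrite sumEFin big_mkord.
exact: (@cvg_comp _ _ _ (fun n => \sum_(i < n) cbin R i * x ^+ i) EFin _ _ _ H).
Qed.

End BinomialSeries.

Section FTC.
Variable R : realType.
Local Notation mu := (@lebesgue_measure R).

Lemma ftc_segment (f F : R -> R) (a b : R) : a <= b -> continuous f ->
  (forall x : R, is_derive x 1 F (f x)) ->
  (\int[mu]_(x in `[a, b]) (f x)%:E = (F b - F a)%:E)%E.
Proof.
rewrite le_eqVlt => /orP[/eqP<- _ _|ab cf dF].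
  by rewrite set_itv1 integral_set1 subrr.
have cF : continuous F.
  by move=> x; apply: differentiable_continuous; apply/derivable1_diffP; have [] := dF x.
rewrite (@continuous_FTC2 _ f F) //.
- by apply: continuous_subspaceT.
- split.
  + by move=> x _; have [] := dF x.
  + exact/cvg_at_right_filter/cF.
  + exact/cvg_at_left_filter/cF.
- by move=> x _; rewrite derive1E; exact: derive_val.
Qed.

End FTC.

Section Wallis.
Variable R : realType.
Local Notation mu := (@lebesgue_measure R).

(** The primitive of sin^(2n) that vanishes at 0, from the reduction formula; at pi/2 its recurrence
    becomes that of [cbin]. *)
Fixpoint sinprim (n : nat) (x : R) : R := if n is n'.+1 then
  ((n'.*2.+1)%:R * sinprim n' x - sin x ^+ n'.*2.+1 * cos x) / (n'.*2.+2)%:R else x.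

Lemma is_derive_sinprim n (x : R) : is_derive x 1 (sinprim n) (sin x ^+ n.*2).
Proof.
elim: n => [|n IH]; first by rewrite expr0; exact: is_derive_id.
have dsc : is_derive x 1 ((@sin R) ^+ n.*2.+1 * (@cos R))
    ((n.*2.+1)%:R * sin x ^+ n.*2 * cos x ^+ 2 - sin x ^+ n.*2.+2).
  apply: is_derive_eq.
  rewrite !fctE /GRing.scale /= !exprS -mulr_natr; ring.
have -> : sinprim n.+1 = (n.*2.+2)%:R^-1 \*: ((n.*2.+1)%:R \*: sinprim n -
   ((@sin R) ^+ n.*2.+1 * (@cos R))).
  by apply/funext => y; rewrite /= !fctE /GRing.scale /= mulrC.
apply: is_derive_eq; rewrite /GRing.scale /= cos2sin2 -[n.*2.+2%:R]natr1 !exprS.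
have n0 : n.*2.+1%:R + 1 != 0 :> R by rewrite natr1 pnatr_eq0.
by field.
Qed.

Lemma sinprim_pihalf n : sinprim n (pi / 2) = pi / 2 * cbin R n.
Proof.
elim: n => [|n IH] /=; first by rewrite cbin0 mulr1.
rewrite IH cos_pihalf mulr0 subr0.
have E : cbin R n.+1 = (n%:R + 1 / 2) * cbin R n / n.+1%:R.
  by rewrite -cbinS mulrC mulKf // pnatr_eq0.
have n0 : n%:R + 1 != 0 :> R by rewrite natr1 pnatr_eq0.
rewrite E -[n.*2.+2%:R]natr1 -[n.*2.+1%:R]natr1 -[n.+1%:R]natr1 -muln2 natrM.
have n1 : n%:R * 2 + 1 + 1 != 0 :> R by rewrite -natrM !natr1 pnatr_eq0.
by field; rewrite n0 n1.
Qed.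

Lemma sinprim0 n : sinprim n 0 = 0.
Proof. by elim: n => [|n IH] //=; rewrite IH sin0 exprS mul0r mulr0 mul0r subrr mul0r. Qed.

Lemma wallis n : (\int[mu]_(x in `[0%R, (pi / 2)%R]) (sin x ^+ n.*2)%:E = (pi / 2 * cbin R n)%:E)%E.
Proof.
rewrite (ftc_segment _ _ (is_derive_sinprim n)).
- by rewrite sinprim_pihalf sinprim0 subr0.
- by rewrite divr_ge0 // pi_ge0.
- move=> x; apply: (@continuous_comp _ _ _ sin (fun y => y ^+ n.*2)).
    exact: continuous_sin.
  exact: exprn_continuous.
Qed.

(** The binomial series in k^2 sin^2 x supplies one factor [cbin] and may be integrated termwise
    since its terms are nonnegative; the Wallis integrals supply the other. *)
Lemma ellK_series (k : R) : 0 <= k < 1 ->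
  (ellK k = \sum_(n <oo) (pi / 2 * cbin R n ^+ 2 * k ^+ n.*2)%:E)%E.
Proof.
move=> /andP[k0 k1]; rewrite /ellK k1.
transitivity (\int[mu]_(x in `[0%R, (pi / 2)%R])
   (\sum_(n <oo) (cbin R n * k ^+ n.*2 * sin x ^+ n.*2)%:E))%E.
  apply: eq_integral => x _; rewrite -eseries_cbin.
    apply: eq_eseriesr => n _; congr EFin.
    by rewrite exprMn -!exprM !mul2n mulrA.
  rewrite mulr_ge0 ?sqr_ge0 //=.
  have s1 : sin x ^+ 2 <= 1 by rewrite sin2cos2 lerBlDr lerDl sqr_ge0.
  apply: (@le_lt_trans _ _ (k ^+ 2)); first by rewrite ler_piMr ?sqr_ge0.
  by rewrite expr_lt1.
have m n : measurable_fun `[0%R, (pi / 2)%R] (fun x : R => (cbin R n * k ^+ n.*2 * sin x ^+ n.*2)%:E).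
  apply/measurable_EFinP; apply: measurable_funM => //; apply: measurable_funX.
  by apply: measurable_funTS; exact: (continuous_measurable_fun (@continuous_sin R)).
have p n (x : R) : 0 <= sin x ^+ n.*2 by rewrite -muln2 mulnC exprM exprn_ge0 // sqr_ge0.
rewrite integral_nneseries //; last first.
  by move=> n x _; rewrite lee_fin mulr_ge0 // mulr_ge0 ?cbin_ge0 ?exprn_ge0.
apply: eq_eseriesr => n _.
under eq_integral do rewrite EFinM.
rewrite ge0_integralZl //.
- by rewrite wallis -EFinM; congr EFin; ring.
- apply/measurable_EFinP; apply: measurable_funX.
  by apply: measurable_funTS; exact: (continuous_measurable_fun (@continuous_sin R)).
- by move=> x _; rewrite lee_fin.
- by rewrite lee_fin mulr_ge0 ?cbin_ge0 ?exprn_ge0.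
Qed.

End Wallis.

Section Moments.
Variable R : realType.
Local Notation mu := (@lebesgue_measure R).

Lemma ae_eq_finite (D : set R) (s : seq R) (f g : R -> \bar R) :
  (forall x, D x -> x \notin s -> f x = g x) -> ae_eq mu D f g.
Proof.
move=> fg; exists [set` s]; split.
- apply: countable_measurable => [x|]; first exact: measurable_set1.
  exact/finite_set_countable/finite_seq.
- exact/countable_lebesgue_measure0/finite_set_countable/finite_seq.
- move=> x /= /not_implyP[Dx nfg]; apply/negP => /negP xs; apply: nfg.
  exact: fg.
Qed.

Variable a : R.
Hypothesis a01 : 0 <= a <= 1.

(** The factor 2 * 4 ^+ k comes from the substitution t = 2 x. *)
Lemma integral_even_monomial k n :
  (\int[mu]_(t in `[(- (2 * a))%R, (2 * a)%R]) (t ^+ k.*2 * (a ^+ 2 - t ^+ 2 / 4) ^+ n)%:E =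
   (2 * 4 ^+ k * betai a k n)%:E)%E.
Proof.
have a0 : 0 <= a by case/andP: a01.
pose F : R -> R := fun t => 2 * 4 ^+ k * (prim (betap a k n)).[t / 2].
have dF (t : R) : is_derive t 1 F (t ^+ k.*2 * (a ^+ 2 - t ^+ 2 / 4) ^+ n).
  have d2 : is_derive t 1 (2^-1 \*: (@id R)) (2^-1 : R).
    by apply: is_derive_eq; rewrite /GRing.scale /= mulr1.
  have -> : F = (2 * 4 ^+ k) \*: (horner (prim (betap a k n)) \o (2^-1 \*: (@id R))).
    by apply/funext => y; rewrite /F /= /GRing.scale /= [2^-1 * y]mulrC.
  apply: is_derive_eq; rewrite /GRing.scale /= deriv_prim /betap.
  rewrite !hornerE /= !exprMn -muln2 mulnC !exprM exprMn.
  have -> : a ^+ 2 - 2^-1 ^+ 2 * t ^+ 2 = a ^+ 2 - t ^+ 2 / 4 by field.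
  have e4 : 4 ^+ k * (2^-1 ^+ k * 2^-1 ^+ k) = 1 :> R.
    by rewrite -!exprMn (_ : 4 * _ = 1) ?expr1n //; field.
  move: (_ ^+ n) (t ^+ 2 ^+ k) => b c.
  have -> : 2 * 4 ^+ k * b * (2^-1 ^+ k * 2^-1 ^+ k * c) / 2 =
    4 ^+ k * (2^-1 ^+ k * 2^-1 ^+ k) * (c * b) by field.
  by rewrite e4 mul1r.
rewrite (ftc_segment _ _ dF).
- have h1 : 2 * a / 2 = a by field.
  have h2 : - (2 * a) / 2 = - a by field.
  by rewrite /F -mulrBr /betai h1 h2.
- lra.
- move=> t; apply: cvgM; first exact: exprn_continuous.
  apply: (@continuous_comp _ _ _ (fun t : R => a ^+ 2 - t ^+ 2 / 4) (fun y : R => y ^+ n)); last exact: exprn_continuous.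
  apply: cvgB; first exact: cvg_cst.
  by apply: cvgM; [exact: exprn_continuous | exact: cvg_cst].
Qed.

Lemma betai_ge0 k n : 0 <= betai a k n.
Proof.
have a0 : 0 <= a by case/andP: a01.
have := integral_even_monomial k n => E.
have : (0 <= (2 * 4 ^+ k * betai a k n)%:E)%E.
  rewrite -E; apply: integral_ge0 => t; rewrite /= in_itv /= -ler_norml => ta.
  have : t ^+ 2 <= (2 * a) ^+ 2 by rewrite -real_normK ?num_real // lerXn2r ?nnegrE //; lra.
  rewrite exprMn => t2; rewrite lee_fin mulr_ge0 //.
    by rewrite -muln2 mulnC exprM exprn_ge0 // sqr_ge0.
  by rewrite exprn_ge0 //; lra.
by rewrite lee_fin pmulr_rge0 // mulr_gt0 // exprn_gt0.
Qed.

(** The point t = 0 is left out because for a = 1 the modulus there is 1 and the elliptic integral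
    diverges. *)
Lemma gdens_series (t : R) : `|t| < 2 * a -> t != 0 ->
  (gdens a t = \sum_(n <oo) ((pi ^+ 2)^-1 * (pi / 2) * cbin R n ^+ 2 * (a ^+ 2 - t ^+ 2 / 4) ^+ n)%:E)%E.
Proof.
case/andP: a01 => a0 a1 ta t0; rewrite /gdens ta.
have tt : t ^+ 2 < 4 * a ^+ 2.
  by rewrite -real_normK ?num_real // (_ : 4 * a ^+ 2 = (2 * a) ^+ 2) ?ltr_pXn2r ?nnegrE //; [lra | ring].
have s0 : 0 <= a ^+ 2 - t ^+ 2 / 4 by lra.
have t2 : 0 < t ^+ 2 by rewrite lt_neqAle sqr_ge0 eq_sym sqrf_eq0 t0.
have s1 : a ^+ 2 - t ^+ 2 / 4 < 1.
  have : a ^+ 2 <= 1 by rewrite exprn_ile1.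
  lra.
rewrite ellK_series; last by rewrite sqrtr_ge0 /= -[X in _ < X]sqrtr1 ltr_sqrt.
rewrite -nneseriesZl; last first.
  move=> n _; rewrite lee_fin mulr_ge0 ?exprn_ge0 ?sqrtr_ge0 //.
  by rewrite mulr_ge0 ?sqr_ge0 // divr_ge0 // pi_ge0.
apply: eq_eseriesr => n _; rewrite -EFinM; congr EFin.
by rewrite -muln2 mulnC exprM sqr_sqrtr // !mulrA.
Qed.

(** Termwise integration produces cbin n^2 times [betai a k n]; [cbin_betai_sym] trades one factor
    so that n and k change places, which is the form in which the angle integral arises. *)
Lemma gdens_even_moment k :
  (\int[mu]_t ((t ^+ k.*2)%:E * gdens a t) =
   \sum_(n <oo) (4 ^+ k * cbin R k / pi * (cbin R n * betai a n k))%:E)%E.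
Proof.
case/andP: a01 => a0 a1.
pose D : set R := `[(- (2 * a))%R, (2 * a)%R]%classic.
have pge0 (t : R) : 0 <= t ^+ k.*2 by rewrite -muln2 mulnC exprM exprn_ge0 // sqr_ge0.
have mD : measurable D by exact: measurable_itv.
have mpow (m : nat) : measurable_fun [set: R] (fun t : R => t ^+ m) by exact: measurable_funX.
pose g n (t : R) : \bar R :=
  ((pi ^+ 2)^-1 * (pi / 2) * cbin R n ^+ 2 * (t ^+ k.*2 * (a ^+ 2 - t ^+ 2 / 4) ^+ n))%:E.
have c0 n : 0 <= (pi ^+ 2)^-1 * (pi / 2) * cbin R n ^+ 2 :> R.
  by rewrite !mulr_ge0 ?sqr_ge0 ?invr_ge0 ?sqr_ge0 ?pi_ge0.
have t4 t : D t -> 0 <= a ^+ 2 - t ^+ 2 / 4.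
  rewrite /D /= in_itv /= -ler_norml => ta.
  have : t ^+ 2 <= (2 * a) ^+ 2 by rewrite -real_normK ?num_real // lerXn2r ?nnegrE //; lra.
  by rewrite exprMn; lra.
have g0 n t : D t -> (0 <= g n t)%E.
  by move=> Dt; rewrite lee_fin mulr_ge0 // mulr_ge0 // exprn_ge0 // t4.
have mg n : measurable_fun D (g n).
  apply: measurable_funTS; apply/measurable_EFinP; apply: measurable_funM => //.
  apply: measurable_funM => //; apply: measurable_funX; apply: measurable_funB => //.
  by apply: measurable_funM.
transitivity (\int[mu]_(t in D) ((t ^+ k.*2)%:E * gdens a t))%E.
  rewrite [RHS]integral_mkcond; apply: eq_integral => t _; rewrite patchE.
  case: ifPn => // /negP; rewrite inE /D /= in_itv /= -ler_norml => tD.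
  by rewrite /gdens ifF ?mule0 //; apply/negP => /ltW.
transitivity (\int[mu]_(t in D) (\sum_(n <oo) g n t))%E.
  apply: ge0_ae_eq_integral => //.
  - apply: emeasurable_funM; last by apply: measurable_funTS; exact: measurable_gdens.
    by apply: measurable_funTS; apply/measurable_EFinP; exact: mpow.
  - by apply: (@ge0_emeasurable_sum _ _ _ _ g xpredT) => [n t Dt _|n _]; [exact: g0 | exact: mg].
  - by move=> t _; rewrite mule_ge0 ?gdens_ge0 // lee_fin.
  - by move=> t Dt; apply: nneseries_ge0 => n _ _; exact: g0.
  apply: (@ae_eq_finite _ [:: - (2 * a); 0; 2 * a]) => t Dt.
  rewrite !inE !negb_or => /and3P[t1 t2 t3].
  move: (Dt); rewrite /D /= in_itv /= => /andP[l1 l2].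
  rewrite gdens_series //; last first.
    by rewrite ltr_norml !lt_neqAle l1 l2 t3 eq_sym t1.
  rewrite -nneseriesZl; last first.
    by move=> n _; rewrite lee_fin mulr_ge0 // exprn_ge0 // t4.
  by apply: eq_eseriesr => n _; rewrite -EFinM; congr EFin; ring.
rewrite integral_nneseries //; apply: eq_eseriesr => n _; rewrite /g.
under eq_integral do rewrite EFinM.
rewrite ge0_integralZl //.
- rewrite integral_even_monomial -EFinM; congr EFin.
  have pi0 : pi != 0 :> R by rewrite gt_eqF // pi_gt0.
  have -> : 4 ^+ k * cbin R k / pi * (cbin R n * betai a n k) =
    4 ^+ k / pi * cbin R n * (cbin R k * betai a n k) by ring.
  rewrite -cbin_betai_sym; move: (pi : R) pi0 => q q0; by field.
- apply: measurable_funTS; apply/measurable_EFinP.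
  apply: measurable_funM => //; apply: measurable_funX; apply: measurable_funB => //.
  by apply: measurable_funM.
- by move=> t Dt; rewrite lee_fin mulr_ge0 // exprn_ge0 // t4.
- by rewrite lee_fin.
Qed.

End Moments.

(** * The moments as integrals over an angle *)

Section Angle.
Variable R : realType.
Local Notation mu := (@lebesgue_measure R).
Variables (psi : R) (k : nat).
Hypothesis psi0pi : 0 <= psi <= pi.
Let a := cos (psi / 2).

Lemma half_angle_symbol (x : R) : (cos psi - cos x) / 2 = a ^+ 2 - cos (x / 2) ^+ 2.
Proof.
have E (y : R) : cos y = cos (y / 2) ^+ 2 *+ 2 - 1.
  by rewrite -cos_mulr2n; congr cos; rewrite -[RHS]mulr_natr; field.
rewrite /a (E psi) (E x); move: (cos _) (cos _) => u v.
by rewrite -[u ^+ 2 *+ 2]mulr_natr -[v ^+ 2 *+ 2]mulr_natr; field.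
Qed.

Let p0 : 0 <= psi. Proof. by case/andP: psi0pi. Qed.
Let p1 : psi <= pi. Proof. by case/andP: psi0pi. Qed.
Let pi0 : 0 < pi :> R. Proof. exact: pi_gt0. Qed.

Lemma cos_half_le x : psi <= x <= pi *+ 2 - psi -> cos (x / 2) ^+ 2 <= a ^+ 2.
Proof.
rewrite -[pi *+ 2]mulr_natr => /andP[x1 x2].
rewrite -subr_ge0 -half_angle_symbol divr_ge0 // subr_ge0.
have [xp|xp] := leP x pi.
  by rewrite leNgt ltr_cos ?in_itv /= ?p0 ?p1 ?xp ?(le_trans p0 x1) // -leNgt.
have -> : cos x = cos (pi *+ 2 - x).
  by rewrite -[RHS]cosN opprB -[RHS]cosD2pi subrK.
rewrite -[pi *+ 2]mulr_natr.
have H (P : R) : 0 < P -> psi <= P -> x <= P * 2 - psi -> P < x ->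
    [/\ psi <= P * 2 - x, 0 <= P * 2 - x & P * 2 - x <= P].
  by move: p0 => *; split; lra.
have [h1 h2 h3] := H _ pi0 p1 x2 xp.
by rewrite leNgt ltr_cos ?in_itv /= ?p0 ?p1 ?h2 ?h3 // -leNgt.
Qed.

Lemma integral_angle_term n :
  (\int[mu]_(x in `[psi, (pi *+ 2 - psi)%R])
     ((a ^+ 2 - cos (x / 2) ^+ 2) ^+ k * cos (x / 2) ^+ n.*2 * sin (x / 2))%:E =
   (2 * betai a n k)%:E)%E.
Proof.
pose F : R -> R := fun x => - 2 * (prim (betap a n k)).[cos (x / 2)].
have dF (x : R) : is_derive x 1 F ((a ^+ 2 - cos (x / 2) ^+ 2) ^+ k * cos (x / 2) ^+ n.*2 * sin (x / 2)).
  have d2 : is_derive x 1 (2^-1 \*: (@id R)) (2^-1 : R).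
    by apply: is_derive_eq; rewrite /GRing.scale /= mulr1.
  have -> : F = (- 2) \*: (horner (prim (betap a n k)) \o ((@cos R) \o (2^-1 \*: (@id R)))).
    by apply/funext => y; rewrite /F /= /GRing.scale /= [2^-1 * y]mulrC.
  apply: is_derive_eq; rewrite /GRing.scale /= deriv_prim /betap.
  rewrite !hornerE /= (_ : 2^-1 *: x = x / 2); [by field | by rewrite /GRing.scale /= mulrC].
rewrite (ftc_segment _ _ dF).
- have h1 : cos ((pi *+ 2 - psi) / 2) = - a.
    have -> : (pi *+ 2 - psi) / 2 = pi - psi / 2.
      by rewrite -[pi *+ 2]mulr_natr; move: (pi : R) => P; field.
    by rewrite cosB cospi sinpi mul0r addr0 mulN1r.
  by rewrite /F /betai h1; congr EFin; rewrite /a; ring.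
- by rewrite -[pi *+ 2]mulr_natr; move: (pi : R) p1 p0 => P *; lra.
have ch (f : R -> R) : continuous f -> continuous (fun x : R => f (x / 2)).
  move=> cf x; apply: (@continuous_comp _ _ _ (fun x : R => x / 2) f); last exact: cf.
  by apply: cvgM; [exact: cvg_id | exact: cvg_cst].
move=> x; apply: cvgM; last exact/ch/continuous_sin.
apply: (ch (fun y => (a ^+ 2 - cos y ^+ 2) ^+ k * cos y ^+ n.*2)) => y.
have cp m : continuous (fun y : R => cos y ^+ m).
  move=> z; apply: (@continuous_comp _ _ _ (@cos R) (fun y : R => y ^+ m)); [exact: continuous_cos | exact: exprn_continuous].
apply: cvgM; last exact: cp.
apply: (@continuous_comp _ _ _ (fun y : R => a ^+ 2 - cos y ^+ 2) (fun y : R => y ^+ k)); last exact: exprn_continuous.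
by apply: cvgB; [exact: cvg_cst | exact: cp].
Qed.

(** Insert 1 = sin(x/2) (1 - cos(x/2)^2)^(-1/2), expand the root in its series, and substitute y =
    cos(x/2) in each term. On this interval all terms are nonnegative, so the sum and the integral
    commute. *)
Lemma integral_angle :
  (\int[mu]_(x in `[psi, (pi *+ 2 - psi)%R]) (((cos psi - cos x) / 2) ^+ k)%:E =
   \sum_(n <oo) (2 * (cbin R n * betai a n k))%:E)%E.
Proof.
pose D : set R := `[psi, (pi *+ 2 - psi)%R]%classic.
have mD : measurable D by exact: measurable_itv.
pose g n (x : R) : \bar R := (cbin R n *
   ((a ^+ 2 - cos (x / 2) ^+ 2) ^+ k * cos (x / 2) ^+ n.*2 * sin (x / 2)))%:E.
have mch (f : R -> R) : continuous f -> measurable_fun D (fun x : R => f (x / 2)).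
  move=> cf; apply: measurable_funTS; apply: continuous_measurable_fun => x.
  apply: (@continuous_comp _ _ _ (fun x : R => x / 2) f); last exact: cf.
  by apply: cvgM; [exact: cvg_id | exact: cvg_cst].
have mc := mch _ (@continuous_cos R); have ms := mch _ (@continuous_sin R).
have mt n : measurable_fun D (fun x : R => (a ^+ 2 - cos (x / 2) ^+ 2) ^+ k * cos (x / 2) ^+ n.*2 * sin (x / 2)).
  apply: measurable_funM => //; apply: measurable_funM; last exact: measurable_funX.
  by apply: measurable_funX; apply: measurable_funB => //; exact: measurable_funX.
have t0 n x : D x -> 0 <= (a ^+ 2 - cos (x / 2) ^+ 2) ^+ k * cos (x / 2) ^+ n.*2 * sin (x / 2).
  rewrite /D /= in_itv /= => Dx; have := cos_half_le Dx => cl.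
  move: Dx; rewrite -[pi *+ 2]mulr_natr => /andP[x1 x2].
  rewrite mulr_ge0 // ?mulr_ge0 //.
  - by rewrite exprn_ge0 // subr_ge0.
  - by rewrite -muln2 mulnC exprM exprn_ge0 // sqr_ge0.
  - by apply: sin_ge0_pi; move: (pi : R) x1 x2 p0 => P *; apply/andP; split; lra.
transitivity (\int[mu]_(x in D) (\sum_(n <oo) g n x))%E.
  apply: ge0_ae_eq_integral => //.
  - apply/measurable_EFinP; apply: measurable_funX; apply: measurable_funM => //.
    apply: measurable_funB => //; apply: measurable_funTS.
    exact: (continuous_measurable_fun (@continuous_cos R)).
  - apply: (@ge0_emeasurable_sum _ _ _ _ g xpredT) => [n t Dt _|n _].
      by rewrite lee_fin mulr_ge0 ?cbin_ge0 // t0.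
    by apply/measurable_EFinP; apply: measurable_funM.
  - move=> x Dx; rewrite lee_fin half_angle_symbol exprn_ge0 // subr_ge0.
    by apply: cos_half_le; move: Dx; rewrite /D /= in_itv.
  - move=> x Dx; apply: nneseries_ge0 => n _ _.
    by rewrite lee_fin mulr_ge0 ?cbin_ge0 // t0.
  (* At these two points sin(x/2) = 0 and the inserted factor is meaningless; they lie in the
     interval only for psi = 0. *)
  apply: (@ae_eq_finite _ _ [:: 0; pi *+ 2]) => x Dx.
  rewrite !inE negb_or => /andP[xn0 xn2].
  have Dx' := Dx; move: Dx; rewrite /D /= in_itv /= => /andP[x1 x2].
  have x0 : 0 < x by rewrite lt_neqAle eq_sym xn0 (le_trans p0).
  have x2pi : x < pi *+ 2.
    by rewrite lt_neqAle xn2 (le_trans x2) // gerBl.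
  have s0 : 0 < sin (x / 2).
    apply: sin_gt0_pi; move: x2pi x0; rewrite -[pi *+ 2]mulr_natr.
    by move: (pi : R) => P *; apply/andP; split; lra.
  have c1 : 0 <= cos (x / 2) ^+ 2 < 1.
    by rewrite sqr_ge0 cos2sin2 /= ltrBlDr ltrDl exprn_gt0.
  rewrite half_angle_symbol.
  transitivity (((a ^+ 2 - cos (x / 2) ^+ 2) ^+ k * sin (x / 2))%:E *
      \sum_(n <oo) (cbin R n * (cos (x / 2) ^+ 2) ^+ n)%:E)%E.
    rewrite eseries_cbin // -sin2cos2 sqrtr_sqr gtr0_norm // -EFinM; congr EFin.
    by rewrite mulfK // gt_eqF.
  rewrite -nneseriesZl; last first.
    by move=> n _; rewrite lee_fin mulr_ge0 ?cbin_ge0 // exprn_ge0 // sqr_ge0.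
  apply: eq_eseriesr => n _; rewrite -EFinM /g -exprM mul2n; congr EFin; ring.
have mg n : measurable_fun D (g n).
  by apply/measurable_EFinP; apply: measurable_funM => //; exact: mt.
rewrite integral_nneseries //; last first.
  by move=> n x Dx; rewrite lee_fin mulr_ge0 ?cbin_ge0 // t0.
apply: eq_eseriesr => n _; rewrite /g.
under eq_integral do rewrite EFinM.
rewrite ge0_integralZl //.
- by rewrite integral_angle_term -EFinM; congr EFin; ring.
- by apply/measurable_EFinP; exact: mt.
- by move=> x Dx; rewrite lee_fin t0.
- by rewrite lee_fin cbin_ge0.
Qed.

Lemma gdens_moment_angle : (\int[mu]_t ((t ^+ k.*2)%:E * gdens a t) =
  ('C(k.*2, k)%:R / (2 * pi))%:E *
  \int[mu]_(x in `[psi, (pi *+ 2 - psi)%R]) (((cos psi - cos x) / 2) ^+ k)%:E)%E.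
Proof.
have a01 : 0 <= a <= 1.
  rewrite /a cos_le1 andbT cos_ge0_pihalf //.
  by move: (pi : R) pi0 p1 p0 => P *; apply/andP; split; lra.
rewrite gdens_even_moment // integral_angle -nneseriesZl; last first.
  move=> n _; rewrite lee_fin mulr_ge0 //.
  by rewrite mulr_ge0 ?cbin_ge0 // betai_ge0.
apply: eq_eseriesr => n _; rewrite -EFinM; congr EFin.
have f0 : 4 ^+ k != 0 :> R by rewrite expf_neq0.
have -> : 4 ^+ k * cbin R k = 'C(k.*2, k)%:R by rewrite /cbin mulrC divfK.
have := gt_eqF pi0; move: (pi : R) => p /negbT pn0.
by field.
Qed.

End Angle.

(** * Riemann sums and eigenvalue moments *)

Section Riemann.
Variable R : realType.
Local Notation mu := (@lebesgue_measure R).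

(** The open interval gives the primitive two-sided derivatives at both ends of [0, T] as soon as A
    > T. *)
Lemma local_primitive (G : R -> R) (A : R) : continuous G ->
  exists F : R -> R, forall x, - A < x < A -> is_derive x 1 F (G x).
Proof.
move=> cG; exists (fun x => \int[mu]_(t in `[- A, x]) G t) => x /andP[x1 x2].
have iG : mu.-integrable `[- A, A] (EFin \o G).
  apply: continuous_compact_integrable; first exact: segment_compact.
  exact: continuous_subspaceT.
have [d dE] := continuous_FTC1_closed x2 iG x1 (cG x).
by apply: DeriveDef; [exact: d | rewrite -derive1E].
Qed.

Lemma lipschitz_continuous (G : R -> R) (L : R) :
  (forall x y, `|G x - G y| <= L * `|x - y|) -> continuous G.
Proof.
move=> lG x; apply/cvgrPdist_le => e e0.
have L1 : 0 < `|L| + 1 by rewrite ltr_pwDr.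
near=> y; apply: (le_trans (lG _ _)).
apply: (@le_trans _ _ ((`|L| + 1) * `|x - y|)).
  by rewrite ler_wpM2r // (le_trans (ler_norm _)) // lerDl.
rewrite mulrC -ler_pdivlMr //; near: y.
by apply: (@cvgr_dist_le _ _ _ _ _ id) => //; rewrite divr_gt0.
Unshelve. all: by end_near. Qed.

(** On each cell of length h = T / M the mean value theorem bounds the error of h G by L h^2; adding
    M cells and dividing by h leaves L T, whatever M is. *)
Lemma riemann_sum_error (G : R -> R) (L T : R) : 0 < T ->
  (forall x y, `|G x - G y| <= L * `|x - y|) ->
  exists I : R, (\int[mu]_(x in `[0%R, T]) (G x)%:E = I%:E)%E /\
  forall M : nat, (0 < M)%N ->
    `|\sum_(i < M) G (T / M%:R * i%:R) - M%:R * I / T| <= L * T.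
Proof.
move=> T0 lG; have cG := lipschitz_continuous lG.
have [F dF] := local_primitive (T + 1) cG.
have dF' x : 0 <= x <= T -> is_derive x 1 F (G x).
  by move=> /andP[x0 xT]; apply: dF; apply/andP; split; lra.
have cF x : 0 <= x <= T -> {for x, continuous F}.
  move=> /dF' [d _]; apply: differentiable_continuous; exact/derivable1_diffP.
exists (F T - F 0); split.
  rewrite (@continuous_FTC2 _ G F) //; first exact: continuous_subspaceT.
    split.
    - by move=> x; rewrite in_itv /= => /andP[x0 xT]; have [] := dF' x _; rewrite ?(ltW x0) ?(ltW xT).
    - by apply: cvg_at_right_filter; apply: cF; rewrite lexx ltW.
    - by apply: cvg_at_left_filter; apply: cF; rewrite lexx ltW.
  move=> x; rewrite in_itv /= => /andP[x0 xT]; rewrite derive1E.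
  have dFx : is_derive x 1 F (G x) by apply: dF'; rewrite !ltW.
  exact: derive_val.
move=> M M0; have m0 : 0 < M%:R :> R by rewrite ltr0n.
set h := T / M%:R; have h0 : 0 < h by rewrite divr_gt0.
have hM : h * M%:R = T by rewrite /h divfK // gt_eqF.
have step (i : 'I_M) : `|h * G (h * i%:R) - (F (h * i.+1%:R) - F (h * i%:R))| <= L * h ^+ 2.
  have iM : h * i.+1%:R <= T by rewrite -hM ler_pM2l // ler_nat.
  have i0 : 0 <= h * i%:R by rewrite mulr_ge0 // ltW.
  have lt : h * i%:R < h * i.+1%:R by rewrite ltr_pM2l // ltr_nat.
  have hd x : x \in `]h * i%:R, h * i.+1%:R[ -> is_derive x 1 F (G x).
    rewrite in_itv /= => /andP[x1 x2]; apply: dF'.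
    by rewrite (le_trans i0 (ltW x1)) (le_trans (ltW x2)).
  have hc : {within `[h * i%:R, h * i.+1%:R], continuous F}.
    apply: continuous_in_subspaceT => x; rewrite inE /= in_itv /= => /andP[x1 x2].
    by apply: cF; rewrite (le_trans i0) // (le_trans x2).
  have [c] := MVT lt hd hc.
  rewrite in_itv /= => /andP[c1 c2] ->.
  have -> : h * i.+1%:R - h * i%:R = h by rewrite -natr1; ring.
  rewrite [h * _]mulrC -mulrBl normrM (gtr0_norm h0) expr2 mulrA ler_wpM2r ?(ltW h0) //.
  apply: (le_trans (lG _ _)); have L0 : 0 <= L.
    have := lG 0 1; rewrite sub0r normrN1 mulr1; apply: le_trans; exact: normr_ge0.
  rewrite ler_wpM2l // distrC ger0_norm ?subr_ge0 ?(ltW c1) //.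
  by move: c2; rewrite -natr1 mulrDr mulr1 => c2; lra.
have tele : \sum_(i < M) (F (h * i.+1%:R) - F (h * i%:R)) = F T - F 0.
  rewrite -(big_mkord xpredT (fun i => F (h * i.+1%:R) - F (h * i%:R))).
  by rewrite telescope_sumr // hM mulr0.
have : `|h * \sum_(i < M) G (h * i%:R) - (F T - F 0)| <= M%:R * (L * h ^+ 2).
  rewrite -tele mulr_sumr -sumrB; apply: (le_trans (ler_norm_sum _ _ _)).
  apply: (@le_trans _ _ (\sum_(i < M) L * h ^+ 2)); first exact: ler_sum.
  by rewrite sumr_const card_ord [leRHS]mulr_natl.
have -> : M%:R * (L * h ^+ 2) = h * (L * T) by rewrite -hM; ring.
have -> : h * \sum_(i < M) G (h * i%:R) - (F T - F 0) =
   h * (\sum_(i < M) G (h * i%:R) - M%:R * (F T - F 0) / T).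
  rewrite /h; have := gt_eqF m0; have := gt_eqF T0.
  by move=> /negbT T1 /negbT m1; field; rewrite T1 m1.
by rewrite normrM (gtr0_norm h0) ler_pM2l.
Qed.

(** The samples on one sublattice sit at an offset of a whole number of quarter steps. Whole steps
    are absorbed by the period, and the remaining fraction of a step costs another L T. *)
Lemma riemann_periodic_error (G : R -> R) (L T : R) : 0 < T ->
  (forall x y, `|G x - G y| <= L * `|x - y|) -> (forall x, G (x + T) = G x) ->
  exists I : R, (\int[mu]_(x in `[0%R, T]) (G x)%:E = I%:E)%E /\
  forall M n : nat, (0 < M)%N ->
    `|\sum_(i < M) G (T / M%:R * (i%:R + n%:R / 4)) - M%:R * I / T| <= 2 * (L * T).
Proof.
move=> T0 lG pG; have [I [IE HI]] := riemann_sum_error T0 lG.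
exists I; split=> // M n M0; have m0 : 0 < M%:R :> R by rewrite ltr0n.
have L0 : 0 <= L.
  have := lG 0 1; rewrite sub0r normrN1 mulr1; apply: le_trans; exact: normr_ge0.
set h := T / M%:R; have h0 : 0 < h by rewrite divr_gt0.
have hM : h * M%:R = T by rewrite /h divfK // gt_eqF.
have per : \sum_(i < M) G (h * (n %/ 4 + i)%N%:R) = \sum_(i < M) G (h * i%:R).
  apply: (@sum_periodic _ (fun m => G (h * m%:R))) => m.
  by rewrite natrD mulrDr hM pG.
have := HI M M0; rewrite -/h -per => H.
have -> : 2 * (L * T) = L * T + L * T by ring.
rewrite -(subrK (\sum_(i < M) G (h * (n %/ 4 + i)%N%:R)) (\sum_(i < M) _)) -addrA.
apply: (le_trans (ler_normD _ _)); rewrite lerD // -sumrB.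
apply: (le_trans (ler_norm_sum _ _ _)).
apply: (@le_trans _ _ (\sum_(i < M) L * h)); last first.
  by rewrite sumr_const card_ord -mulr_natr -mulrA hM.
apply: ler_sum => i _; apply: (le_trans (lG _ _)); rewrite ler_wpM2l //.
rewrite -mulrBr normrM (gtr0_norm h0) -[leRHS]mulr1 ler_pM2l //.
have -> : i%:R + n%:R / 4 - (n %/ 4 + i)%N%:R = (n %% 4)%N%:R / 4 :> R.
  by rewrite {1}(divn_eq n 4) !natrD natrM; field.
rewrite ger0_norm ?divr_ge0 // ler_pdivrMr // mul1r ler_nat.
by rewrite ltnW // ltn_mod.
Qed.

Lemma cos_lipschitz (x y : R) : `|cos x - cos y| <= `|x - y|.
Proof.
wlog xy : x y / x <= y.
  move=> H; have [/H //|/ltW/H] := leP x y; by rewrite distrC [leRHS]distrC.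
rewrite distrC [leRHS]distrC.
have hc : {within `[x, y], continuous (@cos R)}.
  by apply: continuous_subspaceT; exact: continuous_cos.
have [c _ ->] := MVT_segment xy (fun z _ => is_derive_cos z) hc.
by rewrite normrM normrN ler_piMl // sin_max.
Qed.

End Riemann.

Local Notation ppart x := (Num.max (x : _) 0).

Section Moments.
Variable R : realType.
Local Notation mu := (@lebesgue_measure R).
Implicit Types psi phi : R.

(** Off the smaller interval the symbol is nonpositive, so its positive part is 0; the exponent is a
    successor because 0^0 = 1. *)
Lemma integral_pos_symbol psi k : 0 <= psi <= pi ->
  (\int[mu]_(x in `[psi, (pi *+ 2 - psi)%R]) (((cos psi - cos x) / 2) ^+ k.+1)%:E =
   \int[mu]_(x in `[0%R, (pi *+ 2)%R]) ((ppart ((cos psi - cos x) / 2) : R) ^+ k.+1)%:E)%E.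
Proof.
move=> psi0pi; have /andP[p0 p1] := psi0pi; have pi0 := pi_gt0 R.
rewrite integral_mkcond [RHS]integral_mkcond; apply: eq_integral => x _.
rewrite /patch !mem_setE !in_itv /=.
have [Dx|Dx] := boolP (psi <= x <= pi *+ 2 - psi).
  have -> : 0 <= x <= pi *+ 2.
    move: Dx; rewrite -[pi *+ 2]mulr_natr; move: (pi : R) pi0 p0 p1 => P *.
    by apply/andP; split; lra.
  congr ((_ ^+ _)%:E).
  rewrite max_l // (half_angle_symbol psi) subr_ge0; exact: cos_half_le.
case: ifP => // /andP[x0 x2]; rewrite max_r ?expr0n //.
rewrite ler_pdivrMr // mul0r subr_le0.
move: Dx; rewrite negb_and -!ltNge => /orP[xp|xp].
  by rewrite ltW // ltr_cos // in_itv /= ?p0 ?p1 ?x0 // ltW // (lt_le_trans xp).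
have -> : cos x = cos (pi *+ 2 - x).
  by rewrite -[RHS]cosN opprB -[RHS]cosD2pi subrK.
move: x2 xp; rewrite -[pi *+ 2]mulr_natr => x2 xp.
have H (P : R) : 0 < P -> psi <= P -> x <= P * 2 -> P * 2 - psi < x ->
    [/\ P * 2 - x < psi, 0 <= P * 2 - x & P * 2 - x <= P].
  by move: p0 => *; split; lra.
have [h1 h2 h3] := H _ pi0 p1 x2 xp.
by rewrite ltW // ltr_cos // in_itv /= ?p0 ?p1 ?h2 ?h3.
Qed.

Lemma symbol_power_lipschitz psi k (x y : R) :
  `|(ppart ((cos psi - cos x) / 2) : R) ^+ k - (ppart ((cos psi - cos y) / 2) : R) ^+ k| <=
  k%:R * `|x - y|.
Proof.
have b z : `|(ppart ((cos psi - cos z) / 2) : R)| <= 1.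
  have := symb_le1 psi (z + pi); rewrite /symb cosDpi => /pos_le1.
  by rewrite ger0_norm // pos_ge0.
apply: distX_le => //; apply: (le_trans (pos_lip _ _)).
have -> : (cos psi - cos x) / 2 - (cos psi - cos y) / 2 = (cos y - cos x) / 2 by field.
rewrite normrM [`|2^-1|]ger0_norm ?invr_ge0 // distrC.
have := cos_lipschitz x y; have := normr_ge0 (cos x - cos y); move: `|cos x - cos y| => u.
by move=> *; lra.
Qed.

(** Covers both lines: psi = |phi| gives the half-length [aplus phi], and psi = pi - |phi| gives
    [aminus phi]. *)
Lemma gdens_moment_riemann psi k : 0 <= psi <= pi ->
  exists m : R, (\int[mu]_t ((t ^+ k.+1.*2)%:E * gdens (cos (psi / 2)) t) = m%:E)%E /\
  exists2 c : R, 0 <= c & forall M n, (0 < M)%N ->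
   `|'C(k.+1.*2, k.+1)%:R * \sum_(i < M)
      (ppart ((cos psi - cos (pi *+ 2 / M%:R * (i%:R + n%:R / 4))) / 2) : R) ^+ k.+1
     - M%:R * m| <= c.
Proof.
move=> psi0pi; have pi0 := pi_gt0 R.
have T0 : 0 < pi *+ 2 :> R by rewrite pmulrn_lgt0.
have [x|I [IE HI]] := riemann_periodic_error T0 (symbol_power_lipschitz psi k.+1).
  by rewrite cosD2pi.
pose B : R := 'C(k.+1.*2, k.+1)%:R.
exists (B / (2 * pi) * I); split.
  by rewrite gdens_moment_angle // integral_pos_symbol // IE -EFinM.
have Bge : 0 <= B by rewrite ler0n.
exists (B * (2 * (k.+1%:R * (pi *+ 2)))).
  by rewrite !mulr_ge0 // ?ler0n // ltW.
move=> M n M0; have := HI M n M0.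
have -> : M%:R * (B / (2 * pi) * I) = B * (M%:R * I / (pi *+ 2)).
  rewrite -[pi *+ 2]mulr_natr; have := gt_eqF pi0; move: (pi : R) => P /negbT Pn0.
  by field.
by rewrite -mulrBr normrM (ger0_norm Bge) => H; rewrite ler_wpM2l.
Qed.

Lemma cos_norm (x : R) : cos `|x| = cos x.
Proof. by have [x0|x0] := ler0P x => //; rewrite cosN. Qed.

Lemma symb_lipschitz phi (x y : R) : `|symb phi x - symb phi y| <= `|x - y|.
Proof.
rewrite /symb.
have -> : (cos phi + cos x) / 2 - (cos phi + cos y) / 2 = (cos x - cos y) / 2 by field.
rewrite normrM [`|2^-1|]ger0_norm ?invr_ge0 //.
have := cos_lipschitz x y; have := normr_ge0 (cos x - cos y); move: `|cos x - cos y| => u.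
by move=> *; lra.
Qed.

Lemma wb_step M phi m : (0 < M)%N -> `|wb M phi m.+1 - wb M phi m| <= pi / M%:R.
Proof.
move=> M0; have m0 : M%:R != 0 :> R by rewrite pnatr_eq0 -lt0n.
apply: (le_trans (symb_lipschitz _ _ _)).
have -> : pi * (2 * m.+1%:R + 1) / (2 * M%:R) - pi * (2 * m%:R + 1) / (2 * M%:R) = pi / M%:R :> R.
  by rewrite -natr1; move: (pi : R) => P; field.
by rewrite ger0_norm // divr_ge0 // ?pi_ge0.
Qed.

Lemma diagonalizes_hopN M (eps u v : 'I_M -> R) P lam :
  diagonalizes P lam (cyc u v (hop eps u v) (hop eps u v)) ->
  let u' := fun i => - u i in let v' := fun i => - v i in
  diagonalizes P (fun j => - lam j) (cyc u' v' (hop eps u' v') (hop eps u' v')).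
Proof.
move=> dlam u' v'.
have hE : hop eps u' v' = fun i => - hop eps u v i.
  apply/funext => i; rewrite /hop /u' /v' -mulrN opprB.
  by rewrite !opprK.
suff -> : cyc u' v' (hop eps u' v') (hop eps u' v') =
   - cyc u v (hop eps u v) (hop eps u v) by exact: diagonalizesN.
by rewrite hE -[RHS]scaleN1r cycZ; apply: eq_cyc => i; rewrite /= mulN1r.
Qed.

Section Model.
Variables (M : nat) (phi : R) (q : nat).
Hypothesis M0 : (0 < M)%N.
Let m0 : M%:R != 0 :> R. Proof. by rewrite pnatr_eq0 -lt0n. Qed.
Let u i := wb M phi (q + i.*2).
Let v i := wb M phi (q + i.*2).+1.

Lemma wb_cyclic_step (i : 'I_M) : `|v i - u (ordS i)| <= pi / M%:R.
Proof.
have -> : u (ordS i) = wb M phi (q + i.*2).+2.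
  rewrite /u /=; have := ltn_ord i; rewrite leq_eqVlt => /orP[/eqP iM|iM].
    rewrite iM modnn addn0 -(wb_per phi M0 q); congr wb.
    by move: iM; clear; lia.
  by rewrite modn_small //; congr wb; clear; lia.
by rewrite distrC; exact: wb_step.
Qed.

(** The extra M.*2 quarter steps of size 2 pi / M shift the angle by pi, which turns + cos into -
    cos. *)
Lemma wb_plus (i : nat) :
  u i = (cos `|phi| - cos (pi *+ 2 / M%:R * (i%:R + (q.*2 + M.*2).+1%:R / 4))) / 2.
Proof.
rewrite /u /wb /symb cos_norm; congr ((_ + _) / 2).
rewrite -[LHS]opprK -cosDpi; congr (- cos _); rewrite -[pi *+ 2]mulr_natr.
rewrite -[(_ + _).+1%:R]natr1 -!mul2n !(natrM, natrD); move: (pi : R) => P; by field.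
Qed.

Lemma wb_minus (i : nat) :
  - u i = (cos (pi - `|phi|) - cos (pi *+ 2 / M%:R * (i%:R + q.*2.+1%:R / 4))) / 2.
Proof.
rewrite -[pi - _]opprB cosN cosBpi cos_norm /u /wb /symb -mulNr opprD; congr ((_ - cos _) / 2).
rewrite -[pi *+ 2]mulr_natr.
rewrite -[q.*2.+1%:R]natr1 -!mul2n !(natrM, natrD); move: (pi : R) => P; by field.
Qed.

Variables (eps : 'I_M -> R) (P : 'M[R[i]]_M) (lam : 'I_M -> R).
Hypothesis eps2 : forall i, eps i ^+ 2 = 1.
Hypothesis uv0 : forall i : 'I_M, 0 <= u i * v i.
Let h := hop eps (u : 'I_M -> R) (v : 'I_M -> R).
Hypothesis dlam : diagonalizes P lam (cyc (u : 'I_M -> R) (v : 'I_M -> R) h h).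

Let u' (i : 'I_M) := - u i.
Let v' (i : 'I_M) := - v i.
Let dlamN := diagonalizes_hopN dlam.

Lemma eigen_norm_le4 j : `|lam j| <= 4.
Proof.
rewrite ler_norml; apply/andP; split; last first.
  by apply: (eigen_le4 eps2 uv0 _ _ _ dlam) => i; exact: symb_le1.
rewrite lerNl; apply: (eigen_le4 (u := u') (v := v') eps2 _ _ _ _ dlamN) => i.
- by rewrite mulrNN.
- by rewrite normrN symb_le1.
- by rewrite normrN symb_le1.
Qed.

End Model.

Lemma eigen_power_sums phi k : - pi <= phi <= pi ->
  exists mp mm c : R,
   [/\ (\int[mu]_t ((t ^+ k.+1.*2)%:E * gdens (aplus phi) t) = mp%:E)%E,
       (\int[mu]_t ((t ^+ k.+1.*2)%:E * gdens (aminus phi) t) = mm%:E)%E,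
       0 <= c
     & forall M q eps P lam, let u := fun i : 'I_M => wb M phi (q + i.*2) in
         let v := fun i : 'I_M => wb M phi (q + i.*2).+1 in
       (k.+1 < M)%N -> (forall i, eps i ^+ 2 = 1) -> (forall i, 0 <= u i * v i) ->
       diagonalizes P lam (cyc u v (hop eps u v) (hop eps u v)) ->
       `|\sum_j (ppart (lam j) : R) ^+ k.+1 - M%:R * mp| <= c /\
       `|\sum_j (ppart (- lam j) : R) ^+ k.+1 - M%:R * mm| <= c].
Proof.
rewrite -ler_norml => phipi; have pi0 := pi_gt0 R.
have psip : 0 <= `|phi| <= pi by rewrite normr_ge0.
have psim : 0 <= pi - `|phi| <= pi by rewrite subr_ge0 phipi gerBl normr_ge0.
have [c c0 Hc] := eigen_power_sum_pos R k.
have [mp [mpE [cp cp0 Hp]]] := gdens_moment_riemann k psip.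
have [mm [mmE [cm cm0 Hm]]] := gdens_moment_riemann k psim.
exists mp, mm, (c * pi + cp + cm); split.
- exact: mpE.
- rewrite -mmE; apply: eq_integral => t _; congr (_ * gdens _ _)%E.
  rewrite /aminus -cosBpihalf; rewrite -cosN; congr cos; move: (pi : R) => P; by field.
- by rewrite !addr_ge0 // mulr_ge0 // ltW.
move=> M q eps P lam u v kM eps2 uv0 dlam.
have M0 : (0 < M)%N by apply: leq_trans kM.
have piM : M%:R * (pi / M%:R) = pi :> R by rewrite mulrC divfK // pnatr_eq0 -lt0n.
have piM0 : 0 <= pi / M%:R :> R by rewrite divr_ge0 // ltW.
have s1 i : `|v i - u i| <= pi / M%:R by exact: wb_step.
have s2 i : `|v i - u (ordS i)| <= pi / M%:R by exact: wb_cyclic_step.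
have tri (x y z a b d : R) : 0 <= d -> `|x - y| <= a -> `|y - z| <= b -> `|x - z| <= a + b + d.
  move=> d0 xa yb; rewrite -(subrK y x) -addrA (le_trans (ler_normD _ _)) //.
  by rewrite -[leLHS]addr0 !lerD.
split.
- apply: (tri _ _ _ _ _ _ cm0 _ (Hp M (q.*2 + M.*2).+1 M0)).
  under [X in _ * X]eq_bigr => i _ do rewrite -(wb_plus _ _ M0).
  rewrite -{1}piM; apply: (Hc M eps u v _ P lam) => // i; exact: symb_le1.
rewrite -addrA [cp + cm]addrC addrA.
apply: (tri _ _ _ _ _ _ cp0 _ (Hm M q.*2.+1 M0)).
under [X in _ * X]eq_bigr => i _ do rewrite -(wb_minus _ _ M0).
rewrite -{1}piM; apply: (Hc M eps (fun i => - u i) (fun i => - v i) _ P (fun j => - lam j)) => // [i|i|i|i|i|].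
- by rewrite mulrNN.
- by rewrite normrN symb_le1.
- by rewrite normrN symb_le1.
- by rewrite -opprD normrN.
- by rewrite -opprD normrN.
- exact: diagonalizes_hopN.
Qed.

End Moments.

(** * Integration against the limit densities *)

Section Density.
Variable R : realType.
Local Notation mu := (@lebesgue_measure R).
Variable psi : R.
Hypothesis psi0pi : 0 <= psi <= pi.
Let a := cos (psi / 2).

Lemma gdens_mass : (\int[mu]_t gdens a t = (1 - psi / pi)%:E)%E.
Proof.
have pi0 := pi_gt0 R; have /andP[p0 p1] := psi0pi.
transitivity (\int[mu]_t ((t ^+ 0.*2)%:E * gdens a t))%E.
  by apply: eq_integral => t _; rewrite mul1e.
rewrite gdens_moment_angle // bin0.
under eq_integral do rewrite expr0.
rewrite integral_cst //= mul1e lebesgue_measure_itv /=.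
have [lt|ge] := ltP psi (pi *+ 2 - psi).
  rewrite lte_fin lt -EFinB -EFinM; congr EFin; rewrite -[pi *+ 2]mulr_natr.
  by move: (pi : R) pi0 => P P0; field; rewrite gt_eqF.
rewrite lte_fin ltNge ge /= mule0.
have -> : psi = pi.
  by move: ge; rewrite -[pi *+ 2]mulr_natr; move: (pi : R) p1 => P *; apply/eqP; rewrite eq_le; apply/andP; split; lra.
by rewrite divff ?subrr // gt_eqF.
Qed.

Lemma gmeasure_setT : gmeasure a setT = (1 - psi / pi)%:E.
Proof. exact: gdens_mass. Qed.

Lemma gdensN t : gdens a (- t) = gdens a t.
Proof. by rewrite /gdens normrN sqrrN. Qed.

Lemma gmeasureN (A : set R) : measurable A ->
  gmeasure a ((-%R : R -> R) @^-1` A) = gmeasure a A.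
Proof.
move=> mA; rewrite /gmeasure.
transitivity (\int[mu]_(t in (-%R : R -> R) @^-1` A) (gdens a \o -%R) t)%E.
  by apply: eq_integral => t _; rewrite /= gdensN.
have mN : measurable_fun setT (-%R : measurableTypeR R -> measurableTypeR R).
  exact: oppr_measurable.
have mg : measurable_fun A (gdens a).
  by apply: measurable_funTS; exact: measurable_gdens.
have <- := @ge0_integral_pushforward _ _ (measurableTypeR R) (measurableTypeR R)
  R _ mN mu A _ mA mg (fun y _ => gdens_ge0 a y).
by apply: eq_measure_integral => B mB _; exact: lebesgue_measureN.
Qed.

Lemma gmeasure_lty : (gmeasure a setT < +oo)%E.
Proof. by rewrite gmeasure_setT ltry. Qed.

Let gfin : {finite_measure set (measurableTypeR R) -> \bar R} :=
  HB.pack (gmeasure a) (Measure_isFinite.Build _ _ _ (gmeasure a)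
    (lty_fin_num_fun gmeasure_lty)).

(** The Radon-Nikodym derivative of [gmeasure a] agrees almost everywhere with [gdens a], since both
    have the same integral over every measurable set. *)
Lemma gmeasure_integral (f : R -> \bar R) : (forall t, 0 <= f t)%E -> measurable_fun setT f ->
  (\int[gmeasure a]_t f t = \int[mu]_t (f t * gdens a t))%E.
Proof.
move=> f0 mf.
have dom : gfin `<< mu.
  apply/null_content_dominatesP => A mA A0; rewrite /= /gmeasure.
  by apply: null_set_integral => //; apply: measurable_funTS; exact: measurable_gdens.
have := Radon_Nikodym_SigmaFinite.change_of_variables dom f0 measurableT mf.
move=> <-; apply: ae_eq_integral => //.
- apply: emeasurable_funM => //.
  exact: measurable_int (Radon_Nikodym_SigmaFinite.f_integrable dom).
- by apply: emeasurable_funM => //; exact: measurable_gdens.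
apply: ae_eqe_mul2l; apply: integral_ae_eq => //.
- exact: Radon_Nikodym_SigmaFinite.f_integrable.
- exact: measurable_gdens.
- by move=> A _ mA; rewrite -Radon_Nikodym_SigmaFinite.f_integral.
Qed.

Lemma gmeasure_even_moment k : (\int[gmeasure a]_t (t ^+ k.*2)%:E =
  \int[mu]_t ((t ^+ k.*2)%:E * gdens a t))%E.
Proof.
apply: gmeasure_integral => [t|]; first by rewrite lee_fin -muln2 mulnC exprM exprn_ge0 // sqr_ge0.
by apply/measurable_EFinP; exact: measurable_funX.
Qed.

Lemma gmeasure_even_moment_fin k : exists m : R,
  (\int[gmeasure a]_t (t ^+ k.*2)%:E = m%:E)%E.
Proof.
rewrite gmeasure_even_moment; case: k => [|k].
  exists (1 - psi / pi); rewrite -gdens_mass; apply: eq_integral => t _.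
  by rewrite mul1e.
by have [m [mE _]] := gdens_moment_riemann k psi0pi; exists m.
Qed.

Lemma integrable_monomial n : (gmeasure a).-integrable setT (fun t => (t ^+ n)%:E).
Proof.
have mX k : measurable_fun [set: R] (fun t : R => (t ^+ k)%:E).
  by apply/measurable_EFinP; exact: measurable_funX.
have even k : (gmeasure a).-integrable setT (fun t => (t ^+ k.*2)%:E).
  apply/integrableP; split; first exact: mX.
  have [m mE] := gmeasure_even_moment_fin k.
  apply: (@le_lt_trans _ _ m%:E); last exact: ltry.
  rewrite -mE le_eqVlt; apply/orP; left; apply/eqP.
  apply: eq_integral => t _; rewrite abse_EFin ger0_norm //.
  by rewrite -muln2 mulnC exprM exprn_ge0 // sqr_ge0.
(* The dominating function is 1 + t^(2n). *)
apply: (le_integrable measurableT _ _ (integrableD measurableT (even 0) (even n))); first exact: mX.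
move=> t _; rewrite -EFinD !abse_EFin lee_fin expr0.
have h : t ^+ n.*2 = `|t ^+ n| ^+ 2 by rewrite real_normK ?num_real // -exprM muln2.
rewrite h; move: (normr_ge0 (t ^+ n)); move: `|t ^+ n| => x x0.
by rewrite ger0_norm; nra.
Qed.

Lemma integrable_horner (p : {poly R}) : (gmeasure a).-integrable setT (fun t => p.[t]%:E).
Proof.
have -> : (fun t : measurableTypeR R => p.[t]%:E) =
    (fun t => \sum_(i <- iota 0 (size p)) (p`_i)%:E * (t ^+ i)%:E)%E.
  apply/funext => t; rewrite horner_coef sumEFin -(big_mkord xpredT (fun i => p`_i * t ^+ i)).
  by rewrite /index_iota subn0.
apply: integrable_sum => // i _; apply: integrableZl => //; exact: integrable_monomial.
Qed.

Lemma Rintegral_odd (n : nat) : odd n -> \int[gmeasure a]_t (t ^+ n) = 0.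
Proof.
move=> on; pose F : measurableTypeR R -> \bar R := fun t => (t ^+ n)%:E.
have mN : measurable_fun setT (-%R : measurableTypeR R -> measurableTypeR R).
  exact: oppr_measurable.
have mF : measurable_fun setT F by apply/measurable_EFinP; exact: measurable_funX.
have FN : F \o -%R = fun t => ((-1)%:E * F t)%E.
  by apply/funext => t; rewrite /F /= exprNn -signr_odd on -EFinM.
have iFN : (gmeasure a).-integrable ((-%R : measurableTypeR R -> measurableTypeR R) @^-1` setT) (F \o -%R).
  by rewrite FN preimage_setT; apply: integrableZl => //; exact: integrable_monomial.
have := @integral_pushforward _ _ (measurableTypeR R) (measurableTypeR R)
  R _ mN (gmeasure a) _ _ mF iFN measurableT.
rewrite FN preimage_setT integralZl //; last exact: integrable_monomial.
rewrite (@eq_measure_integral _ _ _ _ (gmeasure a)); last first.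
  by move=> B mB _; exact: gmeasureN.
rewrite /Rintegral => /(congr1 fine); rewrite fineM //; last first.
  by apply: integrable_fin_num => //; exact: integrable_monomial.
by rewrite /= /F => h; lra.
Qed.

End Density.

(** * Spectral sums on the two lines *)

Section Lines.
Variable R : realType.
Variable phi : R.
Hypothesis phipi : - pi <= phi <= pi.

Lemma aminus_angle : aminus phi = cos ((pi - `|phi|) / 2).
Proof.
rewrite /aminus -cosBpihalf -cosN; congr cos; move: (pi : R) => P; by field.
Qed.

Lemma abs_angle : 0 <= `|phi| <= pi.
Proof. by rewrite normr_ge0 ler_norml. Qed.

Lemma abs_co_angle : 0 <= pi - `|phi| <= pi.
Proof. by have /andP[h1 h2] := abs_angle; rewrite subr_ge0 h2 gerBl. Qed.

(** Hides the data that produce the eigenvalues: the estimates below are uniform in them. *)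
Definition model_eigenvalues M (lam : 'I_M -> R) := exists q eps P,
  let u := fun i : 'I_M => wb M phi (q + i.*2) in
  let v := fun i : 'I_M => wb M phi (q + i.*2).+1 in
  [/\ forall i, eps i ^+ 2 = 1, forall i, 0 <= u i * v i &
      diagonalizes P lam (cyc u v (hop eps u v) (hop eps u v))].

Lemma model_eigenvalue_le4 M (lam : 'I_M -> R) j : model_eigenvalues lam -> `|lam j| <= 4.
Proof. by move=> [q [eps [P [e2 uv dl]]]]; exact: eigen_norm_le4 e2 uv dl j. Qed.

(* [Num.sqrt] vanishes on negative numbers, so for each j two of the four points
   are 0 and the correction [F 0 *+ 2] removes them. *)
Lemma spec_lines M : (0 < M)%N -> exists2 lam : 'I_M -> R, model_eigenvalues lam &
  forall (V : zmodType) (F : R[i] -> V), \sum_(z <- spec (Amx (M + M) phi 0)) F z =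
   \sum_j (F (Rot (phi / 2) (Num.sqrt (lam j))) + F (Rot (phi / 2) (- Num.sqrt (lam j)))
         + F (Rot (phi / 2 + pi / 2) (Num.sqrt (- lam j)))
         + F (Rot (phi / 2 + pi / 2) (- Num.sqrt (- lam j))) - F 0 *+ 2).
Proof.
move=> M0; have [q [eps [P [lam [e2 uv dl HF]]]]] := spec_Amx phi M0.
exists lam; first by exists q, eps, P.
move=> V F; rewrite HF; apply: eq_bigr => j _; rewrite /rt.
have expip : expi (phi / 2 + pi / 2) = expi (phi / 2) * (0 +i* 1)%C.
  rewrite expiD /expi cos_pihalf sin_pihalf; congr (_ * _).
have N0 : (0 : R)%:C%C = 0 :> R[i] by [].
have ac (x y w : V) : x + x + y + w - x *+ 2 = y + w.
  by rewrite mulr2n -(addrA (x + x)) [_ + (y + w)]addrC addrK.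
case: ifP => l0.
  rewrite (ler0_sqrtr (a := - lam j)) ?oppr_le0 // oppr0 /Rot !N0 !mulr0 rmorphN mulrN.
  by rewrite -[_ + F 0 + F 0]addrA -mulr2n addrK.
have {}l0 : lam j <= 0 by rewrite leNgt; apply/negP => /ltW; rewrite l0.
rewrite (ler0_sqrtr l0) oppr0 /Rot !N0 !mulr0 ac.
rewrite expip -!mulrA !rmorphN.
have -> : (0 +i* Num.sqrt (- lam j))%C = (0 +i* 1)%C * (Num.sqrt (- lam j))%:C%C.
  by apply/eqP; rewrite eq_complex /=; apply/andP; split; apply/eqP; ring.
by rewrite !mulrN.
Qed.

(** The contribution of two opposite points to one line; for x <= 0 both square roots are 0 and it
    equals 2 p(0). *)
Definition eigen_power (p : {poly R}) (x : R) := p.[Num.sqrt x] + p.[- Num.sqrt x].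

Lemma sqr_sqrt_pos (x : R) : Num.sqrt x ^+ 2 = ppart x.
Proof.
have [x0|x0] := ler0P x; first by rewrite ler0_sqrtr // expr0n.
by rewrite sqr_sqrtr // ltW.
Qed.

Lemma eigen_powerX n x : eigen_power 'X^n x = if odd n then 0 else 2 * ppart x ^+ n./2.
Proof.
rewrite /eigen_power !hornerXn exprNn -signr_odd; case: ifP => on.
  by rewrite mulN1r subrr.
rewrite mul1r -mulr2n mulr_natl -sqr_sqrt_pos -exprM mul2n.
by have := odd_double_half n; rewrite on add0n => ->.
Qed.

Definition line_estimate (p : {poly R}) := exists (C : R) K, forall M (lam : 'I_M -> R),
  (K <= M)%N -> model_eigenvalues lam ->
  `|\sum_j eigen_power p (lam j) - (M + M)%:R * \int[gmeasure (aplus phi)]_t p.[t]| <= C /\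
  `|\sum_j eigen_power p (- lam j) - (M + M)%:R * \int[gmeasure (aminus phi)]_t p.[t]| <= C.

Let integrable_plus (p : {poly R}) : (gmeasure (aplus phi)).-integrable setT (fun t => p.[t]%:E).
Proof. exact: (integrable_horner abs_angle). Qed.

Let integrable_minus (p : {poly R}) : (gmeasure (aminus phi)).-integrable setT (fun t => p.[t]%:E).
Proof. rewrite aminus_angle; exact: (integrable_horner abs_co_angle). Qed.

Lemma line_estimateD p q : line_estimate p -> line_estimate q -> line_estimate (p + q).
Proof.
move=> [C [K HC]] [D [L HD]]; exists (C + D), (maxn K L) => M lam.
rewrite geq_max => /andP[KM LM] ml.
have [hp hm] := HC M lam KM ml; have [hp' hm'] := HD M lam LM ml.
have ED x : eigen_power (p + q) x = eigen_power p x + eigen_power q x.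
  by rewrite /eigen_power !hornerD addrACA.
have key (s t m u v : R) c d : `|s - m * u| <= c -> `|t - m * v| <= d ->
    `|s + t - m * (u + v)| <= c + d.
  move=> h1 h2; rewrite mulrDr opprD addrACA (le_trans (ler_normD _ _)) //.
  exact: lerD.
have iD (nu : {measure set (measurableTypeR R) -> \bar R}) :
    nu.-integrable setT (fun t => p.[t]%:E) -> nu.-integrable setT (fun t => q.[t]%:E) ->
    \int[nu]_t (p + q).[t] = \int[nu]_t p.[t] + \int[nu]_t q.[t].
  move=> ip iq; rewrite -RintegralD //; apply: eq_Rintegral => t _.
  by rewrite hornerD.
have main (nu : {measure set (measurableTypeR R) -> \bar R}) (l : 'I_M -> R) :
    nu.-integrable setT (fun t => p.[t]%:E) -> nu.-integrable setT (fun t => q.[t]%:E) ->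
    `|\sum_j eigen_power p (l j) - (M + M)%:R * \int[nu]_t p.[t]| <= C ->
    `|\sum_j eigen_power q (l j) - (M + M)%:R * \int[nu]_t q.[t]| <= D ->
    `|\sum_j eigen_power (p + q) (l j) - (M + M)%:R * \int[nu]_t (p + q).[t]| <= C + D.
  move=> ip iq h1 h2; rewrite (iD nu ip iq).
  have -> : \sum_j eigen_power (p + q) (l j) =
      \sum_j eigen_power p (l j) + \sum_j eigen_power q (l j).
    by rewrite -big_split; apply: eq_bigr => j _; exact: ED.
  exact: key h1 h2.
split; first exact (main _ _ (integrable_plus p) (integrable_plus q) hp hp').
exact (main _ (fun j => - lam j) (integrable_minus p) (integrable_minus q) hm hm').
Qed.

Lemma line_estimateZ (c : R) p : line_estimate p -> line_estimate (c *: p).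
Proof.
move=> [C [K HC]]; exists (`|c| * C), K => M lam KM ml.
have [hp hm] := HC M lam KM ml.
have EZ x : eigen_power (c *: p) x = c * eigen_power p x.
  by rewrite /eigen_power !hornerZ mulrDr.
have iZ (nu : {measure set (measurableTypeR R) -> \bar R}) :
    nu.-integrable setT (fun t => p.[t]%:E) ->
    \int[nu]_t (c *: p).[t] = c * \int[nu]_t p.[t].
  move=> ip; rewrite -RintegralZl //; apply: eq_Rintegral => t _.
  by rewrite hornerZ.
have main (nu : {measure set (measurableTypeR R) -> \bar R}) (l : 'I_M -> R) :
    nu.-integrable setT (fun t => p.[t]%:E) ->
    `|\sum_j eigen_power p (l j) - (M + M)%:R * \int[nu]_t p.[t]| <= C ->
    `|\sum_j eigen_power (c *: p) (l j) - (M + M)%:R * \int[nu]_t (c *: p).[t]| <= `|c| * C.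
  move=> ip h; rewrite (iZ nu ip).
  have -> : \sum_j eigen_power (c *: p) (l j) = c * \sum_j eigen_power p (l j).
    by rewrite mulr_sumr; apply: eq_bigr => j _; exact: EZ.
  by rewrite mulrCA -mulrBr normrM ler_wpM2l.
split; first exact (main _ _ (integrable_plus p) hp).
exact (main _ (fun j => - lam j) (integrable_minus p) hm).
Qed.

Lemma line_estimateXn n : line_estimate 'X^(n.+1).
Proof.
have [on|en] := boolP (odd n.+1).
  exists 0, 0 => M lam _ _; split.
    rewrite big1 => [|j _]; last by rewrite eigen_powerX on.
    under eq_Rintegral do rewrite hornerXn.
    by rewrite (Rintegral_odd abs_angle) // mulr0 subrr normr0.
  rewrite big1 => [|j _]; last by rewrite eigen_powerX on.
  under eq_Rintegral do rewrite hornerXn.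
  by rewrite aminus_angle (Rintegral_odd abs_co_angle) // mulr0 subrr normr0.
have [k kE] : exists k, n.+1 = k.+1.*2.
  exists n.+1./2.-1; have := odd_double_half n.+1; rewrite (negbTE en) add0n => h.
  by rewrite prednK // -double_gt0 h.
have [mp [mm [c [Ep Em c0 Hc]]]] := eigen_power_sums k phipi.
exists (2 * c), k.+2 => M lam kM [q [eps [P [e2 uv dl]]]].
have [hp hm] := Hc M q eps P lam kM e2 uv dl.
have key (l : 'I_M -> R) m : `|\sum_j ppart (l j) ^+ k.+1 - M%:R * m| <= c ->
    `|\sum_j eigen_power 'X^(n.+1) (l j) - (M + M)%:R * m| <= 2 * c.
  move=> h; rewrite (eq_bigr (fun j => 2 * ppart (l j) ^+ k.+1)); last first.
    by move=> j _; rewrite eigen_powerX (negbTE en) kE doubleK.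
  rewrite -mulr_sumr addnn -mul2n natrM -mulrA -mulrBr normrM.
  by rewrite [`|2|]ger0_norm // ler_wpM2l.
split; apply: key; rewrite ?kE.
  under eq_Rintegral do rewrite hornerXn.
  by rewrite /Rintegral (gmeasure_even_moment abs_angle) Ep.
under eq_Rintegral do rewrite hornerXn.
by rewrite /Rintegral aminus_angle (gmeasure_even_moment abs_co_angle) -aminus_angle Em.
Qed.

(** Monomials of positive degree span these polynomials. A constant fails in general: it counts
    every j on both lines, while each line carries only its share of the mass. *)
Lemma line_estimate_root0 (p : {poly R}) : p.[0] = 0 -> line_estimate p.
Proof.
rewrite horner_coef0 => /eqP p0.
have -> : p = \sum_(i < (size p).-1) p`_i.+1 *: 'X^(i.+1).
  rewrite -{1}(coefK p) poly_def; case E : (size p) p0 => [|m] p0; first by rewrite !big_ord0.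
  by rewrite big_ord_recl /= (eqP p0) scale0r add0r.
apply: (big_ind line_estimate); first 1 last.
- exact: line_estimateD.
- by move=> i _; apply/line_estimateZ/line_estimateXn.
by rewrite -(scale0r 'X^1); apply/line_estimateZ/line_estimateXn.
Qed.

End Lines.

(** * Bernstein polynomials *)

Section Bernstein.
Variable R : realType.

(* The n-th Bernstein polynomial of a sequence of values, through the recursion
   that conditions a binomial variable on its first trial. *)
Fixpoint bernstein n (g : nat -> R) : {poly R} :=
  if n is m.+1 then 'X * bernstein m (g \o S) + (1 - 'X) * bernstein m g
  else (g 0%N)%:P.

Lemma bernsteinS n g x : (bernstein n.+1 g).[x] =
  x * (bernstein n (g \o S)).[x] + (1 - x) * (bernstein n g).[x].
Proof. by rewrite /= !hornerE. Qed.

Lemma bernstein_linear n g h c d x :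
  (bernstein n (fun k => c * g k + d * h k)).[x] =
  c * (bernstein n g).[x] + d * (bernstein n h).[x].
Proof.
elim: n g h => [|n IH] g h; first by rewrite /= !hornerE.
by rewrite !bernsteinS !IH; ring.
Qed.

Lemma bernstein_cst n c x : (bernstein n (fun=> c)).[x] = c.
Proof.
elim: n => [|n IH]; first by rewrite /= hornerE.
by rewrite bernsteinS !IH; ring.
Qed.

(** For a binomial variable, squared distance of the mean from c plus variance. The centre c is kept
    free because conditioning on the first trial shifts it by 1. *)
Lemma bernstein_variance n c x :
  (bernstein n (fun k => (k%:R - c) ^+ 2)).[x] = (n%:R * x - c) ^+ 2 + n%:R * (x * (1 - x)).
Proof.
elim: n c => [|n IH] c; first by rewrite /= hornerE; ring.
rewrite bernsteinS IH.
have -> : (fun k => (k%:R - c) ^+ 2) \o S = fun k : nat => (k%:R - (c - 1)) ^+ 2.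
  by apply/funext => k /=; rewrite -natr1; ring.
by rewrite IH -natr1; ring.
Qed.

Lemma ler_bernstein n g h x : 0 <= x <= 1 -> (forall k, (k <= n)%N -> g k <= h k) ->
  (bernstein n g).[x] <= (bernstein n h).[x].
Proof.
move=> /andP[x0 x1]; elim: n g h => [|n IH] g h gh.
  by rewrite /= !hornerE gh.
rewrite !bernsteinS lerD // ler_wpM2l ?subr_ge0 // IH // => k kn; apply: gh => //.
exact: leq_trans kn _.
Qed.

(** Close points are handled by uniform continuity, distant ones by the oscillation divided by d^2.
    The quadratic term is what a binomial variance controls. *)
Lemma quadratic_modulus (f : R -> R) (e : R) : continuous f -> 0 < e ->
  exists2 K, 0 <= K & forall x y, 0 <= x <= 1 -> 0 <= y <= 1 ->
    `|f x - f y| <= e + K * (x - y) ^+ 2.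
Proof.
move=> cf e0.
have cpt : compact (`[0, 1]%classic : set R) by exact: segment_compact.
have /compact_near_coveringP/(_ _ (0 : R)^'+ (fun d x => forall y, `|x - y| < d -> `|f x - f y| <= e)) := cpt.
case.
  move=> x _.
  have e2 : 0 < e / 2 by rewrite divr_gt0.
  have /cvgrPdist_lt/(_ _ e2)/nbhs_ballP [r /= r0 Hr] := cf x.
  exists (ball x (r / 2), `]0, (r / 2)[%classic).
    split; first by apply/nbhs_ballP; exists (r / 2); rewrite //= divr_gt0.
    by near=> t; rewrite /= in_itv /=; apply/andP; split; near: t; 
     [exact: nbhs_right_gt | apply: nbhs_right_lt; rewrite divr_gt0].
  move=> [x' d] [/= xx' /andP[d0 dr]] y yd.
  have h1 : `|f x - f x'| < e / 2.
    by apply: Hr; apply: le_ball xx'; rewrite ler_pdivrMr // ler_pMr // ler1n.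
  have h2 : `|f x - f y| < e / 2.
    apply: Hr; rewrite /ball /= -(subrK x' x) -addrA.
    rewrite (le_lt_trans (ler_normD _ _)) // [r](splitr r) ltrD //.
    exact: lt_trans yd dr.
  rewrite -(subrK (f x) (f x')) -addrA [e](splitr e) (le_trans (ler_normD _ _)) //.
  by rewrite lerD // ltW // distrC.
move=> d1 /= d10 Hd1.
have [d d0 Hd] : exists2 d : R, 0 < d & forall x y : R, 0 <= x <= 1 -> `|x - y| < d -> `|f x - f y| <= e.
  exists (d1 / 2) => //; first by rewrite divr_gt0.
  move=> x y x01; apply: (Hd1 (d1 / 2)) => //=.
  - by rewrite sub0r normrN ger0_norm ?divr_ge0 ?ltW // ltr_pdivrMr // ltr_pMr // ltr1n.
  - by rewrite divr_gt0.
have cf' : {within `[0, 1], continuous f} by exact: continuous_subspaceT.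
have [c _ Hc] := EVT_max ler01 cf'; have [c' _ Hc'] := EVT_min ler01 cf'.
exists ((f c - f c') / d ^+ 2).
  rewrite divr_ge0 ?sqr_ge0 // subr_ge0; apply: (le_trans (Hc' 0 _)).
    by rewrite in_itv /= lexx ler01.
  by apply: Hc; rewrite in_itv /= lexx ler01.
move=> x y x01 y01; have A0 : `|f x - f y| <= f c - f c'.
  have x01' : x \in `[0, 1] by rewrite in_itv.
  have y01' : y \in `[0, 1] by rewrite in_itv.
  have := Hc x x01'; have := Hc y y01'; have := Hc' x x01'; have := Hc' y y01'.
  by rewrite ler_norml => *; apply/andP; split; lra.
have K0 : 0 <= f c - f c' by exact: le_trans (normr_ge0 _) A0.
have [xy|xy] := ltP `|x - y| d.
  apply: (le_trans (Hd x y x01 xy)); rewrite lerDl mulr_ge0 ?sqr_ge0 //.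
  by rewrite divr_ge0 // sqr_ge0.
apply: (le_trans A0); apply: ler_wpDl; first exact: ltW.
rewrite mulrAC ler_pdivlMr ?exprn_gt0 // ler_wpM2l //.
by rewrite -(real_normK (num_real (x - y))) lerXn2r // nnegrE ?ltW.
Unshelve. all: by end_near. Qed.

Lemma weierstrass01 (f : R -> R) (e : R) : continuous f -> 0 < e ->
  exists p : {poly R}, forall x, 0 <= x <= 1 -> `|f x - p.[x]| <= e.
Proof.
move=> cf e0; have e2 : 0 < e / 2 by rewrite divr_gt0.
have [K K0 HK] := quadratic_modulus cf e2.
(* Since n > 2 K / e, the variance term K x (1 - x) / n is at most e / 2. *)
pose n := (Num.truncn (2 * K / e)).+1.
have n0 : 0 < n%:R :> R by rewrite ltr0n.
have nK : K / n%:R <= e / 2.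
  rewrite ler_pdivrMr // mulrAC ler_pdivlMr // mulrC [e * _]mulrC -ler_pdivrMr //.
  by rewrite ltW // truncnS_gt.
exists (bernstein n (fun k => f (k%:R / n%:R))) => x x01.
(* The choices s = 1 and s = -1 give the two halves of the absolute value. *)
have key (s : R) : s ^+ 2 = 1 -> s * (f x - (bernstein n (fun k => f (k%:R / n%:R))).[x]) <= e.
  move=> s2.
  have -> : s * (f x - (bernstein n (fun k => f (k%:R / n%:R))).[x]) =
      (bernstein n (fun k => s * f x * 1 + (- s) * f (k%:R / n%:R))).[x].
    by rewrite bernstein_linear bernstein_cst; ring.
  apply: (@le_trans _ _ (bernstein n (fun k => e / 2 * 1 + K / n%:R ^+ 2 * (k%:R - n%:R * x) ^+ 2)).[x]).
    apply: ler_bernstein => // k kn.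
    have k01 : 0 <= (k%:R / n%:R : R) <= 1.
      by rewrite divr_ge0 //= ler_pdivrMr // mul1r ler_nat.
    have := HK x (k%:R / n%:R) x01 k01.
    have -> : K * (x - k%:R / n%:R) ^+ 2 = K / n%:R ^+ 2 * (k%:R - n%:R * x) ^+ 2.
      by field; rewrite gt_eqF.
    move=> h; rewrite !mulr1 mulNr -mulrBr; apply: le_trans h.
    have s1 : `|s| = 1.
      by apply/eqP; rewrite -sqr_norm_eq1 s2.
    by rewrite -[leRHS]mul1r -s1 -normrM ler_norm.
  rewrite bernstein_linear bernstein_cst bernstein_variance subrr expr0n add0r mulr1.
  rewrite [leRHS](splitr e) lerD2l; apply: le_trans nK.
  have -> : K / n%:R ^+ 2 * (n%:R * (x * (1 - x))) = K / n%:R * (x * (1 - x)).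
    by field; rewrite gt_eqF.
  have /andP[x0 x1] := x01.
  rewrite ler_piMr ?(divr_ge0 K0 (ltW n0)) //.
  have : 0 <= 1 - x <= 1 by lra.
  by move=> /andP[? ?]; rewrite mulr_ile1 ?x0 ?x1.
rewrite ler_norml lerNl -mulN1r key ?sqrrN ?expr1n //=.
by rewrite -[leLHS]mul1r key ?expr1n.
Qed.

(** Making the value at 0 exact costs half of the error: the two lines meet at 0, and the
    approximants must agree there for the constants to cancel. *)
Lemma weierstrass2 (f : R -> R) (e : R) : continuous f -> 0 < e ->
  exists2 p : {poly R}, p.[0] = f 0 & forall x, `|x| <= 2 -> `|f x - p.[x]| <= e.
Proof.
move=> cf e0; have e2 : 0 < e / 2 by rewrite divr_gt0.
pose g x := f (4 * x - 2).
have cg : continuous g.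
  move=> x; apply: (@continuous_comp _ _ _ (fun x : R => 4 * x - 2) f); last exact: cf.
  by apply: cvgB; [apply: cvgM; [exact: cvg_cst|exact: cvg_id]|exact: cvg_cst].
have [p Hp] := weierstrass01 cg e2.
pose q := p \Po ((1 / 4)%:P * 'X + (1 / 2)%:P).
have Hq x : `|x| <= 2 -> `|f x - q.[x]| <= e / 2.
  rewrite ler_norml => /andP[x1 x2].
  rewrite horner_comp (_ : _.[x] = 1 / 4 * x + 1 / 2); last by rewrite !hornerE.
  have -> : f x = g (1 / 4 * x + 1 / 2) by rewrite /g; congr f; field.
  by apply: Hp; apply/andP; split; lra.
exists (q + (f 0 - q.[0])%:P); first by rewrite hornerD hornerC addrC subrK.
move=> x x2; rewrite hornerD hornerC opprD addrA [e](splitr e) (le_trans (ler_normB _ _)) //.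
by rewrite lerD ?Hq // normr0.
Qed.
End Bernstein.

Section Average.
Variable R : realType.
Variable phi : R.
Hypothesis phipi : - pi <= phi <= pi.

Lemma gmeasure_plus_setT : gmeasure (aplus phi) setT = (1 - `|phi| / pi)%:E.
Proof. exact: (gmeasure_setT (abs_angle phipi)). Qed.

Lemma gmeasure_minus_setT : gmeasure (aminus phi) setT = (`|phi| / pi)%:E.
Proof.
rewrite aminus_angle (gmeasure_setT (abs_co_angle phipi)); congr EFin.
have := pi_gt0 R; move: (pi : R) => P P0; by field; rewrite gt_eqF.
Qed.

Lemma integrable_horner_plus (p : {poly R}) :
  (gmeasure (aplus phi)).-integrable setT (fun t => p.[t]%:E).
Proof. exact: (integrable_horner (abs_angle phipi)). Qed.

Lemma integrable_horner_minus (p : {poly R}) :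
  (gmeasure (aminus phi)).-integrable setT (fun t => p.[t]%:E).
Proof. rewrite aminus_angle; exact: (integrable_horner (abs_co_angle phipi)). Qed.

(** Subtracting the common value at 0 makes both polynomials vanish there. The constant itself is
    counted exactly: each j stands for two eigenvalues, and the two masses add up to 1. *)
Lemma line_sum_estimate (p q : {poly R}) : p.[0] = q.[0] -> exists (C : R) K,
  forall M (lam : 'I_M -> R), (K <= M)%N -> model_eigenvalues phi lam ->
  `|\sum_j (eigen_power p (lam j) + eigen_power q (- lam j) - p.[0] *+ 2)
    - (M + M)%:R * (\int[gmeasure (aplus phi)]_t p.[t] + \int[gmeasure (aminus phi)]_t q.[t])| <= C.
Proof.
move=> pq; set c := p.[0].
have p0 : (p - c%:P).[0] = 0 by rewrite hornerD hornerN hornerC subrr.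
have q0 : (q - c%:P).[0] = 0 by rewrite hornerD hornerN hornerC -pq subrr.
have [C [K HC]] := line_estimate_root0 phipi p0.
have [D [L HD]] := line_estimate_root0 phipi q0.
exists (C + D), (maxn K L) => M lam; rewrite geq_max => /andP[KM LM] ml.
have [h1 _] := HC M lam KM ml; have [_ h2] := HD M lam LM ml.
have iB (nu : {measure set (measurableTypeR R) -> \bar R}) (r : {poly R}) m :
    nu.-integrable setT (fun t => r.[t]%:E) ->
    nu.-integrable setT (fun t => (c%:P).[t]%:E) -> nu setT = m%:E ->
    \int[nu]_t (r - c%:P).[t] = \int[nu]_t r.[t] - c * m.
  move=> ir ic num.
  rewrite -[c * m]/(c * fine m%:E) -num -(Rintegral_cst _ measurableT).
  have -> : \int[nu]_x cst c x = \int[nu]_x (c%:P).[x].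
    by apply: eq_Rintegral => t _; rewrite hornerC.
  by rewrite -RintegralB //; apply: eq_Rintegral => t _; rewrite hornerD hornerN.
rewrite (iB _ _ _ (integrable_horner_plus p) (integrable_horner_plus _) gmeasure_plus_setT) in h1.
rewrite (iB _ _ _ (integrable_horner_minus q) (integrable_horner_minus _) gmeasure_minus_setT) in h2.
have eB (r : {poly R}) x : eigen_power (r - c%:P) x = eigen_power r x - c *+ 2.
  by rewrite /eigen_power !hornerD !hornerN !hornerC mulr2n opprD addrACA.
rewrite (_ : \sum_j _ = \sum_j eigen_power (p - c%:P) (lam j) +
    \sum_j eigen_power (q - c%:P) (- lam j) + (M + M)%:R * c); last first.
  have -> : (M + M)%:R * c = \sum_(j < M) (c *+ 2).
    by rewrite sumr_const card_ord -mulrnA mulr_natl mul2n addnn.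
  rewrite -!big_split; apply: eq_bigr => j _ /=; rewrite !eB.
  by ring.
move: h1 h2; move: (\sum_j _) (\sum_j _) (Rintegral _ _ _) (Rintegral _ _ _) => t s v u h1 h2.
have -> : s + t + (M + M)%:R * c - (M + M)%:R * (u + v) =
  (s - (M + M)%:R * (u - c * (1 - `|phi| / pi))) + (t - (M + M)%:R * (v - c * (`|phi| / pi))).
  ring.
by rewrite (le_trans (ler_normD _ _)) // lerD.
Qed.

End Average.

(** * Integrals over the complex plane *)

Section ComplexMeasures.
Variable R : realType.
Implicit Types (phi : R) (f : borelC R -> R) (g : borelC R -> R[i]).

Lemma continuous_measurable_borelC (f : (R[i] : numClosedFieldType) -> R) :
  continuous f -> measurable_fun [set: borelC R] f.
Proof.
move=> cf; apply: (@measurability _ _ (borelC R) (measurableTypeR R) setT f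
  (@RGenOInfty.G R)); first exact: RGenOInfty.measurableE.
move=> _ [_ [x ->] <-]; rewrite setTI; apply: sub_sigma_algebra.
by move/continuousP : cf; apply; exact: interval_open.
Qed.

Lemma normC_ge_Im (z : R[i]) : `|complex.Im z|%:C%C <= `|z|.
Proof.
by have := normc_ge_Re (z * (0 -i* 1)%C); case: z => x y;
  rewrite normrM /= !mulr0 sub0r mulrN1 opprK [`|(_ -i* _)%C|]normc_def /=
    expr0n add0r sqrrN expr1n sqrtr1 mulr1.
Qed.

Lemma measurable_lipschitzC (f : R[i] -> R) :
  (forall z w, `|f z - f w|%:C%C <= `|z - w|) -> measurable_fun [set: borelC R] f.
Proof.
move=> lf; apply: continuous_measurable_borelC => z.
apply/(@cvgrPdist_lt _ _ _ (nbhs (z : (R[i] : numClosedFieldType)))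
  (nbhs_filter (z : (R[i] : numClosedFieldType)))) => e e0.
apply/nbhs_ballP; exists (e%:C%C); first by rewrite /= ltcR.
by move=> w; rewrite /ball /= -ltcR; apply: le_lt_trans; exact: lf.
Qed.

Lemma measurable_Re : measurable_fun [set: borelC R] (@complex.Re R).
Proof.
by apply: measurable_lipschitzC => z w; rewrite -raddfB; exact: normc_ge_Re.
Qed.

Lemma measurable_Im : measurable_fun [set: borelC R] (@complex.Im R).
Proof.
by apply: measurable_lipschitzC => z w; rewrite -raddfB; exact: normC_ge_Im.
Qed.

Definition measurableC g := measurable_fun [set: borelC R] (fun z => complex.Re (g z)) /\
  measurable_fun [set: borelC R] (fun z => complex.Im (g z)).

Lemma measurableC_cst (c : R[i]) : measurableC (fun=> c).
Proof. by split; exact: measurable_cst. Qed.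

Lemma measurableCD g h : measurableC g -> measurableC h -> measurableC (fun z => g z + h z).
Proof.
move=> [g1 g2] [h1 h2]; split.
  rewrite (_ : (fun _ => _) = fun z => complex.Re (g z) + complex.Re (h z)).
    exact: measurable_funD.
  by apply/funext => z; rewrite raddfD.
rewrite (_ : (fun _ => _) = fun z => complex.Im (g z) + complex.Im (h z)).
  exact: measurable_funD.
by apply/funext => z; rewrite raddfD.
Qed.

Lemma measurableCM g h : measurableC g -> measurableC h -> measurableC (fun z => g z * h z).
Proof.
move=> [g1 g2] [h1 h2]; split.
  rewrite (_ : (fun _ => _) = fun z => complex.Re (g z) * complex.Re (h z)
     - complex.Im (g z) * complex.Im (h z)).
    by apply: measurable_funB; exact: measurable_funM.
  by apply/funext => z; case: (g z) => a b; case: (h z) => c d.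
rewrite (_ : (fun _ => _) = fun z => complex.Re (g z) * complex.Im (h z)
     + complex.Im (g z) * complex.Re (h z)).
  by apply: measurable_funD; exact: measurable_funM.
by apply/funext => z; case: (g z) => a b; case: (h z) => c d.
Qed.

Lemma measurableC_peval P : measurableC (@peval R P).
Proof.
have mid : measurableC id by split; [exact: measurable_Re | exact: measurable_Im].
have mconj : measurableC (fun z => z^*%C).
  split.
    rewrite (_ : (fun _ => _) = @complex.Re R); first exact: measurable_Re.
    by apply/funext; case.
  rewrite (_ : (fun _ => _) = fun z => - complex.Im (z : R[i])); last by apply/funext; case.
  by apply: measurableT_comp => //; exact: measurable_Im.
have mhorner (q : {poly R[i]}) : measurableC (fun z => q.[z]).
  elim/poly_ind: q => [|q c IH].
    rewrite (_ : (fun _ => _) = fun=> 0); first exact: measurableC_cst.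
    by apply/funext => z; rewrite horner0.
  rewrite (_ : (fun _ => _) = fun z => q.[z] * z + c).
    by apply: measurableCD; [exact: measurableCM | exact: measurableC_cst].
  by apply/funext => z; rewrite hornerMXaddC.
elim/poly_ind: P => [|P q IH].
  rewrite (_ : peval 0 = fun=> 0); first exact: measurableC_cst.
  by apply/funext => z; rewrite /peval !horner0.
rewrite (_ : peval _ = fun z => peval P z * z^*%C + q.[z]).
  by apply: measurableCD => //; exact: measurableCM.
by apply/funext => z; rewrite /peval hornerMXaddC hornerD hornerM hornerC.
Qed.

Lemma ge0_integral_mu_spec N phi (f : borelC R -> \bar R) :
  measurable_fun setT f -> (forall z, 0 <= f z)%E ->
  (\int[mu_spec N phi]_z f z = (N%:R^-1)%:E * \sum_(z <- spec (Amx N phi 0)) f z)%E.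
Proof.
move=> mf f0; rewrite /mu_spec ge0_integral_mscale // ge0_integral_measure_sum //.
congr (_ * _)%E; rewrite (big_nth 0) big_mkord; apply: eq_bigr => i _.
by rewrite integral_dirac // diracT mul1e.
Qed.

Lemma mu_spec_setT N phi : (0 < N)%N -> mu_spec N phi setT = 1%E.
Proof.
move=> N0.
have := @ge0_integral_mu_spec N phi (fun=> 1%E) (measurable_cst _) (fun=> lee01).
rewrite integral_cst // mul1e => ->.
rewrite sumEFin big_const_seq count_predT size_spec iter_addr_0 -EFinM mulVf //.
by rewrite pnatr_eq0 -lt0n.
Qed.

Lemma Rintegral_mu_spec N phi f : measurable_fun setT f ->
  \int[mu_spec N phi]_z f z = N%:R^-1 * \sum_(z <- spec (Amx N phi 0)) f z.
Proof.
move=> mf; rewrite /Rintegral integralE.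
have mE : measurable_fun setT (EFin \o f) by exact/measurable_EFinP.
rewrite ge0_integral_mu_spec; [|exact: measurable_funepos|exact: funepos_ge0].
rewrite ge0_integral_mu_spec; [|exact: measurable_funeneg|exact: funeneg_ge0].
have -> : (fun z => (f z)%:E)^\+%E = fun z => (Num.max (f z) 0)%:E.
  by apply/funext => z; rewrite funeposE EFin_max.
have -> : (fun z => (f z)%:E)^\-%E = fun z => (Num.max (- f z) 0)%:E.
  by apply/funext => z; rewrite funenegE EFin_max.
rewrite !sumEFin -!EFinM -EFinB /= -mulrBr -sumrB; congr (_ * _).
apply: eq_bigr => z _; have /orP[h|h] := le_total 0 (f z).
  by rewrite (max_l h) max_r ?subr0 // oppr_le0.
by rewrite (max_r h) max_l ?oppr_ge0 // sub0r opprK.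
Qed.

Section Limit.
Variables (phi : R) (f : borelC R -> R).
Hypothesis mf : measurable_fun setT f.
Hypothesis fplus : (gmeasure (aplus phi)).-integrable setT (fun t => (f (Rot (phi / 2) t))%:E).
Hypothesis fminus :
  (gmeasure (aminus phi)).-integrable setT (fun t => (f (Rot (phi / 2 + pi / 2) t))%:E).

Let mE : measurable_fun setT (EFin \o f). Proof. exact/measurable_EFinP. Qed.

Let push_integrable alpha (nu : {measure set (measurableTypeR R) -> \bar R}) :
  nu.-integrable setT (fun t => (f (Rot alpha t))%:E) ->
  (Rot_push alpha nu).-integrable setT (EFin \o f).
Proof.
move=> inu; apply: (integrable_pushforward (measurable_Rot alpha) mE) => //.
Qed.

Let push_integral alpha (nu : {measure set (measurableTypeR R) -> \bar R}) :
  nu.-integrable setT (fun t => (f (Rot alpha t))%:E) ->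
  (\int[Rot_push alpha nu]_z (f z)%:E = \int[nu]_t (f (Rot alpha t))%:E)%E.
Proof.
move=> inu; exact: (@integral_pushforward _ _ _ _ _ _ (measurable_Rot alpha) nu setT _ mE inu measurableT).
Qed.

Lemma integrable_mu_lim : (mu_lim phi).-integrable setT (EFin \o f).
Proof.
apply/integrableP; split=> //.
rewrite ge0_integral_measure_add //; last exact: measurableT_comp.
have /integrableP[_ h1] := push_integrable fplus.
have /integrableP[_ h2] := push_integrable fminus.
exact (lte_add_pinfty h1 h2).
Qed.

Lemma Rintegral_mu_lim : \int[mu_lim phi]_z f z =
  \int[gmeasure (aplus phi)]_t f (Rot (phi / 2) t) +
  \int[gmeasure (aminus phi)]_t f (Rot (phi / 2 + pi / 2) t).
Proof.
have H := integral_measure_add measurableT (push_integrable fplus) (push_integrable fminus).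
exact (etrans (congr1 fine (etrans H (f_equal2 adde (push_integral fplus) (push_integral fminus))))
  (fineD (integrable_fin_num measurableT fplus) (integrable_fin_num measurableT fminus))).
Qed.

End Limit.

End ComplexMeasures.

(** * Asymptotics of spectral averages *)

Section Approximation.
Variable R : realType.

(** The density vanishes for |t| >= 2 a, and a = cos(psi/2) <= 1, so only |t| <= 2 matters. *)
Lemma gmeasure_small (psi : R) (h : measurableTypeR R -> R) (e : R) : 0 <= psi <= pi -> 0 <= e ->
  (gmeasure (cos (psi / 2))).-integrable setT (EFin \o h) ->
  (forall t : R, `|t| <= 2 -> `|h t| <= e) ->
  `|\int[gmeasure (cos (psi / 2))]_t h t| <= e * (1 - psi / pi).
Proof.
move=> psi0pi e0 ih he; set a := cos (psi / 2).
have a1 : a <= 1 by exact: cos_le1.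
apply: (le_trans (le_normr_Rintegral measurableT ih)).
have mh : measurable_fun setT h by apply/measurable_EFinP; exact: measurable_int ih.
have inh : (gmeasure a).-integrable setT (fun t => `|h t|%:E).
  by apply: integrable_norm.
rewrite -lee_fin /Rintegral fineK; last by exact (integrable_fin_num measurableT inh).
rewrite (gmeasure_integral psi0pi); first 1 last.
- by move=> t; rewrite lee_fin.
- by apply/measurable_EFinP; exact: measurableT_comp.
rewrite EFinM -(gdens_mass psi0pi) -ge0_integralZl //; first 1 last.
- exact: measurable_gdens.
- by move=> t _; exact: gdens_ge0.
apply: ge0_le_integral => //.
- by move=> t _; rewrite mule_ge0 ?gdens_ge0 // lee_fin.
- apply: emeasurable_funM; last exact: measurable_gdens.
  by apply/measurable_EFinP; exact: measurableT_comp.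
- by apply: emeasurable_funM; last exact: measurable_gdens.
move=> t _; have := gdens_ge0 a t; rewrite /gdens; case: ifP => [ta g0|]; last by rewrite !mule0.
apply: lee_wpmul2r; first exact: g0.
by rewrite lee_fin; apply: he; apply: (le_trans (ltW ta)); lra.
Qed.

End Approximation.

Section Estimate.
Variable R : realType.
Variable phi : R.
Hypothesis phipi : - pi <= phi <= pi.

Lemma Rot0 (alpha : R) : Rot alpha 0 = 0.
Proof. by rewrite /Rot mulr0. Qed.

Lemma average_estimate (F : borelC R -> R) (p q : {poly R}) : measurable_fun setT F ->
  (forall t : R, F (Rot (phi / 2) t) = p.[t]) ->
  (forall t : R, F (Rot (phi / 2 + pi / 2) t) = q.[t]) ->
  exists (C : R) K, forall M, (K <= M)%N -> (0 < M)%N ->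
   `|(M + M)%:R^-1 * \sum_(z <- spec (Amx (M + M) phi 0)) F z - \int[mu_lim phi]_z F z|
     <= C / (M + M)%:R.
Proof.
move=> mF Fp Fq.
have p0 : p.[0] = F 0 by rewrite -Fp Rot0.
have q0 : q.[0] = F 0 by rewrite -Fq Rot0.
have [C [K HC]] := line_sum_estimate phipi (etrans p0 (esym q0)).
exists C, K => M KM M0.
have [lam ml ->] := spec_lines phi M0.
have m0 : 0 < (M + M)%:R :> R by rewrite ltr0n addn_gt0 M0.
have E : \int[mu_lim phi]_z F z =
    \int[gmeasure (aplus phi)]_t p.[t] + \int[gmeasure (aminus phi)]_t q.[t].
  rewrite Rintegral_mu_lim //; first 1 last.
  - by rewrite (_ : (fun t => _) = fun t => p.[t]%:E);
      [exact: integrable_horner_plus | apply/funext => t; rewrite Fp].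
  - by rewrite (_ : (fun t => _) = fun t => q.[t]%:E);
      [exact: integrable_horner_minus | apply/funext => t; rewrite Fq].
  apply: f_equal2; apply: eq_Rintegral => t _; [exact: Fp | exact: Fq].
have S : \sum_j (F (Rot (phi / 2) (Num.sqrt (lam j))) + F (Rot (phi / 2) (- Num.sqrt (lam j)))
         + F (Rot (phi / 2 + pi / 2) (Num.sqrt (- lam j)))
         + F (Rot (phi / 2 + pi / 2) (- Num.sqrt (- lam j))) - F 0 *+ 2) =
    \sum_j (eigen_power p (lam j) + eigen_power q (- lam j) - p.[0] *+ 2).
  by apply: eq_bigr => j _; rewrite !Fp !Fq p0 -!addrA.
have h := HC M lam KM ml; rewrite -E -S in h.
move: h; move: (\sum_j _) (Rintegral _ _ _) => s t h.
have -> : (M + M)%:R^-1 * s - t = (s - (M + M)%:R * t) / (M + M)%:R.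
  by rewrite mulrBl [_ * t]mulrC mulfK ?gt_eqF // mulrC.
by rewrite normrM [`|_^-1|]gtr0_norm ?invr_gt0 // ler_wpM2r // invr_ge0 ltW.
Qed.

Lemma integrable_bounded_continuous (psi : R) (f : R -> R) : 0 <= psi <= pi ->
  continuous f -> bounded_fun f -> (gmeasure (cos (psi / 2))).-integrable setT (EFin \o f).
Proof.
move=> psi0pi cf bf; apply: measurable_bounded_integrable => //.
- exact: gmeasure_lty.
- exact: (@continuous_measurable_fun R f).
Qed.

Lemma line_integral_approx (psi e : R) (f : R -> R) (p : {poly R}) : 0 <= psi <= pi -> 0 <= e ->
  continuous f -> bounded_fun f -> (forall t, `|t| <= 2 -> `|f t - p.[t]| <= e) ->
  `|\int[gmeasure (cos (psi / 2))]_t f t - \int[gmeasure (cos (psi / 2))]_t p.[t]|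
    <= e * (1 - psi / pi).
Proof.
move=> psi0pi e0 cf bf fp.
have i1 := integrable_bounded_continuous psi0pi cf bf.
have i2 := integrable_horner psi0pi p.
rewrite -(RintegralB measurableT i1 i2).
apply: (gmeasure_small psi0pi e0 _ fp).
exact: (integrableB measurableT i1 i2).
Qed.

Lemma weak_average (f : (R[i] : numClosedFieldType) -> R) (e : R) : continuous f -> bounded_fun f -> 0 < e ->
  exists K, forall M, (K <= M)%N -> (0 < M)%N ->
   `|(M + M)%:R^-1 * \sum_(z <- spec (Amx (M + M) phi 0)) f z - \int[mu_lim phi]_z f z| <= e.
Proof.
move=> cf bf e0.
have mf : measurable_fun [set: borelC R] f by exact: continuous_measurable_borelC.
(* One quarter of e goes to the two line integrals together, one to C / N, and two to the spectral
   sum, where each of the M indices carries four errors d against N = 2 M. *)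
pose d := e / 4; have d0 : 0 < d by rewrite divr_gt0.
have cR alpha : continuous (fun t : R => f (Rot alpha t)).
  by move=> t; apply: (@continuous_comp _ _ _ (Rot alpha : R -> (R[i] : numClosedFieldType)) f); 
    [exact: continuous_Rot | exact: cf].
have bR alpha : bounded_fun (fun t : R => f (Rot alpha t)).
  by have [B [Br HB]] := bf; exists B; split=> // x /HB h t _; exact: h.
have [p p0 Hp] := weierstrass2 (cR (phi / 2)) d0.
have [q q0 Hq] := weierstrass2 (cR (phi / 2 + pi / 2)) d0.
rewrite Rot0 in p0; rewrite Rot0 in q0.
have [C [K HC]] := line_sum_estimate phipi (etrans p0 (esym q0)).
exists (maxn K (Num.truncn (C / d)).+1) => M; rewrite geq_max => /andP[KM LM] M0.
have [lam ml HS] := spec_lines phi M0.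
have m0 : 0 < (M + M)%:R :> R by rewrite ltr0n addn_gt0 M0.
have fplus : (gmeasure (aplus phi)).-integrable setT (fun t => (f (Rot (phi / 2) t))%:E).
  exact: (integrable_bounded_continuous (abs_angle phipi) (cR _) (bR _)).
have fminus : (gmeasure (aminus phi)).-integrable setT (fun t => (f (Rot (phi / 2 + pi / 2) t))%:E).
  rewrite aminus_angle.
  exact: (integrable_bounded_continuous (abs_co_angle phipi) (cR _) (bR _)).
rewrite (Rintegral_mu_lim mf fplus fminus).
have hA := line_integral_approx (abs_angle phipi) (ltW d0) (cR _) (bR _) Hp.
have hB := line_integral_approx (abs_co_angle phipi) (ltW d0) (cR _) (bR _) Hq.
rewrite -aminus_angle in hB.
have CM : C / (M + M)%:R <= d.
  rewrite ler_pdivrMr // mulrC -ler_pdivrMr //.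
  by apply: (le_trans (ltW (truncnS_gt _))); rewrite ler_nat (leq_trans LM) // leq_addr.
have h := HC M lam KM ml.
set S1 := \sum_j _ in h.
have hS : `|\sum_(z <- spec (Amx (M + M) phi 0)) f z - S1| <= M%:R * (4 * d).
  rewrite HS /S1 -sumrB (le_trans (ler_norm_sum _ _ _)) //.
  rewrite mulr_natl -[in leRHS](card_ord M) -sumr_const; apply: ler_sum => j _.
  have l4 := model_eigenvalue_le4 j ml.
  have sq (x : R) : `|x| <= 4 -> `|Num.sqrt x| <= 2 /\ `|- Num.sqrt x| <= 2.
    move=> x4; rewrite normrN ger0_norm ?sqrtr_ge0 //.
    suff : Num.sqrt x <= 2 by [].
    have -> : 2 = Num.sqrt 4 :> R.
      by rewrite (_ : 4 = 2 ^+ 2) ?sqrtr_sqr ?ger0_norm // -natrX.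
    by rewrite ler_sqrt ?(le_trans _ x4) // ?ler_norm // (le_trans (ler_norm x)).
  have l4N : `|- lam j| <= 4 by rewrite normrN.
  have [s1 s2] := sq _ l4; have [s3 s4] := sq _ l4N.
  have := Hp _ s1; have := Hp _ s2; have := Hq _ s3; have := Hq _ s4.
  rewrite /eigen_power p0; move: (f _) (f _) (f _) (f _) (f 0) => a1 a2 a3 a4 a0.
  move: p.[_] p.[_] q.[_] q.[_] => b1 b2 b3 b4.
  move=> k4 k3 k2 k1; have -> : 4 * d = d + d + (d + d) by ring.
  rewrite (_ : _ - _ = (a1 - b1) + (a2 - b2) + ((a3 - b3) + (a4 - b4))); last by ring.
  rewrite (le_trans (ler_normD _ _)) // lerD //; rewrite (le_trans (ler_normD _ _)) // lerD //.
have key (A A' B B' t x y : R) : x + y = d -> `|A - A'| <= x -> `|B - B'| <= y ->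
    `|S1 - (M + M)%:R * (A' + B')| <= C -> `|t - S1| <= M%:R * (4 * d) ->
    `|(M + M)%:R^-1 * t - (A + B)| <= e.
  move=> xy hx hy h1 h2.
  have -> : (M + M)%:R^-1 * t - (A + B) = (t - S1) / (M + M)%:R +
      (S1 - (M + M)%:R * (A' + B')) / (M + M)%:R - ((A - A') + (B - B')).
    by move: ((M + M)%:R : R) m0 => n n0; field; rewrite gt_eqF.
  have -> : e = 2 * d + d + (x + y) by rewrite xy /d; field.
  rewrite (le_trans (ler_normB _ _)) // lerD //; last first.
    by rewrite (le_trans (ler_normD _ _)) // lerD.
  rewrite (le_trans (ler_normD _ _)) // lerD // normrM [`|_^-1|]gtr0_norm ?invr_gt0 //.
    rewrite ler_pdivrMr //; apply: (le_trans h2).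
    by rewrite (_ : 2 * d * (M + M)%:R = M%:R * (4 * d)) // natrD; ring.
  by apply: le_trans CM; rewrite ler_wpM2r // invr_ge0 ltW.
(* The errors of the two integrals are d times the masses of the lines, and these masses add up to
   1. *)
refine (key _ _ _ _ _ _ _ _ hA hB h hS).
by have := pi_gt0 R; move: (pi : R) => P P0; field; rewrite gt_eqF.
Qed.

End Estimate.

(** * Supports *)

Section Support.
Variable R : realType.
Local Notation mu := (@lebesgue_measure R).

Lemma ellK_ge (k : R) : 0 <= k <= 1 -> ((pi / 2)%:E <= ellK k)%E.
Proof.
move=> /andP[k0]; rewrite le_eqVlt => /orP[/eqP ->|k1].
  by rewrite /ellK ltxx leey.
rewrite ellK_series ?k0 //.
have := @nneseries_lim_ge R (fun n => (pi / 2 * cbin R n ^+ 2 * k ^+ n.*2)%:E) xpredT 0 1.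
rewrite big_nat1 /cbin bin0 expr0 divr1 expr1n !mulr1; apply => n _ _.
rewrite lee_fin !mulr_ge0 ?divr_ge0 ?pi_ge0 ?sqr_ge0 //.
exact: exprn_ge0.
Qed.

(** The elliptic integral is at least pi/2, its value at modulus 0. A bound uniform up to the ends
    makes the whole closed segment the support. *)
Lemma gdens_ge (a t : R) : 0 <= a <= 1 -> `|t| < 2 * a -> ((2 * pi)^-1%:E <= gdens a t)%E.
Proof.
move=> /andP[a0 a1] ta; rewrite /gdens ta.
have pi0 := pi_gt0 R.
have -> : ((2 * pi)^-1)%:E = ((pi ^+ 2)^-1%:E * (pi / 2)%:E)%E :> \bar R.
  by rewrite -EFinM; congr EFin; move: (pi : R) pi0 => P P0; field; rewrite gt_eqF.
apply: lee_wpmul2l; first by rewrite lee_fin invr_ge0 exprn_ge0 // ltW.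
apply: ellK_ge; rewrite sqrtr_ge0 /= -[leRHS]sqrtr1 ler_sqrt //.
have := sqr_ge0 t; nra.
Qed.

Lemma gmeasure_eq0 (A : set R) : gmeasure 0 A = 0%E.
Proof.
rewrite /gmeasure integral0_eq // => t _; rewrite /gdens mulr0.
by rewrite ltNge normr_ge0.
Qed.

Lemma supp_gmeasure0 : supp (gmeasure (0 : R)) = set0.
Proof.
apply/seteqP; split=> // x /(_ setT openT Logic.I).
by rewrite gmeasure_eq0 ltxx.
Qed.

Lemma supp_gmeasure (a : R) : 0 < a <= 1 ->
  supp (gmeasure a) = `[- (2 * a), 2 * a]%classic.
Proof.
move=> /andP[a0 a1]; apply/seteqP; split=> x.
  move=> sx; rewrite /= in_itv /= -ler_norml leNgt; apply/negP => xa.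
  have oU : open [set y : R | 2 * a < `|y|].
    apply: (@open_comp _ _ (fun y : R => `|y|) [set y | 2 * a < y]).
      by move=> y _; exact: norm_continuous.
    exact: open_gt.
  have := sx _ oU xa.
  rewrite /gmeasure integral0_eq ?ltxx // => y /= ay.
  by rewrite /gdens ltNge (ltW ay).
rewrite /= in_itv /= => /andP[x1 x2] U oU Ux.
have /nbhs_ballP [e /= e0 eU] : nbhs x U by exact: open_nbhs_nbhs.
(* The neighbourhood is cut down to the segment; as a > 0, the interval is nonempty even when x is
   an endpoint. *)
pose l := Num.max (x - e) (- (2 * a)); pose r := Num.min (x + e) (2 * a).
have lr : l < r.
  by rewrite /l /r lt_min !gt_max; apply/andP; split; apply/andP; split; lra.
have c0 : 0 < (2 * pi)^-1 :> R by rewrite invr_gt0 mulr_gt0 // pi_gt0.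
apply: (@lt_le_trans _ _ ((2 * pi)^-1 * (r - l))%:E).
  by rewrite lte_fin mulr_gt0 // subr_gt0.
have -> : (((2 * pi)^-1 * (r - l))%:E = \int[mu]_(t in `]l, r[) (cst ((2 * pi)^-1)%:E) t)%E.
  by rewrite integral_cst //= lebesgue_measure_itv /= lte_fin lr -EFinB -EFinM.
apply: (@le_trans _ _ (gmeasure a `]l, r[)).
  apply: ge0_le_integral => //=.
  - by move=> t _; rewrite lee_fin ltW.
  - by apply: measurable_funTS; exact: measurable_gdens.
  move=> t; rewrite /= in_itv /= => /andP[lt tr]; apply: gdens_ge; first by rewrite (ltW a0).
  rewrite ltr_norml; move: lt tr; rewrite /l /r lt_min gt_max.
  by move=> /andP[_ ->] /andP[_ ->].
apply: le_measure; rewrite ?inE //; first exact: open_measurable.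
move=> t; rewrite /= in_itv /= => /andP[lt tr]; apply: eU.
rewrite /ball /= ltr_norml; move: lt tr; rewrite /l /r lt_min gt_max.
by move=> /andP[h1 _] /andP[h2 _]; apply/andP; split; lra.
Qed.

End Support.

(** * Polynomials in z and its conjugate *)

Section PolynomialTest.
Variable R : realType.

(** On the line z = e^(i alpha) t the conjugate is e^(-i alpha) t, again linear in the real
    parameter t. *)
Lemma peval_line (alpha : R) P :
  exists p : {poly R[i]}, forall t : R, peval P (Rot alpha t) = p.[t%:C%C].
Proof.
elim/poly_ind: P => [|P q [p IH]].
  by exists 0 => t; rewrite /peval !horner0.
exists (p * ((expi alpha)^*%C%:P * 'X) + (q \Po ((expi alpha)%:P * 'X))) => t.
have -> : peval (P * 'X + q%:P) (Rot alpha t) =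
    peval P (Rot alpha t) * (Rot alpha t)^*%C + q.[Rot alpha t].
  by rewrite /peval hornerMXaddC hornerD hornerM hornerC.
rewrite IH hornerD !hornerM horner_comp !hornerM !hornerC !hornerX; congr (_ * _ + _).
rewrite /Rot /=; case: (expi alpha) => a b /=.
by apply/eqP; rewrite eq_complex /=; apply/andP; split; apply/eqP; ring.
Qed.

Lemma Re_Im_horner_line (p : {poly R[i]}) : exists q r : {poly R}, forall t : R,
  complex.Re p.[t%:C%C] = q.[t] /\ complex.Im p.[t%:C%C] = r.[t].
Proof.
elim/poly_ind: p => [|p c [q [r IH]]]; first by exists 0, 0 => t; rewrite !horner0.
exists (q * 'X + (complex.Re c)%:P), (r * 'X + (complex.Im c)%:P) => t.
rewrite !hornerMXaddC; case: (p.[_]) (IH t) => x y /= [<- <-].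
by case: c => a b /=; split; ring.
Qed.

Lemma normC_le_ReIm (z : R[i]) :
  `|z| <= (`|complex.Re z| + `|complex.Im z|)%:C%C.
Proof.
case: z => x y; rewrite normc_def lecR /=.
rewrite -[leRHS]ger0_norm ?addr_ge0 // -sqrtr_sqr ler_wsqrtr //.
rewrite sqrrD !real_normK ?num_real // -addrA [_ *+ 2 + _]addrC addrA lerDl.
by rewrite mulrn_wge0 // mulr_ge0.
Qed.

Section TestFunctions.
Variable phi : R.
Hypothesis phipi : - pi <= phi <= pi.
Variable P : {poly {poly R[i]}}.

Let reim alpha : exists q r : {poly R}, forall t : R,
  complex.Re (peval P (Rot alpha t)) = q.[t] /\ complex.Im (peval P (Rot alpha t)) = r.[t].
Proof.
have [p pE] := peval_line alpha P; have [q [r H]] := Re_Im_horner_line p.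
by exists q, r => t; rewrite pE.
Qed.

Let line_integrable (F : borelC R -> R) (p q : {poly R}) : measurable_fun setT F ->
  (forall t : R, F (Rot (phi / 2) t) = p.[t]) ->
  (forall t : R, F (Rot (phi / 2 + pi / 2) t) = q.[t]) ->
  (mu_lim phi).-integrable setT (EFin \o F).
Proof.
move=> mF Fp Fq; apply: (integrable_mu_lim mF).
  by rewrite (_ : (fun t => _) = fun t => p.[t]%:E);
    [exact: integrable_horner_plus | apply/funext => t; rewrite Fp].
by rewrite (_ : (fun t => _) = fun t => q.[t]%:E);
  [exact: integrable_horner_minus | apply/funext => t; rewrite Fq].
Qed.

Lemma peval_integrable :
  (mu_lim phi).-integrable setT (fun z => (complex.Re (peval P z))%:E) /\
  (mu_lim phi).-integrable setT (fun z => (complex.Im (peval P z))%:E).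
Proof.
have [p [p' Hp]] := reim (phi / 2); have [q [q' Hq]] := reim (phi / 2 + pi / 2).
have [m1 m2] := measurableC_peval P.
split.
  exact (line_integrable m1 (fun t => (Hp t).1) (fun t => (Hq t).1)).
exact (line_integrable m2 (fun t => (Hp t).2) (fun t => (Hq t).2)).
Qed.

Lemma peval_average_estimate : exists (C : R) K, forall M, (K <= M)%N -> (0 < M)%N ->
  `|(M + M)%:R^-1 * \sum_(z <- spec (Amx (M + M) phi 0)) peval P z
     - cintegral (mu_lim phi) (peval P)| <= C%:C%C * (M + M)%:R^-1.
Proof.
have [p [p' Hp]] := reim (phi / 2); have [q [q' Hq]] := reim (phi / 2 + pi / 2).
have [m1 m2] := measurableC_peval P.
have [C1 [K1 H1]] := average_estimate phipi m1 (fun t => (Hp t).1) (fun t => (Hq t).1).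
have [C2 [K2 H2]] := average_estimate phipi m2 (fun t => (Hp t).2) (fun t => (Hq t).2).
exists (C1 + C2), (maxn K1 K2) => M; rewrite geq_max => /andP[KM1 KM2] M0.
have h1 := H1 M KM1 M0; have h2 := H2 M KM2 M0.
have E : ((M + M)%:R : R[i])^-1 = ((M + M)%:R^-1 : R)%:C%C by rewrite fmorphV rmorph_nat.
apply: (le_trans (normC_le_ReIm _)); rewrite E -rmorphM lecR.
rewrite mulrDl; apply: lerD.
  apply: le_trans h1; rewrite le_eqVlt; apply/orP; left; apply/eqP; congr (`|_|).
  rewrite -Re_sum /cintegral; case: (\sum_(z <- _) _) => x y /=.
  by rewrite mul0r subr0.
apply: le_trans h2; rewrite le_eqVlt; apply/orP; left; apply/eqP; congr (`|_|).
rewrite -Im_sum /cintegral; case: (\sum_(z <- _) _) => x y /=.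
by rewrite mul0r addr0.
Qed.

End TestFunctions.
End PolynomialTest.

Theorem theorem1p5 (R : realType) (phi : R) (hphi : - pi <= phi <= pi) :
  (forall N : nat, (0 < N)%N -> ~~ odd N -> mu_spec N phi setT = 1%E) /\
  mu_lim phi setT = 1%E /\
  weak_cvg (fun N => mu_spec N phi) even_oo (mu_lim phi) /\
  (\int[lebesgue_measure]_t gdens (aplus phi) t = (1 - `|phi| / pi)%:E)%E /\
  (\int[lebesgue_measure]_t gdens (aminus phi) t = (`|phi| / pi)%:E)%E /\
  (forall a : R, a = aplus phi \/ a = aminus phi ->
    (0 < a -> supp (gmeasure a) = `[- (2 * a), 2 * a]%classic) /\
    (a = 0 ->
      (forall A, measurable A -> gmeasure a A = 0%E) /\
      supp (gmeasure a) = set0)) /\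
  (forall P : {poly {poly R[i]}},
    (mu_lim phi).-integrable setT (fun z => (complex.Re (peval P z))%:E) /\
    (mu_lim phi).-integrable setT (fun z => (complex.Im (peval P z))%:E) /\
    (fun N : nat => N%:R^-1 * \sum_(z <- spec (Amx N phi 0)) peval P z
       - cintegral (mu_lim phi) (peval P) : (R[i] : numClosedFieldType))
      =O_even_oo (fun N : nat => N%:R^-1 : (R[i] : numClosedFieldType))) /\
  (aplus (pi / 2 : R) = (Num.sqrt 2)^-1 /\
   aminus (pi / 2 : R) = (Num.sqrt 2)^-1 /\
   gdens (aplus (pi / 2 : R)) = gdens (aminus (pi / 2 : R))).
Proof.
(* Even integers are handled as N = M + M; the threshold also excludes N = 0. *)
have even_ooP (Q : nat -> Prop) K : (forall M, (K <= M)%N -> (0 < M)%N -> Q (M + M)%N) ->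
    \forall N \near even_oo, Q N.
  move=> HQ; exists (maxn (K + K) 1) => // N /=; rewrite geq_max => /andP[KN N0] eN.
  have NE : N = (N./2 + N./2)%N.
    by rewrite addnn -[LHS]odd_double_half (negbTE eN).
  by rewrite NE; apply: HQ; lia.
have aplus_le1 : aplus phi <= 1 by exact: cos_le1.
have aminus_le1 : aminus phi <= 1 by exact: sin_le1.
have pihalf : 0 <= pi / 2 :> R by rewrite divr_ge0 // pi_ge0.
have aphalf : aplus (pi / 2 : R) = (Num.sqrt 2)^-1.
  rewrite /aplus ger0_norm //; have c2 : cos (pi / 2 / 2) ^+ 2 *+ 2 = 1 :> R.
    have := cos_mulr2n (pi / 2 / 2 : R).
    rewrite (_ : (pi / 2 / 2) *+ 2 = pi / 2 :> R); last by rewrite -mulr_natr; move: (pi : R) => P; field.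
    by rewrite cos_pihalf => /esym/eqP; rewrite subr_eq0 => /eqP.
  have c0 : 0 <= cos (pi / 2 / 2 : R).
    by apply: cos_ge0_pihalf; have := pi_ge0 R; move: (pi : R) => P *; apply/andP; split; lra.
  rewrite -sqrtrV // -[LHS]ger0_norm // -sqrtr_sqr; congr Num.sqrt.
  by move: c2; rewrite -mulr_natr; move: (_ ^+ 2) => x; lra.
have amhalf : aminus (pi / 2 : R) = (Num.sqrt 2)^-1.
  rewrite -aphalf /aminus /aplus ger0_norm // -cosBpihalf -cosN; congr cos.
  by move: (pi : R) => P; field.
split; first by move=> N N0 _; exact: mu_spec_setT.
split.
  transitivity (gmeasure (aplus phi) setT + gmeasure (aminus phi) setT)%E.
    exact: measure_addE.
  by rewrite (gmeasure_plus_setT hphi) (gmeasure_minus_setT hphi) -EFinD subrK.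
split.
  move=> f cf bf; apply/cvgrPdist_le => e e0.
  have mf : measurable_fun [set: borelC R] f by exact: continuous_measurable_borelC.
  have [K HK] := weak_average hphi cf bf e0.
  apply: (even_ooP _ K) => M KM M0.
  by rewrite Rintegral_mu_spec // distrC; exact: HK.
split; first exact: (gmeasure_plus_setT hphi).
split; first exact: (gmeasure_minus_setT hphi).
split.
  move=> a aE; split=> [a0|->].
    by apply: supp_gmeasure; rewrite a0 /=; case: aE => ->.
  by split=> [A mA|]; [rewrite gmeasure_eq0 | rewrite supp_gmeasure0].
split; last by rewrite aphalf amhalf.
move=> P; have [h1 h2] := peval_integrable hphi P; split; first exact: h1.
split; first exact: h2.
have [C [K HC]] := peval_average_estimate hphi P.
apply/eqO_exP.
(* The constant has to be positive, which |C| alone need not be. *)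
exists (`|C| + 1)%:C%C; first by rewrite ltcR ltr_wpDl.
apply: (even_ooP _ K) => M KM M0.
apply: (le_trans (HC M KM M0)).
have n0 : 0 <= ((M + M)%:R : R[i])^-1 by rewrite invr_ge0 ler0n.
rewrite (ger0_norm n0); apply: ler_wpM2r => //.
by rewrite lecR (le_trans (ler_norm C)) // lerDl.
Qed.
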